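(* For every $\delta>0$ and every $\eta_0>0$ there is a constant $A$ depending only on $\eta_0$ and $\delta$ such that the following holds. Let $n\ge 1$ be an integer, $p$ a prime with $p\le e^{n^{1/13}}$, and $\mu$ a probability distribution on $\mathbb{F}_p$ with $\eta:=1-\max_{x\in\mathbb{F}_p}\mu(x)=\eta_0$. Let $f(x)=\sum_{i=0}^n\varepsilon_i x^i\in\mathbb{F}_p[x]$ with $\varepsilon_0,\dots,\varepsilon_n$ independent with distribution $\mu$, and let $\overline{f}$ be a uniformly random monic polynomial of degree $n$ in $\mathbb{F}_p[x]$. Then $$d_{TV}\left((N'_i(f))_{1\le i\leq n^{\frac1{13}-\delta}},\,(N'_i(\overline{f}))_{1\le i\leq n^{\frac1{13}-\delta}}\right)\le A\,n^{-3\delta}.$$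
   Context: For a nonzero polynomial $g$ over a finite field, $N'_i(g)$ denotes the number of monic irreducible factors of $g$ of degree $i$, counted with multiplicity, where the irreducible factor $x$ is always excluded (so $N_1'$ does not count factors of $x$); by convention $N'_i(0)=0$. $d_{TV}(X,Y)=\sup_A|\mathbb{P}(X\in A)-\mathbb{P}(Y\in A)|$ is the total variation distance between the laws of $X$ and $Y$. *)

(* Defs.v *)
From HB Require Import structures.
From mathcomp Require Import all_boot all_order all_algebra.
From mathcomp Require Import all_classical all_reals all_analysis.

Set Implicit Arguments.
Unset Strict Implicit.
Unset Printing Implicit Defensive.

Import Order.TTheory GRing.Theory Num.Theory.

Local Open Scope classical_set_scope.
Local Open Scope ring_scope.

(* A copy of T with the sigma-algebra of all its subsets; the additive structure
   of T only provides the point 0 that measurable types are required to have. *)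
Definition discrete (T : Type) : Type := T.

HB.instance Definition _ (T : nmodType) := Choice.on (discrete T).
HB.instance Definition _ (T : nmodType) := isPointed.Build (discrete T) (0 : T).
HB.instance Definition _ (T : nmodType) :=
  @isMeasurable.Build default_measure_display (discrete T)
    discrete_measurable discrete_measurable0
    discrete_measurableC discrete_measurableU.

Section PolynomialFactors.
Variable F : finFieldType.

(* Largest k with q ^+ k dividing g; the bound k < size g loses nothing when
   g != 0 and q is not constant. *)
Definition multiplicity (q g : {poly F}) : nat :=
  \max_(k < size g | q ^+ k %| g) k.

Definition Nprime (i : nat) (g : {poly F}) : nat :=
  if g == 0 then 0%N else
  (\sum_(q : {poly_(i.+1) F} | [&& polyn q \is monic, size (polyn q) == i.+1,
                                  irreducibleb (polyn q) & polyn q != 'X])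
     multiplicity (polyn q) g)%N.

(* Coordinate j : 'I_m is the number of factors of degree j + 1. *)
Definition Nprimes (m : nat) (g : {poly F}) : discrete {ffun 'I_m -> nat} :=
  [ffun j : 'I_m => Nprime j.+1 g].

End PolynomialFactors.

(* Since the B i may be the whole space, the product rule for all n sets at once
   contains the product rules for all subfamilies. *)
Definition mutually_independent (R : realType) (d d' : measure_display)
    (Omega : measurableType d) (T : measurableType d') (P : probability Omega R)
    (n : nat) (X : 'I_n -> {RV P >-> T}) : Prop :=
  forall B : 'I_n -> set T, (forall i, measurable (B i)) ->
    P (\bigcap_(i in [set: 'I_n]) (X i @^-1` B i)) =
    (\prod_(i < n) P (X i @^-1` B i))%E.

Definition dTV (R : realType) (d : measure_display) (T : measurableType d)
    (mu nu : set T -> \bar R) : R :=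
  sup [set `|fine (mu A) - fine (nu A)| | A in measurable].

Definition eta (R : realType) (p : nat) (mu : probability (discrete 'F_p) R) : R :=
  1 - \big[Num.max/0]_(x : 'F_p) fine (mu [set x]).

Definition random_poly (R : realType) (d : measure_display)
    (Omega : measurableType d) (P : probability Omega R) (F : finFieldType)
    (n : nat) (eps : 'I_n.+1 -> {RV P >-> discrete F}) (w : Omega) : {poly F} :=
  \sum_(i < n.+1) (eps i w : F) *: 'X^i.

(* There are #|F| ^ n monic polynomials of degree n. *)
Definition uniform_monic (R : realType) (d : measure_display)
    (Omega : measurableType d) (P : probability Omega R) (F : finFieldType)
    (n : nat) (g : {RV P >-> discrete {poly F}}) : Prop :=
  forall h : {poly F},
    P (g @^-1` [set h]) =
    (if (h \is monic) && (size h == n.+1) then (#|F| ^ n)%:R^-1 else 0)%:E.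

(* Main.v *)
(* Let D be about m log n.  A Bonferroni sieve, truncated by Rankin's trick after
   O(log n) prime factors, reduces the comparison of the two count vectors to the
   estimate P(Q | f) = p^(-deg Q) + O(p^(-2D)) for all Q of degree at most D whose prime
   factors are not exceptional, plus a bound on the probability of having an
   exceptional factor.

   By Fourier inversion on F_p[x]/(Q) the estimate holds once, for every nonzero linear
   form psi on F_p[x]/(Q), the sequence psi(x^i) is far from 0 in F_p for many i <= n.
   Suppose on the contrary that its centered lift y is small on a long window.  By
   pigeonhole Q divides mod p some G with coefficients in {-1, 0, 1} and degree less than
   L = O(D log p), and smallness makes G annihilate y over the integers.  For a prime
   l > 2L, G(x^l) = G^l mod l, so G(x^l)^k y is divisible by l^k while it is bounded by
   L^k max|y|; hence it vanishes for k about log p.  Thus the roots alpha of some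
   irreducible factor of Q have all alpha^l among the fewer than L roots of G.  With more
   than L such primes l up to K = O(L log L), two powers coincide, and alpha is a root of
   unity of order at most K: the factor divides x^t - 1 with 0 < t <= K.  These factors are
   declared exceptional; there are at most K^2 of them, each dividing f with probability
   O(1/p + 1/sqrt n).  When p is so small that 1/p^2 already is a sufficient lower bound
   for the squared distance of psi(x^i)/p to 0, nothing has to be declared exceptional. *)

From HB Require Import structures.
Require Import Defs.
From mathcomp Require Import all_boot all_order all_algebra all_field.
From mathcomp Require Import zify ring lra.

Set Implicit Arguments.
Unset Strict Implicit.
Unset Printing Implicit Defensive.

Import Order.TTheory GRing.Theory Num.Theory.

(** * Many primes in a short range *)

(** The exponents come from one budget. Put X = n^(1/13), U = n^(-delta) and ignore powers of log n:
    m <= X U and log p <= X make D about X U, L and K about X^2 U, and the windows of length W about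
    K L log p, that is X^5 U^2. Each window contributes L^(-2) to a Fourier exponent that must reach
    a multiple of L, so L^3 W, about X^11 U^5, has to stay below n = X^13. The bound 1/p^2 per
    stretch of length D is insufficient only if n <= C D L p^2, and then (K^2/p)^2 <= C K^4 D L / n
    is about X^(-2) U^6. This gives the rate U^3 = n^(-3 delta), and the spare X^2 pays for the
    logarithms.

    The error in P(Q | f) must be exponentially small in D log p because the sieve adds it over
    exponent vectors and subsets whose number is only bounded through powers of the smallest prime
    density p^(-m).

    Leaving out the factor x makes all windows equivalent: x is invertible modulo Q, so a linear
    form that vanishes on deg Q consecutive powers of x vanishes identically. *)

Lemma expn2_le_central_bin n : 2 ^ n <= 'C(n.*2, n).
Proof.
elim: n => [|n IH]; first by rewrite bin0.
rewrite doubleS binS; case: n IH => // n IH.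
rewrite expnS; move: IH; set m := n.+1.*2; rewrite (binS m n.+1) (binS m n); lia.
Qed.

(** In Legendre's formula the [k]-th term for [2n] exceeds twice that for [n] by at most 1, and by 0
    once [p ^ k] exceeds [2n]. *)
Lemma expn_logn_central_bin p n : prime p -> 0 < n -> p ^ logn p 'C(n.*2, n) <= n.*2.
Proof.
move=> pp n0; have p1 := prime_gt1 pp.
have n20 : 0 < n.*2 by rewrite double_gt0.
have nn : n <= n.*2 by rewrite -addnn leq_addr.
apply: leq_trans (trunc_logP p1 n20); rewrite leq_exp2l //.
have := bin_fact nn; rewrite -{2}addnn addnK => /(congr1 (logn p)).
have b0 : 0 < 'C(n.*2, n) by rewrite bin_gt0.
rewrite !lognM ?fact_gt0 ?muln_gt0 ?fact_gt0 // !logn_fact // => e.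
have e2 : \sum_(1 <= k < n.+1) n %/ p ^ k = \sum_(1 <= k < n.*2.+1) n %/ p ^ k.
  rewrite [RHS](@big_cat_nat _ _ _ n.+1) //=.
  rewrite [X in _ = _ + X]big_nat_cond [X in _ = _ + X]big1 ?addn0 // => k.
  rewrite andbT => /andP[nk _]; rewrite divn_small //.
  by apply: ltn_trans nk _; apply: ltn_expl.
rewrite e2 in e.
set t := trunc_log p n.*2.
have : \sum_(1 <= k < n.*2.+1) n.*2 %/ p ^ k <=
  \sum_(1 <= k < n.*2.+1) ((n %/ p ^ k).*2 + (k <= t)).
  rewrite leq_sum // => k _; case: (leqP k t) => kt.
    have pk : 0 < p ^ k by rewrite expn_gt0 prime_gt0.
    by rewrite -ltnS ltn_divLR //; have := divn_eq n (p ^ k); have := ltn_pmod n pk; nia.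
  by rewrite divn_small // ltnNge; apply: contraTN kt => /(trunc_log_max p1); lia.
rewrite big_split /=.
have -> : \sum_(1 <= k < n.*2.+1) (n %/ p ^ k).*2 = (\sum_(1 <= k < n.*2.+1) n %/ p ^ k).*2.
  by rewrite -[RHS]muln2 big_distrl /=; apply: eq_bigr => k _; rewrite muln2.
suff : \sum_(1 <= k < n.*2.+1) (k <= t) <= t by lia.
have tn : t <= n.*2 by rewrite -(leq_exp2l _ _ p1) (leq_trans (trunc_logP p1 n20)) // ltnW // ltn_expl.
rewrite (@big_cat_nat _ _ _ t.+1) //= [X in _ + X <= _]big_nat_cond [X in _ + X <= _]big1 ?addn0.
  apply: leq_trans (_ : \sum_(1 <= k < t.+1) 1 <= _).
    by apply: leq_sum => k _; case: (k <= t).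
  by rewrite sum_nat_const_nat muln1; lia.
by move=> k; rewrite andbT => /andP[tk _]; rewrite leqNgt tk.
Qed.

Lemma prime_dvd_fact p n : prime p -> p %| n`! -> p <= n.
Proof.
move=> pp; elim: n => [|n IH]; first by rewrite dvdn1 => /eqP p1; rewrite p1 in pp.
by rewrite factS Euclid_dvdM // => /orP[/dvdn_leq->|/IH/leqW].
Qed.

(** Chebyshev's argument: the prime powers that make up the central binomial coefficient are all at
    most [n.*2]. *)
Lemma expn2_le_primes n : 0 < n ->
  exists ls : seq nat, [/\ uniq ls, forall l, l \in ls -> prime l /\ l <= n.*2 &
    2 ^ n <= n.*2 ^ size ls].
Proof.
move=> n0; have nn : n <= n.*2 by rewrite -addnn leq_addr.
have b0 : 0 < 'C(n.*2, n) by rewrite bin_gt0.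
exists (primes 'C(n.*2, n)); split; first exact: primes_uniq.
- move=> l; rewrite mem_primes => /and3P[lp _ lb]; split=> //.
  by apply: prime_dvd_fact lp _; rewrite -(bin_fact nn) dvdn_mulr.
- apply: leq_trans (expn2_le_central_bin n) _.
  rewrite {1}(prod_prime_decomp b0) prime_decompE big_map /= big_seq.
  apply: leq_trans (_ : \prod_(i <- primes 'C(n.*2, n) | i \in primes 'C(n.*2, n)) n.*2 <= _).
    apply: leq_prod => l; rewrite mem_primes => /and3P[lp _ _].
    exact: expn_logn_central_bin.
  by rewrite -big_seq big_const_seq count_predT iter_muln_1.
Qed.

(* With n = 24 L lam one has (2n)^(3L) < 2^n, so more than 3L primes are at most 2n. *)
Lemma many_primes L : 0 < L ->
  exists ls : seq nat, [/\ uniq ls, L <= size ls &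
    forall l, l \in ls -> [/\ prime l, L.*2 <= l & l <= 48 * L * (trunc_log 2 L).+1]].
Proof.
move=> L0; set lam := (trunc_log 2 L).+1.
have Llam : L < 2 ^ lam by apply: trunc_log_ltn.
have n0 : 0 < 24 * L * lam by rewrite !muln_gt0 L0.
have [ls [uls lsP hs]] := expn2_le_primes n0.
exists [seq l <- ls | L.*2 <= l]; split; first exact: filter_uniq.
- have s3 : 3 * L < size ls.
    rewrite ltnNge; apply/negP => sl.
    have : 2 ^ (24 * L * lam) < 2 ^ (24 * L * lam).
      apply: leq_ltn_trans hs _.
      apply: leq_ltn_trans (_ : (2 ^ (8 * lam).-1) ^ (3 * L) < _); last first.
        by rewrite -expnM ltn_exp2l //; nia.
      apply: leq_trans (_ : (24 * L * lam).*2 ^ (3 * L) <= _).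
        by rewrite leq_pexp2l // double_gt0.
      rewrite leq_exp2r ?muln_gt0 //.
      have l1 : lam <= 2 ^ lam.-1 by rewrite /lam /=; apply: ltn_expl.
      have e : 2 ^ (8 * lam).-1 = 2 ^ 6 * (2 ^ lam * (2 ^ lam.-1 * 2 ^ (6 * lam - 6))).
        by rewrite -!expnD; congr (2 ^ _); rewrite /lam; lia.
      have c0 : 0 < 2 ^ (6 * lam - 6) by rewrite expn_gt0.
      have AB : L * lam <= 2 ^ lam * 2 ^ lam.-1 by rewrite leq_mul // ltnW.
      apply: (@leq_trans (2 ^ 6 * (L * lam))); first by lia.
      rewrite e; apply: leq_mul => //; apply: leq_mul; first exact: ltnW.
      by apply: leq_trans l1 _; rewrite leq_pmulr.
    by rewrite ltnn.
  (* At most [L.*2] of the more than [3 * L] primes lie below [L.*2], so at least [L] survive the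
     filter. *)
  have : count (fun l => ~~ (L.*2 <= l)) ls <= L.*2.
    rewrite -size_filter -[leqRHS](size_iota 0); apply: uniq_leq_size.
      exact: filter_uniq.
    by move=> l; rewrite mem_filter mem_iota -ltnNge => /andP[].
  have := count_predC (fun l => L.*2 <= l) ls; rewrite size_filter.
  have -> : count (predC (fun l => L.*2 <= l)) ls = count (fun l => ~~ (L.*2 <= l)) ls by [].
  by lia.
- move=> l; rewrite mem_filter => /andP[Ll /lsP[lp ln]]; split=> //.
  by move: ln; lia.
Qed.

Local Open Scope ring_scope.

(** * Linear forms with small values on the powers of x *)

Lemma scalar_poly_expand (R : comNzRingType) (psi : {scalar {poly R}}) (h g : {poly R}) n :
  (size h <= n)%N -> psi (h * g) = \sum_(i < n) h`_i * psi ('X^i * g).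
Proof.
move=> hn.
have -> : h = \poly_(i < n) h`_i.
  apply/polyP => i; rewrite coef_poly; case: ltnP => // ni.
  by rewrite nth_default // (leq_trans hn).
rewrite {1}poly_def mulr_suml raddf_sum /=; apply: eq_bigr => i _.
by rewrite -scalerAl scalarZ coef_poly ltn_ord.
Qed.

Section Annihilator.
Variables (F : fieldType) (psi : {scalar {poly F}}) (Q : {poly F}).
Hypothesis psiQ : forall g, psi (Q * g) = 0.

(** Equivalently, the sequence [psi 'X^i] satisfies the linear recurrence with the coefficients of
    [h]. *)
Definition annihilates (h : {poly F}) := forall g, psi (g * h) = 0.

(** As [x] is invertible modulo [Q], the classes of any [deg Q] consecutive powers of [x] span
    F[x]/(Q). *)
Lemma annihilates_window i h :
  coprimep Q 'X -> (forall j, (j < (size Q).-1)%N -> psi ('X^(i + j) * h) = 0) ->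
  annihilates h.
Proof.
move=> cQX hw g.
have : coprimep Q 'X^i by apply: coprimep_expr.
case/Bezout_eq1_coprimepP => -[u v] /= uv.
have -> : g * h = Q * (u * g * h) + (g * v) * ('X^i * h).
  by rewrite -[LHS]mul1r -uv; ring.
rewrite raddfD /= psiQ add0r {1}(divp_eq (g * v) Q) mulrDl raddfD /=.
rewrite -mulrA mulrCA psiQ add0r.
have [Q0|Q0] := eqVneq Q 0.
  move: cQX; rewrite Q0 coprime0p => /eqp_size; rewrite size_polyX size_poly1; lia.
rewrite (@scalar_poly_expand _ _ _ _ (size Q).-1); last first.
  by rewrite -ltnS prednK ?ltn_modp // lt0n size_poly_eq0.
rewrite big1 // => j _; rewrite mulrA -exprD addnC hw ?mulr0 //.
Qed.

Lemma annihilates_gcd h1 h2 :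
  annihilates h1 -> annihilates h2 -> annihilates (gcdp h1 h2).
Proof.
move=> a1 a2 g.
have [[u v] /= /eqpP [[c1 c2] /= /andP[c1n c2n] e]] := Bezoutp h1 h2.
have -> : gcdp h1 h2 = (c2^-1 * c1) *: (u * h1 + v * h2).
  by rewrite -scalerA e scalerA mulVf // scale1r.
rewrite -scalerAr scalarZ mulrDr raddfD /= !mulrA a1 a2 addr0 mulr0 //.
Qed.

(** The annihilating polynomials form an ideal containing [Q] but, as [psi] is nonzero, no unit. The
    gcd of [Q] and all of [hs] lies in it, hence is not constant. *)
Lemma annihilates_common_factor (hs : seq {poly F}) :
  Q != 0 -> (exists g, psi g != 0) -> (forall h : {poly F}, h \in hs -> annihilates h) ->
  exists2 h : {poly F}, (1 < size h)%N & (h %| Q) /\ forall h' : {poly F}, h' \in hs -> h %| h'.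
Proof.
move=> Q0 [g0 g0n] hsA.
have aQ : annihilates Q by move=> g; rewrite mulrC psiQ.
pose h := foldr (@gcdp F) Q hs.
have [hA hQ] : annihilates h /\ h %| Q.
  rewrite /h; elim: hs hsA {h} => [|a s IH] hsA /=; first by rewrite dvdpp.
  have [|sA sQ] := IH; first by move=> b bs; apply: hsA; rewrite inE bs orbT.
  split; first by apply: annihilates_gcd => //; apply: hsA; rewrite inE eqxx.
  exact: dvdp_trans (dvdp_gcdr _ _) sQ.
exists h; last first.
  split=> // h' {hsA hA hQ}; rewrite /h; elim: hs {h} => // a s IH /=.
  rewrite inE => /orP[/eqP->|/IH]; first exact: dvdp_gcdl.
  by apply: dvdp_trans; apply: dvdp_gcdr.
have hn0 : h != 0 by apply: contraNneq Q0 => h0; rewrite h0 dvd0p in hQ.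
rewrite ltnNge; apply/negP => h1.
have /size_poly1P[c cn hc] : size h == 1%N.
  by rewrite eqn_leq h1 lt0n size_poly_eq0.
move: (hA (c^-1 *: g0)); rewrite hc mulrC mul_polyC scalerA divff // scale1r.
by move/eqP; rewrite (negPf g0n).
Qed.
End Annihilator.

(** * Lifting to the integers and contraction *)

Lemma frobenius_poly l (g : nat -> int) L : prime l ->
  exists H : {poly int},
    \poly_(j < L) g j \Po 'X^l = (\poly_(j < L) g j) ^+ l + l%:Z *: H.
Proof.
move=> lp.
have chl : l \in [pchar {poly 'F_l}] by rewrite pchar_poly pchar_Fp.
set G := \poly_(j < L) g j.
pose D := G \Po 'X^l - G ^+ l.
have D0 : map_poly (intr : int -> 'F_l) D = 0.
  rewrite rmorphB /= map_comp_poly map_polyXn rmorphXn /=.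
  set G' := map_poly _ G.
  rewrite -(pFrobenius_autE chl G') -[G']coefK poly_def !rmorph_sum -sumrB big1 //=.
  move=> i _; rewrite linearZ /= pFrobenius_autE exprZn comp_Xn_poly.
  have -> : (G'`_i) ^+ l = G'`_i.
    by have := expf_card (G'`_i); rewrite card_Fp.
  by rewrite -!exprM mulnC subrr.
(* Every coefficient of [D] is a multiple of [l], so this division is exact. *)
exists (map_poly (fun c => (c %/ l%:Z)%Z) D).
apply/eqP; rewrite addrC -subr_eq; apply/eqP; rewrite -/D.
apply/polyP => i; rewrite coefZ coef_map_id0 ?div0z //.
rewrite mulrC divzK //.
have := congr1 (fun q : {poly 'F_l} => q`_i) D0.
rewrite coef_map coef0 => /eqP.
by by move=> e; rewrite (@dvdz_pcharf _ l (pchar_Fp lp)).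
Qed.

(** Sends [x^i] to [y i] for [i < N] and to 0 beyond: a sequence known only on a window can then be
    paired with polynomials over the integers, where no modulus [Q] is at hand. *)
Definition window_form (R : comNzRingType) N (y : nat -> R) (h : {poly R}) : R :=
  \sum_(i < N) h`_i * y i.

Lemma window_form_is_scalar (R : comNzRingType) N (y : nat -> R) :
  scalar (window_form N y).
Proof.
move=> a u v; rewrite /window_form mulr_sumr -big_split /=; apply: eq_bigr => i _.
by rewrite coefD coefZ mulrDl mulrA.
Qed.

HB.instance Definition _ (R : comNzRingType) N (y : nat -> R) :=
  GRing.isLinear.Build R {poly R} R *%R (window_form N y) (window_form_is_scalar N y).

Lemma window_formXn (R : comNzRingType) N (y : nat -> R) i :
  window_form N y 'X^i = if (i < N)%N then y i else 0.
Proof.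
rewrite /window_form; case: ltnP => iN.
  rewrite (bigD1 (Ordinal iN)) //= coefXn eqxx mul1r big1 ?addr0 // => j ji.
  by rewrite coefXn; case: eqP => e; rewrite ?mul0r //; case/eqP: ji; apply: val_inj.
rewrite big1 // => j _; rewrite coefXn; case: eqP => e; rewrite ?mul0r //.
by move: (ltn_ord j); rewrite e; lia.
Qed.

(* With Ga = G(x^l) = G^l + l H one has Ga^k = (l H)^k modulo G, and G annihilates y:
   the value is divisible by l^k, but it is at most L^k M < l^k. *)
Lemma contraction (L l k N : nat) (M : int) (g y : nat -> int) :
  prime l -> (L.*2 <= l)%N -> (forall j, `|g j| <= 1) ->
  (forall i, `|y i| <= M) -> M < 2 ^+ k ->
  (forall i, (i + L <= N)%N -> \sum_(j < L) g j * y (i + j)%N = 0) ->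
  forall i, (i + k * l * L + L < N)%N ->
  window_form N y ('X^i * ((\poly_(j < L) g j) \Po 'X^l) ^+ k) = 0.
Proof.
move=> lp Ll g1 yM Mk gy i iN.
set Y : {scalar {poly int}} := window_form N y; set G := \poly_(j < L) g j.
set Ga := G \Po 'X^l.
have M0 : 0 <= M by apply: le_trans (yM 0%N).
have c : L%:Z ^+ k * M < l%:Z ^+ k.
  have [L0|L0] := posnP L.
    rewrite L0; case: (k) Mk => [|k'] Mk; first by rewrite !expr0 mul1r.
    by rewrite exprS mul0r mul0r exprn_gt0 // ltz_nat prime_gt0.
  apply: lt_le_trans (_ : (L%:Z * 2) ^+ k <= _).
    by rewrite exprMn ltr_pM2l // exprn_gt0.
  by rewrite lerXn2r ?nnegrE //; lia.
have GaE : Ga = \sum_(j < L) g j *: 'X^(l * j).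
  rewrite /Ga /G poly_def raddf_sum /=; apply: eq_bigr => j _.
  by rewrite linearZ /= comp_Xn_poly -exprM.
have YGX a : (a + L <= N)%N -> Y ('X^a * G) = 0.
  move=> aN; rewrite mulrC (@scalar_poly_expand _ _ _ _ L) ?size_poly // -[RHS](gy _ aN).
  apply: eq_bigr => j _; rewrite coef_poly ltn_ord; congr (_ * _).
  by rewrite -exprD /Y/= window_formXn ifT 1?addnC //; have := ltn_ord j; lia.
have YG n (h : {poly int}) : (size h <= n)%N -> (n + L <= N.+1)%N -> Y (h * G) = 0.
  move=> hn nN; rewrite (@scalar_poly_expand _ _ _ _ n) // big1 // => a _.
  by rewrite YGX ?mulr0 //; have := ltn_ord a; lia.
(* Multiplication by [Ga] is a combination of [L] shifts with coefficients bounded by 1, so it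
   multiplies the supremum by at most [L]. *)
have Ybound t a : `|Y ('X^a * Ga ^+ t)| <= L%:Z ^+ t * M.
  elim: t a => [|t IH] a.
    rewrite expr0 mulr1 mul1r /Y/= window_formXn; case: ifP => _; first exact: yM.
    by rewrite normr0.
  rewrite exprS {1}GaE mulr_suml mulr_sumr raddf_sum /=.
  apply: le_trans (ler_norm_sum _ _ _) _.
  have -> : L%:Z ^+ t.+1 * M = \sum_(j < L) (L%:Z ^+ t * M).
    by rewrite sumr_const card_ord exprS -mulrA -mulr_natl natz.
  apply: ler_sum => j _; rewrite -scalerAl -scalerAr scalarZ normrM mulrA -exprD.
  by rewrite -[leRHS]mul1r ler_pM // IH.
have [H HE] := frobenius_poly g L lp; rewrite -/G -/Ga in HE.
have szGl : (size (G ^+ l) <= (l * L).+1)%N.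
  apply: leq_trans (size_poly_exp_leq _ _) _; rewrite ltnS mulnC leq_mul //.
  by apply: leq_trans (leq_pred _) (size_poly _ _).
have szGa : (size Ga <= (l * L).+1)%N.
  apply: leq_trans (size_comp_poly_leq _ _) _; rewrite size_polyXn /= ltnS mulnC leq_mul //.
  by apply: leq_trans (leq_pred _) (size_poly _ _).
have szH : (size (l%:Z *: H) <= (l * L).+1)%N.
  have -> : l%:Z *: H = Ga - G ^+ l by rewrite HE addrC addKr.
  by apply: leq_trans (size_polyD _ _) _; rewrite size_polyN geq_max szGa.
have szpow (h : {poly int}) : (size h <= (l * L).+1)%N -> (size (h ^+ k) <= (k * l * L).+1)%N.
  move=> hs; apply: leq_trans (size_poly_exp_leq _ _) _.
  by rewrite ltnS -mulnA mulnC leq_mul //; lia.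
(* The cofactor of [Ga - l H] in [Ga^k - (l H)^k]; since [Ga - l H = G^l], the difference is a
   multiple of [G]. *)
pose S := \sum_(j < k) Ga ^+ (k.-1 - j) * (l%:Z *: H) ^+ j.
pose T := 'X^i * (G ^+ l.-1 * S).
have TE : T * G = 'X^i * (Ga ^+ k - (l%:Z *: H) ^+ k).
  rewrite subrXX -/S.
  have -> : Ga - l%:Z *: H = G * G ^+ l.-1.
    by rewrite HE addrK -exprS prednK // prime_gt0.
  by rewrite /T; ring.
have YT : Y (T * G) = 0.
  have [->|nz] := eqVneq (T * G) 0; first by rewrite raddf0.
  move: (nz); rewrite mulf_eq0 negb_or => /andP[Tn Gn].
  have sT : (size T <= size (T * G)%R)%N.
    rewrite (size_mul Tn Gn); move: Gn; rewrite -size_poly_gt0.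
    by case: (size G) => // s _; rewrite addnS leq_addr.
  apply: (YG (i + (k * l * L).+1)%N); last by lia.
  apply: leq_trans sT _; rewrite TE.
  apply: leq_trans (size_polyMleq _ _) _; rewrite size_polyXn /= leq_add2l.
  by apply: leq_trans (size_polyD _ _) _; rewrite size_polyN geq_max !szpow.
have key : Y ('X^i * Ga ^+ k) = l%:Z ^+ k * Y ('X^i * H ^+ k).
  rewrite -scalarZ; apply/eqP; rewrite -subr_eq0 -raddfB /=.
  by rewrite scalerAr -exprZn -mulrBr -TE YT.
have := Ybound k i; rewrite key normrM => b.
have [z0|zn] := eqVneq (Y ('X^i * H ^+ k)) 0; first by rewrite key z0 mulr0.
have z1 : 1 <= `|Y ('X^i * H ^+ k)| by rewrite -gtz0_ge1 normr_gt0.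
have e : `|l%:Z ^+ k| = l%:Z ^+ k by rewrite normrX.
nia.
Qed.

Lemma irreducible_factor (F : finFieldType) (h : {poly F}) :
  (1 < size h)%N -> exists2 q, irreducible_poly q & q %| h.
Proof.
elim: {h}(size h) {-2}h (leqnn (size h)) => [|n IH] h hn h1; first by lia.
case: (boolP (irreducibleb h)) => [/irreducibleP hi|]; first by exists h.
rewrite negb_and h1 /= => /forallPn[q]; rewrite negb_imply -ltnNge => /andP[qh q1].
have qh' : polyn q %| h by rewrite dvdpE.
have sq := size_npoly q.
have [|//|q' q'i q'q] := IH (polyn q).
  by apply: leq_trans sq _; rewrite -ltnS prednK // (ltn_trans _ h1).
by exists q' => //; apply: dvdp_trans q'q qh'.
Qed.

(** Pigeonhole on the [2 ^ L] polynomials with coefficients 0 and 1. The difference of two of them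
    stays nonzero over [F] since its coefficients are 0, 1 and -1. *)
Lemma poly_mod_collision (F : finFieldType) (Q : {poly F}) L :
  Q != 0 -> (#|F| ^ (size Q).-1 < 2 ^ L)%N ->
  exists g : nat -> int, [/\ forall j, `|g j| <= 1,
    Q %| map_poly intr (\poly_(j < L) g j) &
    map_poly intr (\poly_(j < L) g j) != 0 :> {poly F}].
Proof.
move=> Q0 hL.
pose ext (b : {ffun 'I_L -> bool}) (j : nat) : nat := oapp b false (insub j).
pose P b : {poly F} := \poly_(j < L) (ext b j)%:R.
pose phi (b : {ffun 'I_L -> bool}) : {ffun 'I_(size Q).-1 -> F} := [ffun i : 'I_ _ => (P b %% Q)`_i].
have : ~~ injectiveb phi.
  apply/negP => /injectiveP /leq_card.
  by rewrite !card_ffun !card_ord card_bool leqNgt hL.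
case/injectivePn => b [b' bb' e].
have extb c (j : 'I_L) : ext c j = c j :> nat by rewrite /ext valK.
exists (fun j => (ext b j)%:Z - (ext b' j)%:Z).
have e01 c j : (ext c j <= 1)%N by rewrite /ext; case: insub => //= a; case: (c a).
have mE : map_poly intr (\poly_(j < L) ((ext b j)%:Z - (ext b' j)%:Z)) = P b - P b'.
  apply/polyP => i; rewrite coef_map coefB !coef_poly; case: ifP => _.
    by rewrite raddfB.
  by rewrite subr0 raddf0.
split.
- by move=> j; have := e01 b j; have := e01 b' j; lia.
- rewrite mE; apply/modp_eq0P; rewrite modpD modpN; apply/eqP; rewrite subr_eq0; apply/eqP.
  apply/polyP => i; have [iQ|iQ] := ltnP i (size Q).-1.
    by have := congr1 (fun f : {ffun _ -> _} => f (Ordinal iQ)) e; rewrite !ffunE.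
  have sz (p : {poly F}) : (size (p %% Q)%R <= i)%N.
    by apply: leq_trans iQ; rewrite -ltnS prednK ?ltn_modp // lt0n size_poly_eq0.
  by rewrite !nth_default.
- rewrite mE; apply: contra bb' => /eqP P0; apply/eqP/ffunP => j.
  have := congr1 (fun p : {poly F} => p`_j) P0; rewrite coefB !coef_poly ltn_ord coef0 !extb.
  by case: (b j); case: (b' j) => //= /eqP; rewrite ?subr0 ?sub0r ?oppr_eq0 oner_eq0.
Qed.

Definition centered p (a : 'F_p) : int :=
  if (a.*2 < p)%N then (a : nat)%:Z else (a : nat)%:Z - p%:Z.

Lemma Fp_lt p (a : 'F_p) : prime p -> (a < p)%N.
Proof. by move=> pp; have := ltn_ord a; rewrite {2}Fp_cast. Qed.

Lemma centeredK p (a : 'F_p) : prime p -> (centered a)%:~R = a.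
Proof.
move=> pp; rewrite /centered; case: ifP => _.
  by rewrite -pmulrn natr_Zp.
by rewrite rmorphB /= -!pmulrn natr_Zp pchar_Fp_0 // subr0.
Qed.

Lemma centered_abs p (a : 'F_p) : prime p -> `|centered a| = minn a (p - a) :> int.
Proof. by move=> pp; have := Fp_lt a pp; rewrite /centered; case: ifP; lia. Qed.

Lemma centered_le p (a : 'F_p) : prime p -> `|centered a| <= p%:Z - 1.
Proof. by move=> pp; rewrite centered_abs //; have := Fp_lt a pp; have := prime_gt0 pp; lia. Qed.

Lemma poly_power_collision (F : finFieldType) (h g : {poly F}) (ls : seq nat) K :
  (1 < size h)%N -> coprimep h 'X -> g != 0 -> uniq ls ->
  (size g <= size ls)%N -> (forall l, l \in ls -> (l <= K)%N) ->
  (forall l, l \in ls -> exists k, h %| (g \Po 'X^l) ^+ k) ->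
  exists q t, [/\ irreducible_poly q, q %| h, (0 < t <= K)%N & q %| 'X^t - 1].
Proof.
move=> h1 hX g0 uls sg lsK lsdiv.
have [q qi qh] := irreducible_factor h1.
have [E _ [z qz _]] := irredp_FAdjoin qi.
pose inE := map_poly (in_alg E).
have rq f : q %| f -> root (inE f) z.
  by move=> /dvdpP[c ->]; rewrite /inE rmorphM rootM qz orbT.
have dvdq f : root (inE f) z -> q %| f.
  move=> rf; apply: contraLR isT => nqf.
  have : coprimep q f by rewrite irreducible_poly_coprime.
  rewrite -(coprimep_map (in_alg E)) => /coprimep_root /(_ qz); by rewrite (eqP rf) eqxx.
have z0 : z != 0.
  apply: contraTneq isT => z0.
  have : coprimep q 'X by apply: coprimep_dvdr qh _; rewrite // coprimep_sym.
  rewrite -(coprimep_map (in_alg E)) => /coprimep_root /(_ qz).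
  by rewrite map_polyX hornerX z0 eqxx.
have rg l : l \in ls -> root (inE g) (z ^+ l).
  move=> ll; have [k hk] := lsdiv _ ll.
  have := rq _ (dvdp_trans qh hk).
  rewrite /inE rmorphXn /= map_comp_poly map_polyXn !rootE horner_exp horner_comp hornerXn.
  by rewrite expf_eq0 => /andP[].
(* A nonzero [g] has at most [size g - 1] roots, fewer than [size ls]. *)
have : ~~ uniq [seq z ^+ l | l <- ls].
  apply/negP => u.
  have g0' : inE g != 0 by rewrite map_poly_eq0.
  have := max_poly_roots g0' _ u; rewrite size_map size_map_poly ltnNge sg.
  by move=> H; apply: notF; apply: H; apply/allP => _ /mapP[l ll ->]; apply: rg.
case/(uniqPn 0) => i [j [ij]]; rewrite size_map => jl.
rewrite !(nth_map 0%N) ?(ltn_trans ij) // => e.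
set a := nth 0%N ls i in e; set b := nth 0%N ls j in e.
have ab : a != b by rewrite nth_uniq ?(ltn_trans ij) // ltn_eqF.
have main c d : (c < d)%N -> (d <= K)%N -> z ^+ c = z ^+ d ->
  exists q t, [/\ irreducible_poly q, q %| h, (0 < t <= K)%N & q %| 'X^t - 1].
  move=> cd dK ecd; exists q, (d - c)%N; split=> //; first by lia.
  apply: dvdq; rewrite /inE rmorphB /= map_polyXn rmorph1 rootE !hornerE.
  rewrite subr_eq0; apply/eqP; apply: (mulfI (expf_neq0 c z0)).
  by rewrite -exprD subnKC ?(ltnW cd) // mulr1.
case: (ltngtP a b) ab => // [ltab|ltba] _.
  by apply: (main a b) => //; apply: lsK; rewrite mem_nth.
by apply: (main b a) => //; apply: lsK; rewrite mem_nth // (ltn_trans ij).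
Qed.

Lemma small_window_exceptional p (psi : {scalar {poly 'F_p}}) (Q : {poly 'F_p})
    (k L K N i0 : nat) (ls : seq nat) :
  prime p -> (forall g, psi (Q * g) = 0) -> (exists g, psi g != 0) ->
  Q != 0 -> coprimep Q 'X ->
  (p < 2 ^ k)%N -> (p ^ (size Q).-1 < 2 ^ L)%N ->
  uniq ls -> (L <= size ls)%N ->
  (forall l, l \in ls -> [/\ prime l, (L.*2 <= l)%N & (l <= K)%N]) ->
  ((size Q).-1 + k * K * L + L < N)%N ->
  (forall i, (i < N)%N -> `|centered (psi 'X^(i0 + i))| *+ L < p%:Z) ->
  exists q t, [/\ irreducible_poly q, q %| Q, (0 < t <= K)%N & q %| 'X^t - 1].
Proof.
move=> pp psiQ psin0 Q0 QX pk hL uls sls lsP hN small.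
have cF : #|'F_p| = p by rewrite card_Fp.
have [|g [g1 Qg gn0]] := @poly_mod_collision _ Q L Q0; first by rewrite cF.
set G := \poly_(j < L) g j in Qg gn0.
(* Set to 0 outside the window, so that the bound [yM] holds at every index. *)
pose y i := if (i < N)%N then centered (psi 'X^(i0 + i)) else 0.
have yE i : (i < N)%N -> ((y i)%:~R : 'F_p) = psi 'X^(i0 + i).
  by move=> iN; rewrite /y iN centeredK.
have yM i : `|y i| <= p%:Z - 1.
  by rewrite /y; case: ifP => _; [apply: centered_le|have := prime_gt0 pp; lia].
have formE (h : {poly int}) : (size h <= N)%N ->
  (window_form N y h)%:~R = psi ('X^i0 * map_poly intr h).
  move=> hN'; rewrite mulrC (@scalar_poly_expand _ _ _ _ N) ?(leq_trans (size_poly _ _)) //.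
  rewrite /window_form rmorph_sum /=; apply: eq_bigr => i _.
  by rewrite intrM yE // coef_map_id0 // -exprD addnC.
(* The sum is 0 modulo [p] because [Q] divides [G] there, and smallness keeps it below [p] in
   absolute value: it is 0 as an integer. *)
have gy i : (i + L <= N)%N -> \sum_(j < L) g j * y (i + j)%N = 0.
  move=> iL; set s := \sum_(j < L) _.
  have s0 : (s%:~R : 'F_p) = 0.
    have -> : s%:~R = psi ('X^(i0 + i) * map_poly intr G).
      rewrite mulrC (@scalar_poly_expand _ _ _ _ L); last first.
        by rewrite (leq_trans (size_poly _ _)) // size_poly.
      rewrite /s rmorph_sum /=; apply: eq_bigr => j _.
      rewrite intrM yE; last by have := ltn_ord j; lia.
      by rewrite coef_map_id0 // coef_poly ltn_ord -exprD [(j + _)%N]addnC addnA.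
    by have /dvdpP[c ->] := Qg; rewrite mulrA mulrC psiQ.
  have sb : `|s| *+ L <= (p%:Z - 1) *+ L.
    have -> : (p%:Z - 1) *+ L = \sum_(j < L) (p%:Z - 1) by rewrite sumr_const card_ord.
    rewrite -mulr_natl; apply: le_trans (_ : L%:R * \sum_(j < L) `|g j * y (i + j)%N| <= _).
      by rewrite ler_wpM2l // ler_norm_sum.
    rewrite mulr_sumr; apply: ler_sum => j _.
    have ij : (i + j < N)%N by have := ltn_ord j; lia.
    have := small _ ij; rewrite /y ij normrM mulr_natl.
    have := g1 j; move: (`|g j|) (normr_ge0 (g j)) => a a0 a1.
    move: (centered _) => c hc.
    have -> : (a * `|c|) *+ L = a * (`|c| *+ L) by rewrite mulrnAr.
    have c0 : 0 <= `|c| *+ L by rewrite mulrn_wge0.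
    nia.
  have [L0|L0] := posnP L; first by rewrite /s L0 big_ord0.
  have slt : `|s| < p%:Z.
    have : `|s| <= p%:Z - 1 by rewrite -(ler_pMn2r L0).
    lia.
  have : (p%:Z %| s)%Z by rewrite (dvdz_pcharf (pchar_Fp pp)) s0.
  case/dvdzP => c sE; move: slt; rewrite sE normrM.
  have [->|cn] := eqVneq c 0; first by rewrite mul0r.
  have : 1 <= `|c| by rewrite -gtz0_ge1 normr_gt0.
  by move=> c1; have := prime_gt0 pp; nia.
have Mk : p%:Z - 1 < 2 ^+ k.
  by have -> : 2 ^+ k = (2 ^ k)%N%:Z; [rewrite -[RHS]natz natrX|lia].
have szpow l : (size ((G \Po 'X^l) ^+ k)%R <= (k * l * L).+1)%N.
  apply: leq_trans (size_poly_exp_leq _ _) _.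
  have := size_comp_poly_leq G 'X^l; rewrite size_polyXn /=.
  have : (size G <= L)%N by apply: size_poly.
  move: (size G) (size (G \Po 'X^l)) => a b aL ba.
  rewrite ltnS -mulnA mulnC leq_mul2l; apply/orP; right.
  apply: (@leq_trans (a.-1 * l)); first by case: (b) ba.
  by rewrite mulnC leq_mul2l (leq_trans (leq_pred _) aL) orbT.
(* Vanishing on the window makes each of these annihilate [psi] globally, so they share with [Q] a
   nonconstant factor, to which the collision of powers is applied. *)
pose hs := [seq (map_poly intr G \Po 'X^l) ^+ k | l <- ls] : seq {poly 'F_p}.
have hsA (h : {poly 'F_p}) : h \in hs -> annihilates psi h.
  case/mapP => l ll ->; have [lp Ll lK] := lsP _ ll.
  apply: (@annihilates_window _ psi Q psiQ i0) => // j jQ.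
  have jN : (j + k * l * L + L < N)%N.
    by apply: leq_ltn_trans hN; rewrite leq_add2r leq_add ?(ltnW jQ) // leq_mul // leq_mul.
  have := contraction lp Ll g1 yM Mk gy jN; rewrite -/G => c0.
  have := formE ('X^j * (G \Po 'X^l) ^+ k); rewrite c0.
  rewrite rmorphM (rmorphXn _ k) /= map_comp_poly !map_polyXn mulrA -exprD => <- //.
  apply: leq_trans (size_polyMleq _ _) _; rewrite size_polyXn /=.
  by have := szpow l; move: (size _) => a; lia.
have [h h1 [hQ hdiv]] := annihilates_common_factor psiQ Q0 psin0 hsA.
have hX : coprimep h 'X by apply: coprimep_dvdr hQ _; rewrite // coprimep_sym.
have sG : (size (map_poly intr G : {poly 'F_p}) <= size ls)%N.
  by rewrite (leq_trans _ sls) // (leq_trans (size_poly _ _)) // size_poly.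
have lsK l : l \in ls -> (l <= K)%N by case/lsP.
have lsdiv l : l \in ls -> exists k', h %| (map_poly intr G \Po 'X^l) ^+ k'.
  by move=> ll; exists k; apply: hdiv; apply/mapP; exists l.
have [q [t [qi qh tK qX]]] := poly_power_collision h1 hX gn0 uls sG lsK lsdiv.
by exists q, t; split=> //; apply: dvdp_trans qh hQ.
Qed.

(** * The sieve *)

Section Bonferroni.
Variables (R : realFieldType) (T : finType).
Implicit Types S J : {set T}.

(** Inclusion-exclusion for the indicator of [S = set0], cut off at subsets of size [r]. *)
Definition alternating_count S r : R :=
  \sum_(J : {set T} | (J \subset S) && (#|J| <= r)%N) (-1) ^+ #|J|.

Lemma alternating_countS S r :
  alternating_count S r.+1 = alternating_count S r + (-1) ^+ r.+1 * ('C(#|S|, r.+1))%:R.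
Proof.
rewrite /alternating_count (bigID (fun J : {set T} => #|J| == r.+1)%N) /= addrC; congr (_ + _).
  by apply: eq_bigl => J; case: (J \subset S) => //=; lia.
rewrite (eq_bigr (fun=> (-1) ^+ r.+1)); last by move=> J /andP[_ /eqP->].
rewrite sumr_const -cards_draws mulr_natr; congr (_ *+ _).
apply: eq_card => J; rewrite [RHS]inE unfold_in.
by case: (J \subset S) => //=; lia.
Qed.

(** Pascal's rule collapses the alternating binomial sum to one term, whose sign decides from which
    side the cut-off sum bounds the indicator. *)
Lemma alternating_countE S r :
  alternating_count S r = if #|S| == 0%N then 1 else (-1) ^+ r * ('C(#|S|.-1, r))%:R.
Proof.
elim: r => [|r IH].
  rewrite /alternating_count (big_pred1 set0) => [|J].
    by rewrite cards0 expr0; case: eqP => // _; rewrite bin0 mul1r.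
  rewrite leqn0 cards_eq0 /= andbC.
  by case: eqP => //= ->; rewrite sub0set.
rewrite alternating_countS IH; case: (#|S|) => [|s] /=.
  by rewrite mulr0 addr0.
by rewrite binS natrD exprS; ring.
Qed.

Lemma alternating_count_odd S r : odd r -> alternating_count S r <= (S == set0)%:R.
Proof.
move=> ro; rewrite alternating_countE -cards_eq0; case: eqP => //= _.
by rewrite -signr_odd ro expr1 mulN1r oppr_le0.
Qed.

Lemma alternating_count_even S r : ~~ odd r -> (S == set0)%:R <= alternating_count S r.
Proof.
move=> re; rewrite alternating_countE -cards_eq0; case: eqP => //= _.
by rewrite -signr_odd (negPf re) expr0 mul1r.
Qed.
End Bonferroni.

(** * Sums over exponent vectors and subsets *)

Section Rankin.
Variables (R : realFieldType) (T : finType) (rho : T -> R) (r : nat).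
Hypothesis rho_gt0 : forall t, 0 < rho t.
Hypothesis rho_le : forall t, rho t <= 2^-1.

(* Bounds the Euler product of the 1 / (1 - z rho t) for z = 3/2, at which all sums
   over multi-indices are evaluated. *)
Definition rankin : R := \prod_t (1 + 6 * rho t).

Notation V := {ffun T -> 'I_r.+2}.
Definition weight (v : V) : nat := \sum_t v t.

(** [1 / (1 - x) <= 1 + 4 x] holds exactly up to [3 / 4], the largest value of [3 / 2 * rho t]; and
    [4 * 3 / 2] is the 6 in [rankin]. *)
Lemma geom_le n (x : R) : 0 <= x -> x <= 3 / 4 -> \sum_(j < n) x ^+ j <= 1 + 4 * x.
Proof.
move=> x0 x34; elim: n => [|n IH]; first by rewrite big_ord0; lra.
rewrite big_ord_recl expr0; under eq_bigr => i _ do rewrite /= /bump /= add1n exprS.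
rewrite -mulr_sumr; apply: le_trans (_ : 1 + x * (1 + 4 * x) <= _); last by nra.
by rewrite lerD2l ler_wpM2l.
Qed.

Lemma rankin_gt0 : 0 < rankin.
Proof. by apply: prodr_gt0 => t _; have := rho_gt0 t; lra. Qed.

Lemma sum_rankin : \sum_(v : V) \prod_t (3 / 2 * rho t) ^+ v t <= rankin.
Proof.
rewrite -(bigA_distr_bigA (fun t (j : 'I_r.+2) => (3 / 2 * rho t) ^+ j)).
apply: ler_prod => t _; have := rho_gt0 t; have := rho_le t => a b.
rewrite sumr_ge0 => [|j _]; last by rewrite exprn_ge0 //; lra.
by apply: le_trans (@geom_le _ _ _ _) _; lra.
Qed.

Lemma sum_weight_eq :
  \sum_(v : V | weight v == r.+1) \prod_t rho t ^+ v t <= (2 / 3) ^+ r.+1 * rankin.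
Proof.
apply: le_trans (_ : (2 / 3) ^+ r.+1 * \sum_(v : V) \prod_t (3 / 2 * rho t) ^+ v t <= _); last first.
  by rewrite ler_wpM2l ?sum_rankin // exprn_ge0 //; lra.
rewrite mulr_sumr [leRHS](bigID (fun v : V => weight v == r.+1)) /=.
rewrite ler_wpDr //.
  apply: sumr_ge0 => v _; rewrite mulr_ge0 ?exprn_ge0 //; first lra.
  by apply: prodr_ge0 => t _; rewrite exprn_ge0 //; have := rho_gt0 t; lra.
apply: ler_sum => v /eqP vr.
have -> : (2 / 3) ^+ r.+1 = (2 / 3 : R) ^+ weight v by rewrite vr.
rewrite /weight expr_sum -big_split /= le_eqVlt; apply/orP; left.
by apply/eqP/eq_bigr => t _; rewrite -exprMn; congr (_ ^+ _); field.
Qed.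

Lemma sum_weight_le : \sum_(v : V) \prod_t rho t ^+ v t <= rankin.
Proof.
apply: le_trans sum_rankin; apply: ler_sum => v _; apply: ler_prod => t _.
have a := rho_gt0 t; apply/andP; split; first by rewrite exprn_ge0 // ltW.
by rewrite lerXn2r ?nnegrE //; lra.
Qed.

Lemma sum_subsets (x : T -> R) : (forall t, 0 <= x t <= 3 / 2 * rho t) ->
  \sum_(J : {set T}) \prod_(t in J) x t <= rankin.
Proof.
move=> xr.
have -> : \sum_(J : {set T}) \prod_(t in J) x t = \prod_t (x t + 1).
  rewrite bigA_distr; apply: eq_bigr => J _.
  by rewrite big_mkcond.
by apply: ler_prod => t _; have := xr t; have := rho_gt0 t; lra.
Qed.

Lemma sum_subsets_eq :
  \sum_(J : {set T} | #|J| == r.+1) \prod_(t in J) rho t <= (2 / 3) ^+ r.+1 * rankin.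
Proof.
have xr t : 0 <= 3 / 2 * rho t <= 3 / 2 * rho t by have := rho_gt0 t; lra.
apply: le_trans (ler_wpM2l _ (sum_subsets xr)); last by rewrite exprn_ge0 //; lra.
rewrite mulr_sumr [leRHS](bigID (fun J : {set T} => #|J| == r.+1)) /= ler_wpDr //.
  apply: sumr_ge0 => J _; rewrite mulr_ge0 ?exprn_ge0 ?prodr_ge0 //; first lra.
  by move=> t _; have := xr t; lra.
apply: ler_sum => J /eqP <-; rewrite -prodr_const -big_split /= le_eqVlt; apply/orP; left.
by apply/eqP/eq_bigr => t _; field.
Qed.

Variable rmin : R.
Hypothesis rmin_gt0 : 0 < rmin.
Hypothesis rmin_le : forall t, rmin <= rho t.
Hypothesis rmin1 : rmin <= 1.

Lemma prod_ge_rmin (a : T -> nat) n : (\sum_t a t <= n)%N ->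
  rmin ^+ n <= \prod_t rho t ^+ a t.
Proof.
move=> an; apply: le_trans (_ : rmin ^+ (\sum_t a t) <= _).
  by rewrite ler_wiXn2l // ltW.
rewrite expr_sum; apply: ler_prod => t _; rewrite exprn_ge0 ?(ltW rmin_gt0) //=.
by rewrite lerXn2r ?nnegrE ?rmin_le ?(ltW rmin_gt0) ?(ltW (rho_gt0 t)).
Qed.

(** Each vector of weight at most [r] contributes at least [rmin ^+ r] to [sum_weight_le]. The count
    matters because every vector carries its own error [eps] in the sieve. *)
Lemma count_weight_le : (\sum_(v : V | (weight v <= r)%N) 1) * rmin ^+ r <= rankin.
Proof.
apply: le_trans sum_weight_le; rewrite mulr_suml.
rewrite [leRHS](bigID (fun v : V => (weight v <= r)%N)) /= ler_wpDr //.
  by apply: sumr_ge0 => v _; apply: prodr_ge0 => t _; rewrite exprn_ge0 // ltW.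
by apply: ler_sum => v vr; rewrite mul1r prod_ge_rmin.
Qed.

Lemma count_subsets_le : (\sum_(J : {set T} | (#|J| <= r)%N) 1) * rmin ^+ r <= rankin.
Proof.
have xr t : 0 <= rho t <= 3 / 2 * rho t by have := rho_gt0 t; lra.
apply: le_trans (sum_subsets xr); rewrite mulr_suml.
rewrite [leRHS](bigID (fun J : {set T} => (#|J| <= r)%N)) /= ler_wpDr //.
  by apply: sumr_ge0 => J _; apply: prodr_ge0 => t _; rewrite ltW.
apply: ler_sum => J Jr; rewrite mul1r.
have -> : \prod_(t in J) rho t = \prod_t rho t ^+ (t \in J).
  by rewrite big_mkcond; apply: eq_bigr => t _; case: (t \in J).
apply: (@prod_ge_rmin (fun t => t \in J : nat)); apply: leq_trans Jr.
by rewrite -sum1_card [leqRHS]big_mkcond leq_sum // => t _; case: (t \in J).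
Qed.
End Rankin.

(** * The sieve for two abstract weights *)

Section Sieve.
Variables (R : realFieldType) (T Om : finType) (X : Om -> T -> nat -> bool).
Hypothesis X0 : forall w t, X w t 0%N.
Hypothesis XS : forall w t j, X w t j.+1 -> X w t j.

(** In the application, [X w t j] says that the [j]-th power of the prime [t] divides the polynomial
    [w]. *)
Definition at_least (a : T -> nat) w := [forall t, X w t (a t)].
Definition exactly (a : T -> nat) w := [forall t, X w t (a t) && ~~ X w t (a t).+1].

Definition mass (wt : Om -> R) (A : pred Om) : R := \sum_(w | A w) wt w.

Lemma massE wt A : mass wt A = \sum_w wt w * (A w)%:R.
Proof.
rewrite /mass big_mkcond; apply: eq_bigr => w _.
by case: (A w); rewrite ?mulr1 ?mulr0.
Qed.

Variables (rho : T -> R) (r : nat) (rmin : R) (wf wu : Om -> R) (eps : R).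
Hypothesis r_odd : odd r.
Hypothesis rmin_gt0 : 0 < rmin.
Hypothesis rmin_le1 : rmin <= 1.
Hypothesis rmin_le : forall t, rmin <= rho t.
Hypothesis rho_le : forall t, rho t <= 2^-1.
Hypothesis wf_ge0 : forall w, 0 <= wf w.
Hypothesis wu_ge0 : forall w, 0 <= wu w.
Hypothesis eps_ge0 : 0 <= eps.
Hypothesis wu_at_least : forall a : T -> nat, (\sum_t a t <= r.*2.+1)%N ->
  mass wu (at_least a) = \prod_t rho t ^+ a t.
Hypothesis wf_at_least : forall a : T -> nat, (\sum_t a t <= r.*2.+1)%N ->
  `|mass wf (at_least a) - \prod_t rho t ^+ a t| <= eps.

Let rho_gt0 t : 0 < rho t. Proof. exact: lt_le_trans (rmin_le t). Qed.

Notation V := {ffun T -> 'I_r.+2}.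
Notation Z := (rankin rho).

Definition vec (v : V) (t : T) : nat := v t.

(** With [v] of weight at most [r] and [J] of size at most [r + 1], the total is at most [r.*2.+1],
    the range of the two density hypotheses. *)
Definition shift (v : V) (J : {set T}) (t : T) : nat := (v t + (t \in J))%N.

Definition overflow (v : V) w := [set t | X w t (v t).+1].

Lemma at_least_shift v J w :
  at_least (shift v J) w = at_least (vec v) w && (J \subset overflow v w).
Proof.
apply/forallP/andP => [h|[/forallP hv /subsetP hJ] t].
  split; first by apply/forallP => t; have := h t; rewrite /shift; case: (t \in J);
    rewrite ?addn1 ?addn0 // => /XS.
  by apply/subsetP => t tJ; have := h t; rewrite /shift tJ addn1 inE.
rewrite /shift; case: (boolP (t \in J)) => [/hJ|_]; first by rewrite inE addn1.
by rewrite addn0.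
Qed.

Lemma exactlyE (v : V) w : exactly (vec v) w = at_least (vec v) w && (overflow v w == set0).
Proof.
apply/forallP/andP => [h|[/forallP hv /eqP h0] t].
  split; first by apply/forallP => t; case/andP: (h t).
  by apply/eqP/setP => t; rewrite !inE; case/andP: (h t) => _ /negPf.
by rewrite hv /=; have := in_set0 t; rewrite -h0 inE => ->.
Qed.

Lemma sum_shift (wt : Om -> R) (v : V) q :
  \sum_(J : {set T} | (#|J| <= q)%N) (-1) ^+ #|J| * mass wt (at_least (shift v J)) =
  \sum_w wt w * ((at_least (vec v) w)%:R * alternating_count R (overflow v w) q).
Proof.
under eq_bigr => J _ do rewrite massE mulr_sumr.
rewrite exchange_big /=; apply: eq_bigr => w _.
rewrite /alternating_count !mulr_sumr [RHS]big_mkcond [LHS]big_mkcond /=.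
apply: eq_bigr => J _; rewrite at_least_shift [in RHS]andbC.
case: (#|J| <= q)%N => //=; case: (J \subset _); rewrite ?andbT ?andbF ?mulr0 //.
by rewrite mulrCA [_ ^+ _ * _]mulrC.
Qed.

(** Bonferroni at the even level [r + 1] bounds [wu] from above, at the odd level [r] it bounds [wf]
    from below. The extra level involves only [wu], whose densities are exact, and gives the first
    term; the common levels differ by [eps] per subset. *)
Lemma exactly_diff_le (v : V) : (weight v <= r)%N ->
  mass wu (exactly (vec v)) - mass wf (exactly (vec v)) <=
    (\prod_t rho t ^+ v t) * (\sum_(J : {set T} | #|J| == r.+1) \prod_(t in J) rho t)
    + eps * \sum_(J : {set T} | (#|J| <= r)%N) 1.
Proof.
move=> vr.
have up : mass wu (exactly (vec v)) <=
    \sum_(J : {set T} | (#|J| <= r.+1)%N) (-1) ^+ #|J| * mass wu (at_least (shift v J)).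
  rewrite sum_shift massE; apply: ler_sum => w _; rewrite ler_wpM2l // exactlyE.
  case: (at_least (vec v) w); rewrite /= ?mul0r // mul1r.
  by apply: alternating_count_even; rewrite /= r_odd.
have lo : \sum_(J : {set T} | (#|J| <= r)%N) (-1) ^+ #|J| * mass wf (at_least (shift v J))
    <= mass wf (exactly (vec v)).
  rewrite sum_shift massE; apply: ler_sum => w _; rewrite ler_wpM2l // exactlyE.
  case: (at_least (vec v) w); rewrite /= ?mul0r // mul1r.
  exact: alternating_count_odd.
have sh (J : {set T}) n : (#|J| <= n)%N -> (\sum_t shift v J t <= r + n)%N.
  move=> Jn; rewrite big_split /= leq_add //; apply: leq_trans Jn.
  by rewrite -sum1_card [leqRHS]big_mkcond leq_sum // => t _; case: (t \in J).
have prodsh (J : {set T}) : \prod_t rho t ^+ shift v J t = (\prod_t rho t ^+ v t) * \prod_(t in J) rho t.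
  rewrite [X in _ * X]big_mkcond -big_split /=; apply: eq_bigr => t _.
  by rewrite /shift exprD; case: (t \in J).
apply: le_trans (lerB up lo) _.
rewrite (bigID (fun J : {set T} => #|J| == r.+1)) /= -addrA lerD //.
  rewrite mulr_sumr big_mkcond [leRHS]big_mkcond; apply: ler_sum => J _.
  case: eqP => Jr; last by rewrite andbF.
  rewrite andbT Jr leqnn -signr_odd /= r_odd expr0 mul1r wu_at_least ?prodsh //.
  by have := sh J r.+1; rewrite Jr; lia.
rewrite (eq_bigl (fun J : {set T} => #|J| <= r)%N); last by move=> J; lia.
rewrite -sumrB mulr_sumr; apply: ler_sum => J Jr; rewrite mulr1 -mulrBr.
have s2 : (\sum_t shift v J t <= r.*2.+1)%N by have := sh _ _ Jr; lia.
have := wf_at_least s2; rewrite -wu_at_least // => h.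
apply: le_trans (ler_norm _) _.
by rewrite normrM normrX normrN1 expr1n mul1r distrC.
Qed.

Definition small_exact (w : Om) := [exists v : V, (weight v <= r)%N && exactly (vec v) w].

(** Take a vector of maximal weight among those of weight at most [r + 1] reached by [w]. If its
    weight were at most [r], it would be exact, or some entry could still be raised. *)
Lemma overfull w : ~~ small_exact w -> exists2 v : V, weight v == r.+1 & at_least (vec v) w.
Proof.
move=> nw.
pose v0 : V := [ffun=> ord0].
pose P (v : V) := at_least (vec v) w && (weight v <= r.+1)%N.
have P0 : P v0.
  apply/andP; split; first by apply/forallP => t; rewrite /vec ffunE.
  by rewrite /weight big1 // => t _; rewrite ffunE.
case: (arg_maxnP (fun v : V => weight v) P0) => v /andP[vw vr] vmax.
exists v => //; rewrite eqn_leq vr ltnNge; apply/negP => vr'.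
case/negP: nw; apply/existsP; exists v; rewrite vr' /=; apply/forallP => t.
rewrite (forallP vw) /=; apply/negP => vt.
have vtr : (v t < r.+1)%N.
  by rewrite ltnS; apply: leq_trans vr'; rewrite /weight (bigD1 t) //= leq_addr.
pose v' : V := [ffun t' => if t' == t then Ordinal (vtr : (v t).+1 < r.+2)%N else v t'].
have wv' : weight v' = (weight v).+1.
  rewrite /weight (bigD1 t) //= [in RHS](bigD1 t) //= ffunE eqxx /= addSn; congr (_ + _).+1%N.
  by apply: eq_bigr => s /negPf st; rewrite ffunE st.
have /vmax : P v'.
  rewrite /P wv' ltnS vr' andbT; apply/forallP => s; rewrite /vec ffunE.
  by case: eqP => [->|_] //; apply: (forallP vw).
by rewrite /= wv' ltnn.
Qed.

Lemma mass_not_small : mass wu (fun w => ~~ small_exact w) <= (2 / 3) ^+ r.+1 * Z.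
Proof.
apply: le_trans (sum_weight_eq r rho_gt0 rho_le).
apply: le_trans (_ : \sum_(v : V | weight v == r.+1) mass wu (at_least (vec v)) <= _).
  under [leRHS]eq_bigr => v _ do rewrite massE.
  rewrite exchange_big massE /=; apply: ler_sum => w _.
  rewrite -mulr_sumr ler_wpM2l //; case: (boolP (small_exact w)) => /= [_|].
    by apply: sumr_ge0.
  case/overfull => v vr vw; rewrite (bigD1 v) //= vw lerDl.
  by apply: sumr_ge0.
apply: ler_sum => v /eqP vr; rewrite wu_at_least //.
by rewrite [X in (X <= _)%N]vr; lia.
Qed.

Lemma sum_diff_le :
  \sum_(v : V | (weight v <= r)%N) Num.max 0 (mass wu (exactly (vec v)) - mass wf (exactly (vec v)))
  <= (2 / 3) ^+ r.+1 * Z ^+ 2 + eps * Z ^+ 2 / rmin ^+ r.*2.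
Proof.
pose A := \sum_(J : {set T} | #|J| == r.+1) \prod_(t in J) rho t.
pose B : R := \sum_(J : {set T} | (#|J| <= r)%N) 1.
have A0 : 0 <= A by apply: sumr_ge0 => J _; apply: prodr_ge0 => t _; rewrite ltW.
have B0 : 0 <= B by apply: sumr_ge0.
have Z0 := rankin_gt0 rho_gt0.
have V0 (v : V) : 0 <= \prod_t rho t ^+ v t by apply: prodr_ge0 => t _; rewrite exprn_ge0 // ltW.
apply: le_trans (_ : \sum_(v : V | (weight v <= r)%N) ((\prod_t rho t ^+ v t) * A + eps * B) <= _).
  apply: ler_sum => v vr; rewrite ge_max exactly_diff_le // andbT.
  by rewrite addr_ge0 // mulr_ge0.
rewrite big_split /= lerD //.
  rewrite -mulr_suml expr2 mulrCA ler_pM //.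
  - exact: sumr_ge0.
  - apply: le_trans (sum_weight_le r rho_gt0 rho_le).
    by rewrite [leRHS](bigID (fun v : V => (weight v <= r)%N)) /= ler_wpDr // sumr_ge0.
  - exact: sum_subsets_eq.
pose C : R := \sum_(v : V | (weight v <= r)%N) 1.
have -> : \sum_(v : V | (weight v <= r)%N) eps * B = eps * (C * B).
  by rewrite /C mulr_suml mulr_sumr; apply: eq_bigr => v _; rewrite mul1r.
rewrite -mulrA ler_wpM2l // ler_pdivlMr ?exprn_gt0 // -addnn exprD expr2 mulrACA.
have q0 : 0 <= rmin ^+ r by rewrite exprn_ge0 // ltW.
apply: ler_pM; rewrite ?mulr_ge0 ?sumr_ge0 //.
  by apply: count_weight_le.
by apply: count_subsets_le.
Qed.

Variables (bad N : pred Om).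
Hypothesis N_exactly : forall (v : V) w w', ~~ bad w -> ~~ bad w' ->
  exactly (vec v) w -> exactly (vec v) w' -> N w = N w'.

(** For an upper bound of this one-sided difference the [wf]-mass of vectors of weight above [r] may
    be discarded; only the [wu]-mass there has to be estimated. *)
Lemma sieve_le : mass wu N - mass wf N <= mass wu bad + mass wf bad
  + (2 / 3) ^+ r.+1 * (Z + Z ^+ 2) + eps * Z ^+ 2 / rmin ^+ r.*2.
Proof.
(* Off [bad], membership in [N] depends only on the exact exponent vector; [S] lists the vectors of
   weight at most [r] that occur in [N]. *)
pose S (v : V) := (weight v <= r)%N && [exists w, [&& ~~ bad w, exactly (vec v) w & N w]].
have uniq_v w (v v' : V) : exactly (vec v) w -> exactly (vec v') w -> v = v'.
  move=> /forallP h /forallP h'; apply/ffunP => t; apply: val_inj => /=.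
  have mono i j : (i <= j)%N -> X w t j -> X w t i.
    by elim: j => [|j IH]; [rewrite leqn0 => /eqP->|rewrite leq_eqVlt ltnS => /orP[/eqP->//|ij /XS /(IH ij)]].
  case/andP: (h t) => a b; case/andP: (h' t) => a' b'.
  case: (ltngtP (v t) (v' t)) => // lt.
    by rewrite (mono _ _ lt a') in b.
  by rewrite (mono _ _ lt a) in b'.
have up : mass wu N <= \sum_(v | S v) mass wu (exactly (vec v)) + mass wu bad
    + mass wu (fun w => ~~ small_exact w).
  under eq_bigr => v _ do rewrite massE.
  rewrite !massE exchange_big -!big_split /=; apply: ler_sum => w _.
  rewrite -mulr_sumr -!mulrDr ler_wpM2l //.
  have s0 : 0 <= \sum_(v | S v) (exactly (vec v) w)%:R :> R by apply: sumr_ge0.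
  case Nw : (N w); last by rewrite !addr_ge0.
  case bw : (bad w); first by rewrite /=; case: (small_exact w) => /=; lra.
  case sw : (small_exact w); last by rewrite /= lerDr addr_ge0.
  case/existsP: sw => v /andP[vr vw].
  rewrite (bigD1 v) /=; last first.
    by rewrite /S vr; apply/existsP; exists w; rewrite bw vw Nw.
  by rewrite vw !addr0 lerDl sumr_ge0.
have lo : \sum_(v | S v) mass wf (exactly (vec v)) - mass wf bad <= mass wf N.
  rewrite lerBlDr; under eq_bigr => v _ do rewrite massE.
  rewrite !massE exchange_big -!big_split /=; apply: ler_sum => w _.
  rewrite -mulr_sumr -!mulrDr ler_wpM2l //.
  case: (pickP (fun v => S v && exactly (vec v) w)) => [v /andP[vS vw]|none]; last first.
    by rewrite big1 ?addr_ge0 // => v vS; have := none v; rewrite vS /= => ->.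
  rewrite (bigD1 v) //= vw big1 ?addr0; last first.
    move=> v' /andP[_ vv']; case v'w : (exactly (vec v') w) => //.
    by rewrite (uniq_v _ _ _ v'w vw) eqxx in vv'.
  case bw : (bad w); first by rewrite lerDr.
  rewrite addr0; case/andP: vS => _ /existsP[w' /and3P[bw' vw' Nw']].
  by rewrite (N_exactly (negbT bw) bw' vw vw') Nw'.
have d : \sum_(v | S v) mass wu (exactly (vec v)) - \sum_(v | S v) mass wf (exactly (vec v))
   <= \sum_(v : V | (weight v <= r)%N) Num.max 0 (mass wu (exactly (vec v)) - mass wf (exactly (vec v))).
  rewrite -sumrB [leLHS]big_mkcond [leRHS]big_mkcond; apply: ler_sum => v _.
  rewrite /S; case: (weight v <= r)%N => //=; case: [exists w, _]; rewrite le_max lexx ?orbT //.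
have := sum_diff_le; have := mass_not_small; move: up lo d.
set a1 := mass wu N; set a2 := mass wf N; set a3 := \sum_(v | S v) mass wu _.
set a4 := \sum_(v | S v) mass wf _; set a5 := \sum_(v | _) Num.max _ _.
set a6 := mass wu bad; set a7 := mass wf bad; set a8 := mass wu _.
by rewrite mulrDr; lra.
Qed.
End Sieve.

(** * Irreducible polynomials over a finite field *)

(** The class of [x] in the finite field F[x]/(q) is fixed by raising to the cardinality of that
    field. *)
Lemma irreducible_dvd_XsubX (F : finFieldType) (q : {poly F}) :
  irreducible_poly q -> q \is monic -> q %| 'X^(#|F| ^ (size q).-1) - 'X.
Proof.
move=> qi qm; pose hI : monic_irreducible_poly q := (qi, qm).
have e := expf_card (in_qpoly q 'X : {poly %/ q with hI}).
rewrite card_qfpoly in e.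
have e0 : in_qpoly q ('X^(#|F| ^ (size q).-1) - 'X) = 0.
  by rewrite raddfB /= rmorphXn /=; apply/eqP; rewrite subr_eq0; apply/eqP; exact: e.
have := congr1 val e0; rewrite /= -Pdiv.IdomainMonic.modpE ?monic_mk_monic //.
by rewrite (mk_monicE hI) => /eqP.
Qed.

Lemma monic_irreducible_coprime (F : fieldType) (q q' : {poly F}) :
  irreducible_poly q -> irreducible_poly q' -> q \is monic -> q' \is monic ->
  q != q' -> coprimep q q'.
Proof.
move=> qi qi' qm qm'; rewrite irreducible_poly_coprime //; apply: contra => qq'.
have := qi'.2 q _ qq'; case: (eqVneq (size q) 1%N) => [q1|_]; first by have := qi.1; rewrite q1.
by move/(_ isT); rewrite eqp_monic.
Qed.

Lemma coprimep_prodr (F : fieldType) (I : Type) (s : seq I) (P : pred I) (f : I -> {poly F}) h :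
  (forall i, P i -> coprimep h (f i)) -> coprimep h (\prod_(i <- s | P i) f i).
Proof.
move=> hf; elim/big_rec: _ => [|i x Pi hx]; first exact: coprimep1.
by rewrite coprimepMr hf.
Qed.

Lemma sum_degree_le (F : fieldType) (I : finType) (P : pred I) (f : I -> {poly F}) g :
  g != 0 -> (forall i, P i -> irreducible_poly (f i) /\ f i \is monic) ->
  {in P &, injective f} -> (forall i, P i -> f i %| g) ->
  (\sum_(i | P i) (size (f i)).-1 <= (size g).-1)%N.
Proof.
move=> g0 fi finj fg.
have : \prod_(i | P i) f i %| g.
  rewrite -big_filter.
  have : uniq [seq i <- index_enum I | P i] by rewrite filter_uniq // index_enum_uniq.
  have : {subset [seq i <- index_enum I | P i] <= P}.
    by move=> i; rewrite mem_filter => /andP[].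
  elim: (filter _ _) => [|i s IH] sub; first by rewrite big_nil dvd1p.
  rewrite cons_uniq => /andP[is_ us]; rewrite big_cons.
  have Pi : P i by apply: sub; rewrite inE eqxx.
  have subs : {subset s <= P} by move=> j js; apply: sub; rewrite inE js orbT.
  rewrite Gauss_dvdp ?fg ?IH //.
  rewrite big_seq; apply: coprimep_prodr => j js.
  have Pj : P j by apply: subs.
  have [a b] := fi _ Pi; have [c d] := fi _ Pj.
  apply: monic_irreducible_coprime => //.
  by apply: contraNneq is_ => /finj -> //.
move/(dvdp_leq g0); rewrite size_prod; last by move=> i Pi; apply: monic_neq0; case: (fi _ Pi).
have -> : (\sum_(i | P i) size (f i) = \sum_(i | P i) (size (f i)).-1 + #|P|)%N.
  rewrite -sum1_card -big_split /=; apply: eq_bigr => i Pi.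
  by rewrite addn1 prednK // size_poly_gt0 monic_neq0 //; case: (fi _ Pi).
by rewrite -addSn addnK => h; rewrite -ltnS prednK // size_poly_gt0.
Qed.

Lemma card_irreducible_le (F : finFieldType) (I : finType) (P : pred I) (f : I -> {poly F}) i :
  (0 < i)%N -> (forall j, P j -> irreducible_poly (f j) /\ f j \is monic) ->
  {in P &, injective f} -> (forall j, P j -> size (f j) = i.+1) ->
  (i * #|P| <= #|F| ^ i)%N.
Proof.
move=> i0 fi finj fsz.
have N1 : (1 < #|F| ^ i)%N by rewrite -{1}(exp1n i) ltn_exp2r ?finNzRing_gt1.
have sz : size ('X^(#|F| ^ i) - 'X : {poly F}) = (#|F| ^ i).+1.
  by rewrite size_polyDl ?size_polyXn // size_polyN size_polyX.
have g0 : 'X^(#|F| ^ i) - 'X != 0 :> {poly F} by rewrite -size_poly_gt0 sz.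
have dv j : P j -> f j %| 'X^(#|F| ^ i) - 'X.
  by move=> Pj; have [a b] := fi _ Pj; have := irreducible_dvd_XsubX a b; rewrite (fsz _ Pj).
apply: leq_trans (_ : \sum_(j | P j) (size (f j)).-1 <= _)%N.
  rewrite mulnC -sum_nat_const; apply: eq_leq; apply: eq_big => // j Pj.
  by rewrite (fsz _ Pj).
by have := sum_degree_le g0 fi finj dv; rewrite sz.
Qed.

From mathcomp Require Import all_classical all_reals all_analysis complex.
Import numFieldNormedType.Exports.
Import Order.TTheory GRing.Theory Num.Theory.
Local Open Scope ring_scope.

(** * Fourier analysis on F_p[x]/(Q) *)

Section Trig.
Local Open Scope classical_set_scope.
Variable R : realType.

Definition sin_slope : R := cos 1 / 2.

Lemma sin_slope_gt0 : 0 < sin_slope.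
Proof. by rewrite divr_gt0 // cos1_gt0. Qed.

(** On [0, 1] the mean value theorem gives [sin u >= u cos 1]; beyond 1, [sin u >= sin 1 >= cos 1]
    and [u < 2], which costs the factor 2 in [sin_slope]. *)
Lemma sin_ge_linear (u : R) : 0 <= u <= pi / 2 -> sin_slope * u <= sin u.
Proof.
case/andP => u0 upi; have c1 := @cos1_gt0 R.
have p1 := @pihalf_ge1 R; have p2 := @pihalf_lt2 R.
have low (v : R) : 0 <= v <= 1 -> cos 1 * v <= sin v.
  case/andP => v0 v1.
  have hd (x : R) : x \in `]0, v[%R -> is_derive x 1 (@sin R) (cos x) by move=> _; apply: is_derive_sin.
  have hc : {within `[0, v], continuous (@sin R)}.
    by apply: continuous_subspaceT; exact: continuous_sin.
  have [c] := MVT_segment v0 hd hc.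
  rewrite in_itv /= sin0 !subr0 => /andP[c0 cv] ->.
  rewrite ler_wpM2r // leNgt; apply/negP; rewrite ltr_cos ?in_itv /=; lra.
rewrite /sin_slope; have [u1|u1] := leP u 1.
  by have := low u; rewrite u0 u1 => /(_ isT); nra.
have := low 1; rewrite ler01 lexx mulr1 => /(_ isT) s1.
have : sin 1 < sin u by rewrite ltr_sin ?in_itv /=; lra.
nra.
Qed.

Lemma cos_le_quadratic (t : R) : 0 <= t <= 1 / 2 ->
  cos (2 * pi * t) <= 1 - (cos 1) ^+ 2 * 2 * t ^+ 2.
Proof.
case/andP => t0 t1; have pi2 := @pi_ge2 R; have c1 := @cos1_gt0 R.
have -> : 2 * pi * t = (pi * t) *+ 2 by rewrite mulr2n; ring.
rewrite cos_mulr2n cos2sin2.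
have : sin_slope * (pi * t) <= sin (pi * t).
  apply: sin_ge_linear; apply/andP; split; nra.
have : 0 <= sin_slope * (pi * t).
  by rewrite mulr_ge0 ?(ltW sin_slope_gt0) // mulr_ge0 //; lra.
have : cos 1 * t <= sin_slope * (pi * t).
  by rewrite /sin_slope -mulrA ler_pM2l // ; nra.
have : 0 <= cos 1 * t by rewrite mulr_ge0 // ltW.
move: (sin (pi * t)) (sin_slope * (pi * t)) => s q a0 aq q0 qs.
have : (cos 1 * t) ^+ 2 <= s ^+ 2 by rewrite lerXn2r ?nnegrE //; lra.
rewrite exprMn mulr2n; lra.
Qed.
End Trig.

Section Modulus.
Local Open Scope complex_scope.
Variable R : rcfType.
Implicit Types z : R[i].

(** The squared modulus, with values in [R] rather than in [R[i]]. *)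
Definition nrm2 z : R := complex.Re z ^+ 2 + complex.Im z ^+ 2.

Lemma nrm2_ge0 z : 0 <= nrm2 z.
Proof. by rewrite addr_ge0 // sqr_ge0. Qed.

Lemma nrm2M z1 z2 : nrm2 (z1 * z2) = nrm2 z1 * nrm2 z2.
Proof. by case: z1 z2 => [a b] [c d]; rewrite /nrm2 /=; ring. Qed.

Lemma nrm2_1 : nrm2 1 = 1.
Proof. by rewrite /nrm2 /= expr1n expr0n addr0. Qed.

Lemma nrm2_prod (I : Type) (s : seq I) (P : pred I) (f : I -> R[i]) :
  nrm2 (\prod_(i <- s | P i) f i) = \prod_(i <- s | P i) nrm2 (f i).
Proof. exact: (big_morph _ nrm2M nrm2_1). Qed.

Lemma Re_le_nrm2 z e : 0 <= e -> nrm2 z <= e ^+ 2 -> `|complex.Re z| <= e.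
Proof.
move=> e0 ze; rewrite -(@ler_pXn2r _ 2) ?nnegrE // real_normK ?num_real //.
by apply: le_trans ze; rewrite lerDl sqr_ge0.
Qed.

Lemma Re_sum (I : Type) (s : seq I) (P : pred I) (f : I -> R[i]) :
  complex.Re (\sum_(i <- s | P i) f i) = \sum_(i <- s | P i) complex.Re (f i).
Proof. exact: raddf_sum. Qed.
End Modulus.

Section Characters.
Local Open Scope complex_scope.
Variables (R : realType) (p : nat).
Hypothesis pp : prime p.

Definition omega : R[i] := cos (2 * pi / p%:R) +i* sin (2 * pi / p%:R).

Lemma omegaX n : omega ^+ n = cos (2 * pi * (n%:R / p%:R)) +i* sin (2 * pi * (n%:R / p%:R)).
Proof.
elim: n => [|n IH]; first by rewrite expr0 mul0r mulr0 cos0 sin0.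
rewrite exprS IH /omega.
have -> : 2 * pi * (n.+1%:R / p%:R) = 2 * pi / p%:R + 2 * pi * (n%:R / p%:R) :> R.
  by rewrite -natr1; ring.
by rewrite cosD sinD; apply/eqP; rewrite eq_complex /=; apply/andP; split; apply/eqP; ring.
Qed.

Lemma omega_p : omega ^+ p = 1.
Proof.
rewrite omegaX divff ?pnatr_eq0 -?lt0n ?prime_gt0 // mulr1.
by rewrite mulr_natl cos2pi sin2pi.
Qed.

Definition chr (a : 'F_p) : R[i] := omega ^+ a.

Lemma chrD a b : chr (a + b) = chr a * chr b.
Proof.
rewrite /chr -exprD -[in RHS](expr_mod _ omega_p); congr (_ ^+ _).
by rewrite /= [X in (_ %% X)%N](Fp_cast pp).
Qed.

Lemma chr0 : chr 0 = 1. Proof. by rewrite /chr expr0. Qed.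

Lemma nrm2_chr a : nrm2 (chr a) = 1.
Proof. by rewrite /chr omegaX /nrm2 /= cos2Dsin2. Qed.

Definition slope : R := 2 * cos 1 ^+ 2.

Lemma slope_gt0 : 0 < slope.
Proof. by rewrite mulr_gt0 // exprn_gt0 // cos1_gt0. Qed.

(** In absolute value, the distance of [a / p] to the nearest integer. *)
Definition ratio (a : 'F_p) : R := (centered a)%:~R / p%:R.

Lemma Re_chr_le a : complex.Re (chr a) <= 1 - slope * ratio a ^+ 2.
Proof.
have p0 : 0 < p%:R :> R by rewrite ltr0n prime_gt0.
have ap := Fp_lt a pp.
have lt1 (x : R) : 0 <= x <= 1 / 2 -> cos (2 * pi * x) <= 1 - slope * x ^+ 2.
  by move=> h; apply: le_trans (cos_le_quadratic h) _; rewrite /slope; lra.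
rewrite /chr omegaX /=; have [h|h] := ltnP a.*2 p.
  rewrite /ratio /centered h -pmulrn; apply: lt1.
  rewrite divr_ge0 ?ler0n //= ler_pdivrMr //.
  have : 2%:R * (a : nat)%:R <= p%:R :> R by rewrite -natrM ler_nat mul2n ltnW.
  by lra.
have e : 2 * pi * ((a : nat)%:R / p%:R) = - (2 * pi * ((p - a)%:R / p%:R)) + pi *+ 2 :> R.
  rewrite natrB; last exact: ltnW.
  by rewrite mulrBl divff ?gt_eqF // mulr2n; ring.
rewrite e cosD2pi cosN.
have -> : ratio a ^+ 2 = ((p - a)%:R / p%:R) ^+ 2.
  rewrite /ratio /centered ltnNge h /= -sqrrN -mulNr; congr ((_ / _) ^+ _).
  by rewrite intrB -!pmulrn opprB natrB // ltnW.
apply: lt1; rewrite divr_ge0 ?ler0n //= ler_pdivrMr //.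
have : 2%:R * (p - a)%:R <= p%:R :> R by rewrite -natrM ler_nat mul2n; lia.
by lra.
Qed.

Lemma ratio_neq0 a : a != 0 -> 0 < ratio a ^+ 2.
Proof.
move=> a0; rewrite exprn_even_gt0 //= /ratio mulf_neq0 ?invr_eq0 ?pnatr_eq0 -?lt0n ?prime_gt0 //.
rewrite intr_eq0; apply: contra a0 => /eqP c0.
by rewrite -[a]centeredK // c0.
Qed.

Lemma sum_chr (t : 'F_p) : \sum_a chr (a * t) = if t == 0 then p%:R else 0.
Proof.
case: eqP => [->|/eqP t0].
  under eq_bigr => a _ do rewrite mulr0 chr0.
  by rewrite sumr_const card_Fp.
set S := \sum_a _.
have : chr t * S = S.
  rewrite /S mulr_sumr [RHS](reindex_inj (addrI 1)) /=; apply: eq_bigr => a _.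
  by rewrite mulrDl mul1r chrD.
move/eqP; rewrite -subr_eq0 -[X in _ - X]mul1r -mulrBl mulf_eq0 => /orP[|/eqP//].
rewrite subr_eq0 => /eqP c1.
(* For [t != 0] the quadratic bound keeps the real part of [chr t] strictly below 1. *)
exfalso; have := Re_chr_le t; rewrite c1 /=; have := ratio_neq0 t0; have := slope_gt0.
nra.
Qed.

Definition hat (mu : 'F_p -> R) (s : 'F_p) : R[i] := \sum_a (mu a)%:C * chr (a * s).

Lemma hat0 mu : \sum_a mu a = 1 -> hat mu 0 = 1.
Proof.
move=> m1; rewrite /hat; under eq_bigr => a _ do rewrite mulr0 chr0 mulr1.
by rewrite -raddf_sum m1.
Qed.

(** The squared modulus is the characteristic function of the difference of two independent
    samples. *)
Lemma nrm2_hat mu s :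
  nrm2 (hat mu s) = \sum_a \sum_b mu a * mu b * complex.Re (chr ((a - b) * s)).
Proof.
have rh : complex.Re (hat mu s) = \sum_a mu a * complex.Re (chr (a * s)).
  by rewrite /hat Re_sum; apply: eq_bigr => a _; case: (chr _) => x y /=; rewrite mul0r subr0.
have ih : complex.Im (hat mu s) = \sum_a mu a * complex.Im (chr (a * s)).
  rewrite /hat raddf_sum; apply: eq_bigr => a _; case: (chr _) => x y /=.
  by rewrite mul0r addr0.
rewrite /nrm2 rh ih !expr2 !mulr_suml -big_split /=; apply: eq_bigr => a _.
rewrite !mulr_sumr -big_split /=; apply: eq_bigr => b _.
have h : chr (a * s) = chr ((a - b) * s) * chr (b * s) by rewrite -chrD -mulrDl subrK.
have := nrm2_chr (b * s); rewrite h /nrm2.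
case: (chr (b * s)) => x y; case: (chr _) => u v /=; set w := x ^+ 2 + _ => e.
have -> : mu a * mu b * u = mu a * mu b * u * w by rewrite e mulr1.
by rewrite /w; ring.
Qed.

Lemma nrm2_hat_le mu s : (forall a, 0 <= mu a) -> \sum_a mu a = 1 ->
  nrm2 (hat mu s) <=
  expR (- (slope * \sum_a \sum_b mu a * mu b * ratio ((a - b) * s) ^+ 2)).
Proof.
move=> m0 m1; rewrite nrm2_hat; apply: le_trans (expR_ge1Dx _).
apply: le_trans (_ : \sum_a \sum_b (mu a * mu b - slope * (mu a * mu b * ratio ((a - b) * s) ^+ 2)) <= _).
  apply: ler_sum => a _; apply: ler_sum => b _.
  have -> : mu a * mu b - slope * (mu a * mu b * ratio ((a - b) * s) ^+ 2) =
    mu a * mu b * (1 - slope * ratio ((a - b) * s) ^+ 2) by ring.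
  by rewrite ler_wpM2l ?mulr_ge0 // Re_chr_le.
under eq_bigr => a _ do rewrite sumrB -!mulr_sumr m1 mulr1.
by rewrite sumrB -mulr_sumr m1.
Qed.
End Characters.

(** For [d = deg Q] these are all the linear forms on F[x]/(Q), given by their values [u] on the
    powers of [x] below [d]. *)
Definition residue_form (F : fieldType) (Q : {poly F}) d (u : {ffun 'I_d -> F})
  (g : {poly F}) : F := \sum_(j < d) u j * (g %% Q)`_j.

Lemma residue_form_is_scalar (F : fieldType) (Q : {poly F}) d (u : {ffun 'I_d -> F}) :
  scalar (residue_form Q u).
Proof.
move=> a g h; rewrite /residue_form mulr_sumr -big_split /=; apply: eq_bigr => j _.
by rewrite modpD modpZl coefD coefZ; ring.
Qed.

(* HB would otherwise generate the names of the instance for window_form again. *)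
Module ResidueForm.
HB.instance Definition _ (F : fieldType) (Q : {poly F}) d (u : {ffun 'I_d -> F}) :=
  GRing.isLinear.Build F {poly F} F *%R (residue_form Q u) (residue_form_is_scalar Q u).
End ResidueForm.
Export ResidueForm.

Lemma residue_form_mul (F : fieldType) (Q : {poly F}) d (u : {ffun 'I_d -> F}) g :
  residue_form Q u (Q * g) = 0.
Proof. by rewrite /residue_form modp_mulr big1 // => j _; rewrite coef0 mulr0. Qed.

Lemma residue_form_neq0 (F : fieldType) (Q : {poly F}) (u : {ffun 'I_(size Q).-1 -> F}) :
  u != [ffun=> 0] -> exists2 j : 'I_(size Q).-1, u j != 0 & residue_form Q u 'X^j = u j.
Proof.
move=> u0; have [j uj] : exists j, u j != 0.
  apply/existsP; apply: contraR u0; rewrite negb_exists => /forallP h.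
  by apply/eqP/ffunP => j; rewrite ffunE; apply/eqP; have := h j; rewrite negbK.
exists j => //; rewrite /residue_form modp_small; last first.
  by rewrite size_polyXn -ltn_predRL.
rewrite (bigD1 j) //= coefXn eqxx mulr1 big1 ?addr0 // => i ij.
by rewrite coefXn; case: eqP => e; rewrite ?mulr0 //; rewrite -val_eqE /= e eqxx in ij.
Qed.

Section Fourier.
Local Open Scope complex_scope.
Variables (R : realType) (p : nat).
Hypothesis pp : prime p.
Variables (n : nat).
Notation C := {ffun 'I_n.+1 -> 'F_p}.

Definition poly_of_coefs (c : C) : {poly 'F_p} := \sum_(i < n.+1) c i *: 'X^i.

(** The law may vary with [i], so that the uniform monic polynomial with its constant leading
    coefficient fits as well. *)
Definition coef_weight (mu : 'I_n.+1 -> 'F_p -> R) (c : C) : R := \prod_i mu i (c i).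

Definition div_mass mu (Q : {poly 'F_p}) : R := \sum_(c | Q %| poly_of_coefs c) coef_weight mu c.

(** Orthogonality of characters in each of the [deg Q] coordinates of the residue detects residue 0;
    independence then factors the sum over coefficient vectors. *)
Lemma fourier_div mu (Q : {poly 'F_p}) : Q != 0 ->
  (div_mass mu Q * p%:R ^+ (size Q).-1)%:C =
  \sum_(u : {ffun 'I_(size Q).-1 -> 'F_p}) \prod_i hat (mu i) (residue_form Q u 'X^i).
Proof.
move=> Q0; set d := (size Q).-1.
have szQ g : (size (g %% Q)%R <= d)%N.
  by rewrite -ltnS prednK ?ltn_modp // lt0n size_poly_eq0.
under [RHS]eq_bigr => u _ do rewrite bigA_distr_bigA /=.
rewrite exchange_big /div_mass big_mkcond mulr_suml raddf_sum /=; apply: eq_bigr => c _.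
have chrM (I : finType) (f : I -> 'F_p) : \prod_i chr R (f i) = chr R (\sum_i f i).
  by rewrite (big_morph _ (chrD R pp) (chr0 R p)).
transitivity ((coef_weight mu c)%:C * \sum_(u : {ffun 'I_d -> 'F_p}) chr R (residue_form Q u (poly_of_coefs c))).
  have -> : \sum_(u : {ffun 'I_d -> 'F_p}) chr R (residue_form Q u (poly_of_coefs c)) =
     \prod_(j < d) \sum_a chr R (a * (poly_of_coefs c %% Q)`_j).
    by rewrite bigA_distr_bigA; apply: eq_bigr => u _; rewrite chrM.
  under [in RHS]eq_bigr => j _ do rewrite (sum_chr R pp).
  case: ifPn => [/modp_eq0P dv|ndv].
    under [in RHS]eq_bigr => j _ do rewrite dv coef0 eqxx.
    by rewrite prodr_const card_ord rmorphM rmorphXn /= rmorph_nat.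
  rewrite mul0r; have [j jn] : exists j : 'I_d, (poly_of_coefs c %% Q)`_j != 0.
    apply/existsP; apply: contraR ndv; rewrite negb_exists => /forallP h.
    apply/modp_eq0P/polyP => i; rewrite coef0; have [id|id] := ltnP i d.
      by have := h (Ordinal id); rewrite negbK => /eqP.
    by rewrite nth_default // (leq_trans (szQ _)).
  by rewrite (bigD1 j) //= (negPf jn) mul0r mulr0.
rewrite mulr_sumr; apply: eq_bigr => u _.
rewrite /coef_weight rmorph_prod big_split /=; congr (_ * _).
rewrite chrM; congr (chr R _); rewrite raddf_sum /=; apply: eq_bigr => i _.
by rewrite scalarZ.
Qed.

Lemma div_massE mu (Q : {poly 'F_p}) : Q != 0 ->
  div_mass mu Q = (p%:R ^- (size Q).-1) *
  \sum_(u : {ffun 'I_(size Q).-1 -> 'F_p}) complex.Re (\prod_i hat (mu i) (residue_form Q u 'X^i)).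
Proof.
move=> Q0; have /(congr1 (@complex.Re R)) := fourier_div mu Q0.
rewrite Re_sum /= => <-; rewrite mulrC mulfK // expf_neq0 // pnatr_eq0 -lt0n prime_gt0 //.
Qed.

(** The form [u = 0] gives the main term. The other forms, fewer than [p ^ deg Q], are compensated
    by the prefactor, so the bound [e] for one form is the bound for the whole. *)
Lemma div_mass_near (mu : 'I_n.+1 -> 'F_p -> R) (Q : {poly 'F_p}) (e : R) : Q != 0 -> 0 <= e ->
  (forall i, \sum_a mu i a = 1) ->
  (forall u : {ffun 'I_(size Q).-1 -> 'F_p}, u != [ffun=> 0] ->
     \prod_i nrm2 (hat (mu i) (residue_form Q u 'X^i)) <= e ^+ 2) ->
  `|div_mass mu Q - p%:R ^- (size Q).-1| <= e.
Proof.
move=> Q0 e0 m1 small; set d := (size Q).-1 in small *.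
have pd0 : 0 < p%:R ^+ d :> R by rewrite exprn_gt0 // ltr0n prime_gt0.
rewrite div_massE // -/d (bigD1 [ffun=> 0]) //= mulrDr.
rewrite [X in complex.Re X]big1; last first.
  move=> i _; rewrite /residue_form big1 ?hat0 // => j _; by rewrite ffunE mul0r.
rewrite /= mulr1 addrC addKr normrM gtr0_norm ?invr_gt0 //.
rewrite ler_pdivrMl //; apply: le_trans (ler_norm_sum _ _ _) _.
apply: le_trans (_ : \sum_(u : {ffun 'I_d -> 'F_p} | u != [ffun=> 0]) e <= _).
  by apply: ler_sum => u u0; apply: Re_le_nrm2 => //; rewrite nrm2_prod small.
rewrite sumr_const -[leLHS]mulr_natl ler_wpM2r //.
apply: le_trans (_ : #|{ffun 'I_d -> 'F_p}|%:R <= _).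
  by rewrite ler_nat max_card.
by rewrite card_ffun [#|'I_d|]card_ord (card_Fp pp) natrX.
Qed.

(** Keeps an average over [u]: for exceptional factors no bound uniform in [u] is available. *)
Lemma div_mass_le (mu : 'I_n.+1 -> 'F_p -> R) (Q : {poly 'F_p}) (f : {ffun 'I_(size Q).-1 -> 'F_p} -> R) :
  Q != 0 -> (forall u, 0 <= f u) ->
  (forall u, \prod_i nrm2 (hat (mu i) (residue_form Q u 'X^i)) <= f u ^+ 2) ->
  div_mass mu Q <= p%:R ^- (size Q).-1 * \sum_u f u.
Proof.
move=> Q0 f0 fu; rewrite div_massE // ler_wpM2l ?invr_ge0 ?exprn_ge0 //.
apply: ler_sum => u _; apply: le_trans (ler_norm _) _.
by apply: Re_le_nrm2 => //; rewrite nrm2_prod fu.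
Qed.
End Fourier.

(** * Divisibility probabilities for a non-degenerate coefficient law *)

Lemma expR_jensen (R : realType) (I : finType) (P : pred I) (w x : I -> R) :
  (forall i, P i -> 0 <= w i) -> \sum_(i | P i) w i = 1 ->
  expR (\sum_(i | P i) w i * x i) <= \sum_(i | P i) w i * expR (x i).
Proof.
move=> w0 w1; set m := \sum_(i | P i) w i * x i.
(* The tangent of [expR] at the mean [m], averaged. *)
have -> : expR m = \sum_(i | P i) w i * (expR m * (1 + (x i - m))).
  under eq_bigr => i _ do rewrite mulrCA.
  rewrite -mulr_sumr; under eq_bigr => i _ do rewrite addrCA mulrDr mulrBr mulr1.
  rewrite big_split /= -/m sumrB w1 -mulr_suml w1; ring.
apply: ler_sum => i Pi; rewrite ler_wpM2l ?w0 //.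
have -> : expR (x i) = expR m * expR (x i - m) by rewrite -expRD addrC subrK.
by rewrite ler_wpM2l ?expR_ge0 // expR_ge1Dx.
Qed.

(** A nonzero linear form is equidistributed: translating coordinate [j] by [t] adds [t * a j],
    which runs through [F]. Multiples on both sides avoid dividing in [R]. *)
Lemma sum_linear_form (F : finFieldType) (R : nzRingType) d (a : 'I_d -> F) (g : F -> R) j :
  a j != 0 ->
  \sum_(u : {ffun 'I_d -> F}) g (\sum_i u i * a i) *+ #|F| =
  (\sum_t g t) *+ (#|F| ^ d).
Proof.
move=> aj; pose tr (t : F) (u : {ffun 'I_d -> F}) := [ffun i => if i == j then u i + t else u i].
have trE t u : \sum_i tr t u i * a i = \sum_i u i * a i + t * a j.
  rewrite (bigD1 j) //= ffunE eqxx [in RHS](bigD1 j) //= mulrDl addrAC; congr (_ + _ + _).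
  by apply: eq_bigr => i /negPf ij; rewrite ffunE ij.
have trK t : cancel (tr t) (tr (- t)).
  by move=> u; apply/ffunP => i; rewrite !ffunE; case: eqP => // _; rewrite addrK.
transitivity (\sum_(t : F) \sum_(u : {ffun 'I_d -> F}) g (\sum_i u i * a i)).
  by rewrite sumr_const sumrMnl.
transitivity (\sum_(t : F) \sum_(u : {ffun 'I_d -> F}) g (\sum_i u i * a i + t * a j)).
  apply: eq_bigr => t _; rewrite (reindex_inj (can_inj (trK t))) /=.
  by apply: eq_bigr => u _; rewrite trE.
rewrite exchange_big /= -[d in RHS]card_ord -card_ffun -sumr_const; apply: eq_bigr => u _.
pose h t := \sum_(i < d) u i * a i + t * a j.
have hinj : injective h by move=> x y /addrI /(mulIf aj).
by rewrite [RHS](reindex_inj hinj).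
Qed.

Section Law.
Variables (R : realType) (p : nat).
Hypothesis pp : prime p.
Variable mu : 'F_p -> R.
Hypothesis mu_ge0 : forall a, 0 <= mu a.
Hypothesis mu1 : \sum_a mu a = 1.
Variable eta0 : R.
Hypothesis eta0_gt0 : 0 < eta0.
Hypothesis mu_le : forall a, mu a <= 1 - eta0.

(* The pairs of values that contribute to 1 - |hat mu|^2. *)
Definition off (ab : 'F_p * 'F_p) := ab.1 != ab.2.
Definition nu (ab : 'F_p * 'F_p) : R := mu ab.1 * mu ab.2.

Lemma nu_ge0 ab : 0 <= nu ab. Proof. by rewrite mulr_ge0. Qed.

(** Two samples coincide with probability [\sum_a mu a ^+ 2], at most the largest atom. *)
Lemma sum_nu_ge : eta0 <= \sum_(ab | off ab) nu ab.
Proof.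
have : \sum_ab nu ab = 1.
  by rewrite -(pair_big xpredT xpredT (fun a b => mu a * mu b)) /=
    (eq_bigr mu) // => a _; rewrite -mulr_sumr mu1 mulr1.
rewrite (bigID off) /= => e.
suff : \sum_(ab | ~~ off ab) nu ab <= 1 - eta0 by lra.
have -> : \sum_(ab | ~~ off ab) nu ab = \sum_a mu a * mu a.
  rewrite (eq_bigl (fun ab : 'F_p * 'F_p => true && (ab.2 == ab.1))); last first.
    by move=> ab; rewrite /off negbK eq_sym.
  rewrite -(pair_big_dep xpredT (fun a b => b == a) (fun a b => mu a * mu b)) /=.
  by apply: eq_bigr => a _; rewrite big_pred1_eq.
apply: le_trans (_ : \sum_a mu a * (1 - eta0) <= _).
  by apply: ler_sum => a _; rewrite ler_wpM2l.
by rewrite -mulr_suml mu1 mul1r.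
Qed.

Lemma nrm2_hat_off s : nrm2 (hat mu s) <=
  expR (- (slope R * \sum_(ab | off ab) nu ab * ratio R ((ab.1 - ab.2) * s) ^+ 2)).
Proof.
apply: le_trans (nrm2_hat_le pp s mu_ge0 mu1) _.
rewrite (pair_big xpredT xpredT (fun a b => mu a * mu b * ratio R ((a - b) * s) ^+ 2)) /=.
rewrite (bigID off) /= [X in _ + X]big1 ?addr0 // => -[a b] /=.
rewrite /off negbK /= => /eqP->; rewrite subrr mul0r /ratio /centered /=.
by rewrite double0 prime_gt0 // mulr0z mul0r expr0n mulr0.
Qed.

Variable n : nat.

Lemma prod_nrm2_hat (s : nat -> 'F_p) : \prod_(i < n.+1) nrm2 (hat mu (s i)) <=
  expR (- (slope R * \sum_(ab | off ab) nu ab * \sum_(i < n.+1) ratio R ((ab.1 - ab.2) * s i) ^+ 2)).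
Proof.
apply: le_trans (_ : \prod_(i < n.+1)
  expR (- (slope R * \sum_(ab | off ab) nu ab * ratio R ((ab.1 - ab.2) * s i) ^+ 2)) <= _).
  by apply: ler_prod => i _; rewrite nrm2_ge0 nrm2_hat_off.
rewrite -expR_sum sumrN -mulr_sumr exchange_big /=.
by under eq_bigr => ab _ do rewrite -mulr_sumr.
Qed.

(** For [a != b] the multiple of the form by [a - b] is again nonzero and kills [Q], so [beta]
    applies to each off-diagonal pair; these have total mass at least [eta0]. The final 2 comes from
    passing from squared moduli to moduli. *)
Lemma div_mass_good (Q : {poly 'F_p}) beta : Q != 0 ->
  (forall psi : {scalar {poly 'F_p}}, (forall g, psi (Q * g) = 0) ->
    (exists g, psi g != 0) -> beta <= \sum_(i < n.+1) ratio R (psi 'X^i) ^+ 2) ->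
  `|div_mass (fun _ : 'I_n.+1 => mu) Q - p%:R ^- (size Q).-1|
    <= expR (- (slope R * eta0 * beta / 2)).
Proof.
move=> Q0 hb; apply: div_mass_near => // u u0.
apply: le_trans (prod_nrm2_hat (fun i => residue_form Q u 'X^i)) _.
rewrite -expRM_natl ler_expR.
have -> : 2%:R * - (slope R * eta0 * beta / 2) = - (slope R * (eta0 * beta)) by field.
rewrite lerN2 ler_wpM2l ?(ltW (slope_gt0 R)) //.
have [b0|b0] := leP beta 0.
  apply: le_trans (_ : 0 <= _); first by rewrite mulr_ge0_le0 // ltW.
  by apply: sumr_ge0 => ab _; rewrite mulr_ge0 ?nu_ge0 // sumr_ge0 // => i _; rewrite sqr_ge0.
apply: le_trans (_ : \sum_(ab | off ab) nu ab * beta <= _).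
  by rewrite -mulr_suml ler_wpM2r ?sum_nu_ge // ltW.
apply: ler_sum => -[a b] /= ab; rewrite ler_wpM2l ?nu_ge0 //.
have cn : a - b != 0 by rewrite subr_eq0.
pose u' : {ffun 'I_(size Q).-1 -> 'F_p} := [ffun j => (a - b) * u j].
have rE g : residue_form Q u' g = (a - b) * residue_form Q u g.
  by rewrite /residue_form mulr_sumr; apply: eq_bigr => j _; rewrite ffunE mulrA.
under eq_bigr => i _ do rewrite -rE.
apply: (hb (residue_form Q u')); first exact: residue_form_mul.
have [j uj e] := residue_form_neq0 u0; exists 'X^j.
by rewrite [X in X != 0](rE 'X^j) e mulf_neq0.
Qed.
End Law.

(** Telescoping, from [(1 + x) * (1 + y) <= (1 + y) ^+ 2 <= 2 * (1 + y ^+ 2)] for consecutive points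
    [x <= y]. *)
Lemma sum_inv_sqr_le (R : realFieldType) (a : R) N : 0 < a ->
  \sum_(0 <= j < N.+1) (1 + (a * j%:R) ^+ 2)^-1 <= 1 + 2 / a.
Proof.
move=> a0.
suff : \sum_(0 <= j < N.+1) (1 + (a * j%:R) ^+ 2)^-1 <= 1 + 2 / a * (1 - (1 + a * N%:R)^-1).
  move=> h; apply: le_trans h _; rewrite lerD2l -[leRHS]mulr1 ler_wpM2l //.
    by rewrite divr_ge0 // ltW.
  by rewrite gerBl invr_ge0 addr_ge0 // mulr_ge0 // ltW.
elim: N => [|N IH].
  by rewrite big_nat1 mulr0 expr0n addr0 invr1 subrr mulr0 addr0.
rewrite big_nat_recr //=; apply: le_trans (lerD IH (lexx _)) _.
rewrite -addrA lerD2l.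
set x := a * N%:R; have x0 : 0 <= x by rewrite mulr_ge0 // ltW.
have -> : a * N.+1%:R = x + a by rewrite -natr1 mulrDr mulr1.
have e : 2 / a * (1 - (1 + (x + a))^-1) - 2 / a * (1 - (1 + x)^-1) =
  2 / ((1 + x) * (1 + (x + a))).
  have h1 : 1 + x != 0 by rewrite gt_eqF // ltr_pwDl.
  have h2 : 1 + (x + a) != 0 by rewrite gt_eqF // ltr_pwDl // addr_ge0 // ltW.
  by field; rewrite h1 (gt_eqF a0) h2.
rewrite -lerBrDl e; set y := x + a; have xy : x <= y by rewrite lerDl ltW.
have P0 : 0 < (1 + x) * (1 + y) by apply: mulr_gt0; lra.
have q0 : 0 < 1 + y ^+ 2 by rewrite ltr_pwDl // sqr_ge0.
rewrite ler_pdivlMr // mulrC ler_pdivrMr //.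
have := sqr_ge0 (1 - y); have : 0 <= (y - x) * (1 + y) by apply: mulr_ge0; lra.
by rewrite !expr2; lra.
Qed.

Lemma sum_ratio_le (R : realType) p (K : R) : prime p -> 0 < K ->
  \sum_(t : 'F_p) expR (- (K * ratio R t ^+ 2)) <= 2 + 4 * p%:R / Num.sqrt K.
Proof.
move=> pp K0; have p0 : 0 < p%:R :> R by rewrite ltr0n prime_gt0.
set a := Num.sqrt K / p%:R.
have a0 : 0 < a by rewrite divr_gt0 // sqrtr_gt0.
pose h (j : nat) : R := (1 + (a * j%:R) ^+ 2)^-1.
have h0 j : 0 <= h j by rewrite invr_ge0 addr_ge0 // sqr_ge0.
have expR_le (x : R) : 0 <= x -> expR (- x) <= (1 + x)^-1.
  by move=> x0; rewrite expRN lef_pV2 ?posrE ?expR_gt0 ?expR_ge1Dx // ltr_pwDl.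
have aE (j : nat) : (a * j%:R) ^+ 2 = K * (j%:R / p%:R) ^+ 2.
  by rewrite /a -[in RHS](@sqr_sqrtr _ K) ?ltW // -exprMn; congr (_ ^+ 2); ring.
(* The centered lift is [t] or [t - p]; counting both candidates replaces the case distinction and
   doubles the bound. *)
have le_h (t : 'F_p) : expR (- (K * ratio R t ^+ 2)) <= h t + h (p - t)%N.
  apply: le_trans (expR_le _ _) _; first by rewrite mulr_ge0 ?sqr_ge0 // ltW.
  rewrite /ratio /centered; case: ifP => _.
    by rewrite -pmulrn -aE lerDl h0.
  rewrite -sqrrN -mulNr intrB -!pmulrn opprB -natrB; last exact: ltnW (Fp_lt t pp).
  by rewrite -aE lerDr h0.
apply: le_trans (_ : \sum_(t : 'F_p) (h t + h (p - t)%N) <= _); first exact: ler_sum.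
have -> : \sum_(t : 'F_p) (h t + h (p - t)%N) = \sum_(0 <= j < p) (h j + h (p - j)%N).
  by rewrite -(big_mkord xpredT (fun j => h j + h (p - j)%N)) (Fp_cast pp).
rewrite big_split /=.
have s1 : \sum_(0 <= j < p) h j <= 1 + 2 / a.
  apply: le_trans (sum_inv_sqr_le p a0).
  by rewrite big_nat_recr //= lerDl h0.
have s2 : \sum_(0 <= j < p) h (p - j)%N <= 1 + 2 / a.
  apply: le_trans (sum_inv_sqr_le p a0).
  rewrite big_nat_rev /= add0n [leRHS]big_nat_recl //=.
  rewrite (eq_big_nat _ _ (F2 := fun j => h j.+1)) ?lerDr ?h0 // => j /andP[_ jp].
  by congr h; lia.
have -> : 2 + 4 * p%:R / Num.sqrt K = (1 + 2 / a) + (1 + 2 / a).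
  have sK : 0 < Num.sqrt K by rewrite sqrtr_gt0.
  by rewrite /a; field; rewrite ?(gt_eqF sK) ?(gt_eqF p0).
by rewrite lerD.
Qed.

Section Anticoncentration.
Variables (R : realType) (p : nat).
Hypothesis pp : prime p.
Variable mu : 'F_p -> R.
Hypothesis mu_ge0 : forall a, 0 <= mu a.
Hypothesis mu1 : \sum_a mu a = 1.
Variable eta0 : R.
Hypothesis eta0_gt0 : 0 < eta0.
Hypothesis mu_le : forall a, mu a <= 1 - eta0.

(** Jensen moves the average over indices and pairs of values out of the exponential. For each fixed
    index and pair, the argument is uniform on F_p as [u] varies, which leaves a Gaussian sum over
    F_p. Roots of unity as roots of [Q] do no harm here. *)
Lemma div_mass_anticoncentration n (Q : {poly 'F_p}) :
  (1 < size Q)%N -> coprimep Q 'X ->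
  div_mass (fun _ : 'I_n.+1 => mu) Q <=
    2 / p%:R + 4 / Num.sqrt (slope R * eta0 * n.+1%:R / 2).
Proof.
move=> Q1 QX; have Q0 : Q != 0 by rewrite -size_poly_gt0 ltnW.
set d := (size Q).-1.
have : 0 < n.+1%:R :> R by [].
have : n.+1%:R = #|'I_n.+1|%:R :> R by rewrite card_ord.
move: (n.+1%:R : R) => Nr NrE Nr0.
(* Halved because [f] bounds moduli while the transforms enter squared; [eta0] stands in for the
   larger pair mass [eta1]. *)
set K := slope R * eta0 * Nr / 2.
have sl := slope_gt0 R.
have K0 : 0 < K by rewrite /K divr_gt0 // mulr_gt0 // mulr_gt0.
have p0 : 0 < p%:R :> R by rewrite ltr0n prime_gt0.
set eta1 := \sum_(ab : 'F_p * 'F_p | off ab) nu mu ab.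
have eta1_ge : eta0 <= eta1 by apply: sum_nu_ge.
have eta1_gt0 : 0 < eta1 by apply: lt_le_trans eta1_ge.
pose w (x : 'I_n.+1 * ('F_p * 'F_p)) : R := nu mu x.2 / (eta1 * Nr).
have N0 : 0 < eta1 * Nr by rewrite mulr_gt0.
have w0 x : 0 <= w x by rewrite divr_ge0 ?(ltW N0) // nu_ge0.
have w1 : \sum_(x | off x.2) w x = 1.
  rewrite -(pair_big xpredT (fun ab => off ab) (fun i ab => w (i, ab))) /=.
  rewrite /w /= sumr_const -mulr_suml -/eta1 -[LHS]mulr_natl -NrE; field.
  by rewrite ?(gt_eqF eta1_gt0) ?(gt_eqF Nr0).
pose S (u : {ffun 'I_d -> 'F_p}) i := residue_form Q u 'X^i.
pose f u := \sum_(x | off x.2) w x * expR (- (K * ratio R ((x.2.1 - x.2.2) * S u x.1) ^+ 2)).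
apply: le_trans (@div_mass_le R p pp n _ Q f Q0 _ _) _.
- by move=> u; apply: sumr_ge0 => x _; rewrite mulr_ge0 ?expR_ge0.
- move=> u; apply: le_trans (prod_nrm2_hat pp mu_ge0 mu1 n (S u)) _.
  pose x u := \sum_(x | off x.2) w x * (- (K * ratio R ((x.2.1 - x.2.2) * S u x.1) ^+ 2)).
  apply: le_trans (_ : expR (x u) ^+ 2 <= _); last first.
    rewrite lerXn2r ?nnegrE ?expR_ge0 //; last first.
      by apply: (@expR_jensen R _ (fun y => off y.2) w) => // y _; apply: w0.
    by apply: sumr_ge0 => y _; rewrite mulr_ge0 ?expR_ge0.
  rewrite -expRM_natl ler_expR.
  set T := \sum_(ab | off ab) _.
  have -> : x u = - (K / (eta1 * Nr) * T).
    rewrite /x /T -(pair_big xpredT (fun ab => off ab)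
      (fun i ab => w (i, ab) * (- (K * ratio R ((ab.1 - ab.2) * S u i) ^+ 2)))) /=.
    rewrite exchange_big mulr_sumr -sumrN /=; apply: eq_bigr => ab _.
    rewrite mulr_sumr mulr_sumr -sumrN; apply: eq_bigr => i _.
    by rewrite /w /=; field; rewrite ?(gt_eqF eta1_gt0) ?(gt_eqF Nr0).
  have T0 : 0 <= T.
    by apply: sumr_ge0 => ab _; rewrite mulr_ge0 ?nu_ge0 // sumr_ge0 // => i _; rewrite sqr_ge0.
  rewrite mulrN lerN2 mulrA ler_wpM2r // /K.
  have -> : 2%:R * (slope R * eta0 * Nr / 2 / (eta1 * Nr)) = slope R * (eta0 / eta1).
    by field; rewrite ?(gt_eqF eta1_gt0) ?(gt_eqF Nr0).
  by rewrite -[leRHS]mulr1 ler_wpM2l ?(ltW sl) // ler_pdivrMr // mul1r.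
have pd0 : 0 < p%:R ^+ d :> R by rewrite exprn_gt0.
rewrite ler_pdivrMl // /f exchange_big /=.
have each (x : 'I_n.+1 * ('F_p * 'F_p)) : off x.2 -> \sum_(u : {ffun 'I_d -> 'F_p})
    expR (- (K * ratio R ((x.2.1 - x.2.2) * S u x.1) ^+ 2))
    <= p%:R ^+ d * (2 / p%:R + 4 / Num.sqrt K).
  case: x => i [a b] /= ab.
  pose r := ('X^i %% Q : {poly 'F_p}).
  (* The residue of [x^i] is nonzero since [Q] is nonconstant and coprime to [x]; its leading
     coefficient serves. *)
  have [j rj] : exists j : 'I_d, (a - b) * r`_j != 0.
    have r0 : r != 0.
      apply/negP => /eqP /modp_eq0P dv.
      have : coprimep Q 'X^i by apply: coprimep_expr.
      by move/coprimepP/(_ Q (dvdpp _) dv)/eqp_size; rewrite size_poly1 => e; rewrite e in Q1.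
    have sr : (size r <= d)%N by rewrite /d -ltnS (prednK (ltnW Q1)) ltn_modp.
    have kd : ((size r).-1 < d)%N by apply: leq_trans sr; rewrite prednK // size_poly_gt0.
    by exists (Ordinal kd); rewrite mulf_neq0 ?subr_eq0 // lead_coef_eq0.
  pose G (t : 'F_p) : R := expR (- (K * ratio R t ^+ 2)).
  have lin u : (a - b) * S u i = \sum_j u j * ((a - b) * r`_j).
    by rewrite /S /residue_form mulr_sumr; apply: eq_bigr => k _; rewrite -/r; ring.
  have := @sum_linear_form _ R d (fun j => (a - b) * r`_j) G j rj; rewrite card_Fp // => e.
  have -> : \sum_(u : {ffun 'I_d -> 'F_p}) expR (- (K * ratio R ((a - b) * S u i) ^+ 2)) =
     p%:R^-1 * (p%:R ^+ d * \sum_t G t).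
    apply: (mulfI (lt0r_neq0 p0)); rewrite mulVKf ?gt_eqF // -natrX !mulr_natl -e.
    by rewrite -sumrMnl; apply: eq_bigr => u _; rewrite lin.
  rewrite mulrCA ler_wpM2l ?(ltW pd0) // mulrC ler_pdivrMr //.
  apply: le_trans (sum_ratio_le pp K0) _; rewrite le_eqVlt; apply/orP; left; apply/eqP.
  have sK : 0 < Num.sqrt K by rewrite sqrtr_gt0.
  by field; rewrite ?(gt_eqF sK) ?(gt_eqF p0).
under eq_bigr => x _ do rewrite -mulr_sumr.
apply: le_trans (_ : \sum_(x | off x.2) w x * (p%:R ^+ d * (2 / p%:R + 4 / Num.sqrt K)) <= _).
  apply: ler_sum => x xo; apply: ler_wpM2l; first exact: w0.
  exact: (each x xo).
by rewrite -mulr_suml w1 mul1r.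
Qed.
End Anticoncentration.

(** * The values of a linear form are not all small *)

Lemma sum_windows (R : realFieldType) (x : nat -> R) N W theta :
  (forall i, 0 <= x i) ->
  (forall i0, (i0 + W <= N)%N -> exists2 i, (i < W)%N & theta <= x (i0 + i)%N) ->
  (N %/ W)%:R * theta <= \sum_(i < N) x i.
Proof.
move=> x0 hx; rewrite -(big_mkord xpredT x).
have main q : (q * W <= N)%N -> q%:R * theta <= \sum_(0 <= i < q * W) x i.
  elim: q => [|q IH] qN; first by rewrite !mul0r mul0n big_nil.
  rewrite (@big_cat_nat _ _ _ (q * W)) //=; last by rewrite mulSn leq_addl.
  rewrite -natr1 mulrDl mul1r lerD ?IH //; first by rewrite (leq_trans _ qN) // mulSn leq_addl.
  have [|i iW hi] := hx (q * W)%N; first by rewrite addnC -mulSn.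
  apply: le_trans hi _; rewrite (bigD1_seq (q * W + i)%N) ?iota_uniq ?mem_index_iota //=.
    by rewrite lerDl sumr_ge0.
  by rewrite leq_addr mulSn addnC ltn_add2r.
have NW := leq_divM N W.
rewrite (@big_cat_nat _ _ _ (N %/ W * W)) //=.
by apply: le_trans (main _ NW) _; rewrite lerDl sumr_ge0.
Qed.

Section LowerBound.
Variables (R : realType) (p : nat).
Hypothesis pp : prime p.
Variables (psi : {scalar {poly 'F_p}}) (Q : {poly 'F_p}).
Hypothesis psiQ : forall g, psi (Q * g) = 0.
Hypothesis psin0 : exists g, psi g != 0.
Hypothesis Q0 : Q != 0.
Hypothesis QX : coprimep Q 'X.
Variables D N : nat.
Hypothesis QD : ((size Q).-1 <= D)%N.

Lemma ratio_sqr_ge (a : 'F_p) L : (0 < L)%N -> (p%:Z <= `|centered a| *+ L) ->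
  L%:R ^- 2 <= ratio R a ^+ 2.
Proof.
move=> L0 h; rewrite /ratio; have p0 : 0 < p%:R :> R by rewrite ltr0n prime_gt0.
rewrite -[leRHS]real_normK ?num_real // -exprVn lerXn2r ?nnegrE ?invr_ge0 //.
rewrite normrM normfV (gtr0_norm p0) ler_pdivlMr // mulrC ler_pdivrMr ?ltr0n //.
rewrite -intr_norm -?mulrA ?mul1r; have : (p%:Z%:~R : R) <= (`|centered a| *+ L)%:~R by rewrite ler_int.
by rewrite raddfMn /= -pmulrn mulr_natr.
Qed.

(** Among [D >= deg Q] consecutive values one is nonzero, since otherwise 1 would annihilate [psi];
    and a nonzero residue is at distance at least [1 / p] from 0. *)
Lemma small_prime_bound : (0 < D)%N ->
  (N %/ D)%:R * p%:R ^- 2 <= \sum_(i < N) ratio R (psi 'X^i) ^+ 2.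
Proof.
move=> D0; apply: (@sum_windows _ (fun i => ratio R (psi 'X^i) ^+ 2)) => [i|i0 _]; first exact: sqr_ge0.
have [|none] := pselect (exists2 i, (i < D)%N & psi 'X^(i0 + i) != 0).
  case=> i iD pi; exists i => //; apply: ratio_sqr_ge; first exact: prime_gt0.
  have : centered (psi 'X^(i0 + i)) != 0.
    by apply: contra pi => /eqP c0; rewrite -[psi _]centeredK // c0.
  by rewrite -normr_gt0 gtz0_ge1 => h; rewrite -mulr_natr natz; have := prime_gt0 pp; nia.
exfalso; case: psin0 => g; rewrite -[g]mulr1 => /negP; apply; apply/eqP.
apply: (@annihilates_window _ psi Q psiQ i0) => // j jQ; rewrite mulr1.
apply/eqP; apply: contrapT => /negP h; apply: none; exists j => //.
exact: leq_trans jQ QD.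
Qed.

Variables k L : nat.
Hypothesis pk : (p < 2 ^ k)%N.
Hypothesis pL : (p ^ D < 2 ^ L)%N.

Definition exceptional_bound := (48 * L * (trunc_log 2 L).+1)%N.
Local Notation K := exceptional_bound.

Lemma large_prime_bound W : (D + k * K * L + L < W)%N ->
  ~ (exists q t, [/\ irreducible_poly q, q %| Q, (0 < t <= K)%N & q %| 'X^t - 1]) ->
  (N %/ W)%:R * L%:R ^- 2 <= \sum_(i < N) ratio R (psi 'X^i) ^+ 2.
Proof.
move=> hW nex; have L0 : (0 < L)%N.
  by case: (L) pL => //; rewrite ltnS leqn0 expn_eq0; case: (p) pp.
have [ls [uls sls lsP]] := many_primes L0.
apply: (@sum_windows _ (fun i => ratio R (psi 'X^i) ^+ 2)) => [i|i0 _]; first exact: sqr_ge0.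
have [//|none] := pselect (exists2 i, (i < W)%N & L%:R ^- 2 <= ratio R (psi 'X^(i0 + i)) ^+ 2).
exfalso; apply: nex; apply: (@small_window_exceptional p psi Q k L K W i0 ls) => //.
- apply: leq_ltn_trans pL; rewrite leq_exp2l // prime_gt1 //.
- apply: leq_ltn_trans hW; by rewrite -!addnA leq_add2r.
- move=> i iW; rewrite ltNge; apply/negP => h; apply: none; exists i => //.
  exact: ratio_sqr_ge.
Qed.
End LowerBound.

(** * Prime factors and their multiplicities *)

Section Primes.
Variable F : finFieldType.
Implicit Types q g : {poly F}.

Definition prime_factor q := [&& q \is monic, irreducibleb q & q != 'X].

Lemma prime_factor_irr q : prime_factor q -> irreducible_poly q.
Proof. by case/and3P => _ /irreducibleP. Qed.

Lemma prime_factor_monic q : prime_factor q -> q \is monic.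
Proof. by case/and3P. Qed.

Lemma prime_factor_size q : prime_factor q -> (1 < size q)%N.
Proof. by move/prime_factor_irr => []. Qed.

Lemma irredp_X : irreducible_poly ('X : {poly F}).
Proof. by rewrite -['X]subr0; exact: irredp_XsubC. Qed.

Lemma prime_factor_coprimeX q : prime_factor q -> coprimep q 'X.
Proof.
case/and3P => qm /irreducibleP qi qX.
by apply: monic_irreducible_coprime; rewrite ?monicX //; apply: irredp_X.
Qed.

Lemma prime_factor_coprime q q' : prime_factor q -> prime_factor q' -> q != q' -> coprimep q q'.
Proof.
move=> a b; apply: monic_irreducible_coprime;
  by rewrite ?prime_factor_monic //; apply: prime_factor_irr.
Qed.

(** A prime of degree 1 that exists over every field, used to recognize the zero polynomial. *)
Lemma prime_factor_Xsub1 : prime_factor ('X - 1%:P).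
Proof.
apply/and3P; split; first exact: monicXsubC.
  by apply/irreducibleP; apply: irredp_XsubC.
apply/eqP => /(congr1 (fun h : {poly F} => h.[0])).
by rewrite !hornerE => /eqP; rewrite ?sub0r oppr_eq0 oner_eq0.
Qed.

Lemma multiplicityE q g v : g != 0 -> (1 < size q)%N ->
  q ^+ v %| g -> ~~ (q ^+ v.+1 %| g) -> multiplicity q g = v.
Proof.
move=> g0 q1 hv nv.
have vg : (v < size g)%N.
  apply: leq_trans (dvdp_leq g0 hv).
  have qv0 : q ^+ v != 0 by rewrite expf_neq0 // -size_poly_gt0 ltnW.
  rewrite -(prednK (_ : 0 < size (q ^+ v))%N) ?size_poly_gt0 // ltnS size_exp.
  by rewrite leq_pmull // -subn1 subn_gt0.
apply/eqP; rewrite eqn_leq; apply/andP; split; last first.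
  exact: (@leq_bigmax_cond _ (fun k : 'I_(size g) => q ^+ k %| g) (fun k => k : nat) (Ordinal vg)).
apply/bigmax_leqP => k kg; rewrite leqNgt; apply: contra nv => vk.
by apply: dvdp_trans kg; apply: dvdp_exp2l.
Qed.

Lemma eq_Nprimes m g g' : g != 0 -> g' != 0 ->
  (forall q, prime_factor q -> (size q <= m.+1)%N -> multiplicity q g = multiplicity q g') ->
  Nprimes m g = Nprimes m g'.
Proof.
move=> g0 g0' h; apply/ffunP => j; rewrite !ffunE /Nprime (negPf g0) (negPf g0').
apply: eq_bigr => q /and4P[qm qs qi qX]; apply: h; first exact/and3P.
by rewrite (eqP qs) ltnS.
Qed.

Lemma prod_prime_powers_dvd (I : finType) (f : I -> {poly F}) (a : I -> nat) g :
  (forall i, prime_factor (f i)) -> injective f ->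
  (\prod_i f i ^+ a i %| g) = [forall i, f i ^+ a i %| g].
Proof.
move=> fp finj; apply/idP/forallP => [dv i|dv].
  by apply: dvdp_trans dv; rewrite (bigD1 i) //= dvdp_mulr.
have : uniq (index_enum I) by apply: index_enum_uniq.
elim: (index_enum I) => [|i s IH]; first by rewrite big_nil dvd1p.
rewrite cons_uniq => /andP[is_ us]; rewrite big_cons Gauss_dvdp ?dv ?IH //.
rewrite big_seq; apply: coprimep_prodr => j js.
apply: coprimep_expl; apply: coprimep_expr.
by apply: prime_factor_coprime => //; apply: contraNneq is_ => /finj ->.
Qed.

Lemma size_prod_prime_powers (I : finType) (f : I -> {poly F}) (a : I -> nat) :
  (forall i, prime_factor (f i)) ->
  (size (\prod_i f i ^+ a i)%R).-1 = (\sum_i a i * (size (f i)).-1)%N.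
Proof.
move=> fp; have mon i : f i ^+ a i \is monic by apply: monic_exp; apply: prime_factor_monic.
have f0 i : f i ^+ a i != 0 by rewrite monic_neq0.
rewrite size_prod //= -sum1_card.
have -> : (\sum_i size (f i ^+ a i)%R = \sum_i a i * (size (f i)).-1 + \sum_(i : I) 1)%N.
  rewrite -big_split /=; apply: eq_bigr => i _.
  by rewrite mulnC -size_exp addn1 prednK // size_poly_gt0.
by rewrite -addSn addnK.
Qed.

Lemma prod_prime_powers_monic (I : finType) (f : I -> {poly F}) (a : I -> nat) :
  (forall i, prime_factor (f i)) -> \prod_i f i ^+ a i \is monic.
Proof. by move=> fp; apply: monic_prod => i _; apply: monic_exp; apply: prime_factor_monic. Qed.

Lemma irreducible_dvd_prod (I : finType) (f : I -> {poly F}) (a : I -> nat) q :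
  (forall i, prime_factor (f i)) -> irreducible_poly q ->
  q %| \prod_i f i ^+ a i -> exists i, q %= f i.
Proof.
move=> fp qi dv; apply: contrapT => none.
have : coprimep q (\prod_i f i ^+ a i).
  apply: coprimep_prodr => i _; apply: coprimep_expr.
  rewrite irreducible_poly_coprime //; apply/negP => qf; apply: none; exists i.
  have := (prime_factor_irr (fp i)).2 q _ qf; apply.
  by apply/eqP => q1; have := qi.1; rewrite q1.
by rewrite irreducible_poly_coprime // dv.
Qed.
End Primes.

(** * Comparison of the two coefficient laws *)

Section Uniform.
Variables (R : realType) (p : nat).
Hypothesis pp : prime p.
Variable n : nat.

(* The uniform monic polynomial also has independent coefficients, the last one
   being 1 almost surely. *)
Definition monic_law (i : 'I_n.+1) (a : 'F_p) : R :=
  if (i < n)%N then p%:R^-1 else (a == 1)%:R.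

Lemma monic_law_ge0 i a : 0 <= monic_law i a.
Proof. by rewrite /monic_law; case: ifP. Qed.

Lemma monic_law_sum i : \sum_a monic_law i a = 1.
Proof.
rewrite /monic_law; case: (i < n)%N.
  by rewrite sumr_const (card_Fp pp) -[LHS]mulr_natl divff // pnatr_eq0 -lt0n prime_gt0.
by rewrite (bigD1 1) //= ?eqxx big1 ?addr0 // => a /negPf ->.
Qed.

Lemma hat_uniform (i : 'I_n.+1) (s : 'F_p) : (i < n)%N -> s != 0 -> hat (monic_law i) s = 0.
Proof.
move=> ilt s0; rewrite /hat /monic_law ilt -mulr_sumr (sum_chr R pp) (negPf s0) mulr0 //.
Qed.

(** There is no error: a nonzero form is nonzero on some [x^j] with [j < deg Q <= n], and the
    transform of the uniform coefficient [j] vanishes there. *)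
Lemma div_mass_monic (Q : {poly 'F_p}) : Q != 0 -> ((size Q).-1 <= n)%N ->
  div_mass monic_law Q = p%:R ^- (size Q).-1.
Proof.
move=> Q0 Qn; apply/eqP; rewrite -subr_eq0 -normr_le0.
apply: div_mass_near => // [i|u u0]; first exact: monic_law_sum.
have [j uj e] := residue_form_neq0 u0.
have jn : (j < n)%N by apply: leq_trans Qn.
rewrite (bigD1 (Ordinal (ltnW jn : j < n.+1)%N)) //= e hat_uniform //.
by rewrite /nrm2 /= expr0n addr0 mul0r.
Qed.
End Uniform.

Lemma coef_weight_sum (R : realType) p n (mu : 'I_n.+1 -> 'F_p -> R) :
  (forall i, \sum_a mu i a = 1) -> \sum_c coef_weight mu c = 1.
Proof.
by move=> m1; rewrite -(bigA_distr_bigA mu) big1.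
Qed.

Section Main.
Variables (R : realType) (p : nat).
Hypothesis pp : prime p.
Variable mu : 'F_p -> R.
Hypothesis mu_ge0 : forall a, 0 <= mu a.
Hypothesis mu1 : \sum_a mu a = 1.
Variables (n m r : nat) (exc : pred {poly 'F_p}) (eps : R).
Hypothesis r_odd : odd r.
Hypothesis m_gt0 : (0 < m)%N.
Hypothesis Dn : (r.*2.+1 * m <= n)%N.
Hypothesis eps_ge0 : 0 <= eps.
Hypothesis good : forall Q : {poly 'F_p}, Q \is monic -> ((size Q).-1 <= r.*2.+1 * m)%N ->
  coprimep Q 'X -> (forall q, prime_factor q -> q %| Q -> ~~ exc q) ->
  `|div_mass (fun _ : 'I_n.+1 => mu) Q - p%:R ^- (size Q).-1| <= eps.

Notation C := {ffun 'I_n.+1 -> 'F_p}.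
Notation wf := (coef_weight (fun _ : 'I_n.+1 => mu)).
Notation wu := (@coef_weight R p n (@monic_law R p n)).

Definition good_prime := {q : {poly_(m.+1) 'F_p} | prime_factor (polyn q) && ~~ exc (polyn q)}.
Definition poly_of_prime (t : good_prime) : {poly 'F_p} := polyn (val t).

Lemma poly_of_primeP t : prime_factor (poly_of_prime t).
Proof. by case/andP: (valP t). Qed.

Lemma poly_of_prime_inj : injective poly_of_prime.
Proof. by move=> t t' /val_inj /val_inj. Qed.

Lemma poly_of_prime_size t : ((size (poly_of_prime t)).-1 <= m)%N.
Proof. by have := size_npoly (val t); rewrite -/(poly_of_prime t); case: (size _). Qed.

Lemma poly_of_prime_size_gt0 t : (0 < (size (poly_of_prime t)).-1)%N.
Proof. by have := prime_factor_size (poly_of_primeP t); case: (size _) => [|[]]. Qed.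

Definition power_dvd (c : C) (t : good_prime) (j : nat) : bool :=
  poly_of_prime t ^+ j %| poly_of_coefs c.

Definition prime_density (t : good_prime) : R := p%:R ^- (size (poly_of_prime t)).-1.

Definition bad_coefs (c : C) : bool :=
  [exists q : {poly_(m.+1) 'F_p}, [&& prime_factor (polyn q), exc (polyn q) & polyn q %| poly_of_coefs c]].

Lemma p_gt0 : 0 < p%:R :> R. Proof. by rewrite ltr0n prime_gt0. Qed.

Lemma prod_density (a : good_prime -> nat) :
  \prod_t prime_density t ^+ a t = p%:R ^- (size (\prod_t poly_of_prime t ^+ a t)%R).-1.
Proof.
rewrite size_prod_prime_powers; last exact: poly_of_primeP.
rewrite -exprVn expr_sum; apply: eq_bigr => t _.
by rewrite /prime_density -exprVn mulnC exprM.
Qed.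

Lemma mass_at_least (wt : 'I_n.+1 -> 'F_p -> R) (a : good_prime -> nat) :
  mass (coef_weight wt) (at_least power_dvd a) = div_mass wt (\prod_t poly_of_prime t ^+ a t).
Proof.
apply: eq_bigl => c; rewrite prod_prime_powers_dvd //; first exact: poly_of_primeP.
exact: poly_of_prime_inj.
Qed.

Lemma degree_prod_le (a : good_prime -> nat) : (\sum_t a t <= r.*2.+1)%N ->
  ((size (\prod_t poly_of_prime t ^+ a t)%R).-1 <= r.*2.+1 * m)%N.
Proof.
move=> h; rewrite size_prod_prime_powers; last exact: poly_of_primeP.
apply: leq_trans (_ : \sum_t a t * m <= _)%N; last by rewrite -big_distrl /= leq_mul2r h orbT.
by apply: leq_sum => t _; rewrite leq_mul2l poly_of_prime_size orbT.
Qed.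

Lemma Nprimes_exactly (v : good_prime -> nat) c c' :
  ~~ bad_coefs c -> ~~ bad_coefs c' ->
  exactly power_dvd v c -> exactly power_dvd v c' ->
  Nprimes m (poly_of_coefs c) = Nprimes m (poly_of_coefs c').
Proof.
move=> bc bc' /forallP ec /forallP ec'.
(* For the zero polynomial, [x - 1] is either exceptional, making it bad, or a good prime all of
   whose powers divide it, so that no exponent is exact. *)
have nz b : ~~ bad_coefs b -> (forall t, power_dvd b t (v t) && ~~ power_dvd b t (v t).+1) ->
    poly_of_coefs b != 0.
  move=> bb eb; apply/eqP => b0; pose q0 : {poly 'F_p} := 'X - 1%:P.
  have sq : (size q0 <= m.+1)%N by rewrite size_XsubC.
  have pq : prime_factor q0 by apply: prime_factor_Xsub1.
  case eq0: (exc q0).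
    case/negP: bb; apply/existsP; exists (NPoly sq); apply/and3P; split => //.
    by rewrite b0 dvdp0.
  have Tq : prime_factor (polyn (NPoly sq)) && ~~ exc (polyn (NPoly sq)) by rewrite /= pq eq0.
  by have := eb (Sub (NPoly sq) Tq); rewrite /power_dvd b0 !dvdp0.
have c0 := nz _ bc ec; have c0' := nz _ bc' ec'.
apply: eq_Nprimes => // q pq sq; have q1 := prime_factor_size pq.
case eq: (exc q).
  have mult0 b : ~~ bad_coefs b -> poly_of_coefs b != 0 -> multiplicity q (poly_of_coefs b) = 0%N.
    move=> bb b0; apply: multiplicityE; rewrite ?expr0 ?dvd1p //.
    apply: contra bb => dv; apply/existsP; exists (NPoly sq); apply/and3P; split => //.
  by rewrite !mult0.
have Tq : prime_factor (polyn (NPoly sq)) && ~~ exc (polyn (NPoly sq)) by rewrite /= pq eq.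
pose t : good_prime := Sub (NPoly sq) Tq.
have multv b : poly_of_coefs b != 0 -> power_dvd b t (v t) && ~~ power_dvd b t (v t).+1 ->
    multiplicity q (poly_of_coefs b) = v t.
  by move=> b0 /andP[h1 h2]; apply: multiplicityE.
by rewrite !multv.
Qed.

Lemma density_le t : prime_density t <= 2^-1.
Proof.
rewrite /prime_density lef_pV2 ?posrE ?exprn_gt0 ?p_gt0 //.
apply: le_trans (_ : p%:R ^+ 1 <= _); first by rewrite expr1 ler_nat prime_gt1.
by rewrite ler_eXn2l ?ltr1n ?prime_gt1 // poly_of_prime_size_gt0.
Qed.

Lemma density_ge t : p%:R ^- m <= prime_density t.
Proof.
rewrite /prime_density lef_pV2 ?posrE ?exprn_gt0 ?p_gt0 //.
by rewrite ler_weXn2l ?ler1n ?prime_gt0 // poly_of_prime_size.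
Qed.

Local Notation Z := (rankin prime_density).

Lemma main_bound (A : pred (discrete {ffun 'I_m -> nat})) :
  mass wu (fun c => A (Nprimes m (poly_of_coefs c)))
  - mass wf (fun c => A (Nprimes m (poly_of_coefs c))) <=
  mass wu bad_coefs + mass wf bad_coefs + (2 / 3) ^+ r.+1 * (Z + Z ^+ 2)
  + eps * Z ^+ 2 * p%:R ^+ (m * r.*2).
Proof.
have -> : p%:R ^+ (m * r.*2) = ((p%:R ^- m) ^+ r.*2)^-1 :> R by rewrite exprM exprVn invrK.
apply: (@sieve_le R good_prime C power_dvd _ _ prime_density r (p%:R ^- m) wf wu eps) => //.
- by move=> c t; rewrite /power_dvd expr0 dvd1p.
- by move=> c t j; apply: dvdp_trans; apply: dvdp_exp2l.
- by rewrite invr_gt0 exprn_gt0 ?p_gt0.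
- by rewrite invf_le1 ?exprn_gt0 ?p_gt0 // exprn_ege1 // ler1n prime_gt0.
- exact: density_ge.
- exact: density_le.
- by move=> c; apply: prodr_ge0 => i _.
- by move=> c; apply: prodr_ge0 => i _; apply: monic_law_ge0.
- move=> a ar; rewrite mass_at_least prod_density div_mass_monic //.
    by rewrite monic_neq0 // prod_prime_powers_monic //; apply: poly_of_primeP.
  exact: leq_trans (degree_prod_le ar) Dn.
- move=> a ar; rewrite mass_at_least prod_density; apply: good.
  + by apply: prod_prime_powers_monic; apply: poly_of_primeP.
  + exact: degree_prod_le.
  + rewrite coprimep_sym; apply: coprimep_prodr => t _; rewrite coprimep_sym; apply: coprimep_expl.
    exact: prime_factor_coprimeX (poly_of_primeP t).
  + move=> q pq dv; have [t qt] := irreducible_dvd_prod poly_of_primeP (prime_factor_irr pq) dv.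
    have -> : q = poly_of_prime t.
      by apply/eqP; rewrite -eqp_monic ?prime_factor_monic ?poly_of_primeP.
    by case/andP: (valP t).
- by move=> v c c' bc bc' ec ec'; rewrite (Nprimes_exactly bc bc' ec ec').
Qed.

Lemma mass_monic_total : mass wu xpredT = 1.
Proof. by apply: coef_weight_sum => i; apply: monic_law_sum. Qed.

Lemma mass_iid_total : mass wf xpredT = 1.
Proof. exact: coef_weight_sum. Qed.

(** The opposite inequality is the one-sided bound for the complement of [A], both total masses
    being 1. *)
Lemma main_bound_abs (A : pred (discrete {ffun 'I_m -> nat})) :
  `|mass wf (fun c => A (Nprimes m (poly_of_coefs c)))
  - mass wu (fun c => A (Nprimes m (poly_of_coefs c)))| <=
  mass wu bad_coefs + mass wf bad_coefs + (2 / 3) ^+ r.+1 * (Z + Z ^+ 2)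
  + eps * Z ^+ 2 * p%:R ^+ (m * r.*2).
Proof.
rewrite ler_norml; apply/andP; split.
  by rewrite lerNl opprB; apply: main_bound.
have compl (w : C -> R) : mass w xpredT = 1 ->
    mass w (fun c => ~~ A (Nprimes m (poly_of_coefs c))) = 1 - mass w (fun c => A (Nprimes m (poly_of_coefs c))).
  move=> <-; apply/eqP; rewrite eq_sym subr_eq addrC; apply/eqP.
  by rewrite /mass [LHS](bigID (fun c => A (Nprimes m (poly_of_coefs c)))).
have := main_bound (predC A); rewrite /= (compl _ mass_monic_total) (compl _ mass_iid_total).
lra.
Qed.
End Main.

(** * Size of the Euler product and of the exceptional set *)

Lemma harmonic_le (R : realType) m : \sum_(i < m.+1) (i.+1%:R)^-1 <= 1 + ln (m.+1%:R) :> R.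
Proof.
elim: m => [|m IH]; first by rewrite big_ord1 invr1 ln1 addr0.
rewrite big_ord_recr /=; apply: le_trans (lerD IH (lexx _)) _.
rewrite -addrA lerD2l.
have h1 : 0 < m.+1%:R / m.+2%:R :> R by rewrite divr_gt0.
have : ln (m.+1%:R / m.+2%:R) <= - (m.+2%:R)^-1 :> R.
  have -> : m.+1%:R / m.+2%:R = 1 + - (m.+2%:R)^-1 :> R.
    have := natr1 (R := R) m.+1; have : m.+2%:R != 0 :> R by [].
    by move: (m.+2%:R : R) => x x0 <-; field; move: x0.
  rewrite le_ln1Dx // ltrN2 invf_lt1 // ltr1n //.
by rewrite ln_div ?posrE // lerNr opprB lerBrDl.
Qed.

Section Bounds.
Variables (R : realType) (p : nat).
Hypothesis pp : prime p.
Variables (m : nat) (exc : pred {poly 'F_p}).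
Hypothesis m_gt0 : (0 < m)%N.

Let p0 : 0 < p%:R :> R. Proof. by rewrite ltr0n prime_gt0. Qed.

(** There are at most [p ^ i / i] primes of degree [i], each of density [p ^- i]: a harmonic sum. *)
Lemma sum_density_le : \sum_(t : good_prime m exc) prime_density R t <= 1 + ln m%:R.
Proof.
have e (t : good_prime m exc) : prime_density R t =
    \sum_(i < m) (if (size (poly_of_prime t)).-1 == i.+1 then prime_density R t else 0).
  have d0 := poly_of_prime_size_gt0 t; have dm := poly_of_prime_size t.
  have lt : ((size (poly_of_prime t)).-1.-1 < m)%N by apply: leq_trans dm; rewrite prednK.
  rewrite (bigD1 (Ordinal lt)) //= prednK // eqxx big1 ?addr0 // => i ij.
  by case: eqP => // ei; case/eqP: ij; apply: val_inj; rewrite /= ei.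
rewrite (eq_bigr _ (fun t _ => e t)) exchange_big /=.
case: m m_gt0 e => // m' _ e; apply: le_trans (harmonic_le R m').
apply: ler_sum => i _; rewrite -big_mkcond /=.
rewrite (eq_bigr (fun=> p%:R ^- i.+1)); last by move=> t /eqP dt; rewrite /prime_density dt.
rewrite sumr_const -[leLHS]mulr_natl ler_pdivrMr ?exprn_gt0 // mulrC ler_pdivlMr ?ltr0n //.
rewrite -natrX -natrM ler_nat mulnC.
have := @card_irreducible_le 'F_p _ (fun t : good_prime m'.+1 exc => (size (poly_of_prime t)).-1 == i.+1)
  (@poly_of_prime p m'.+1 exc) i.+1 isT; rewrite card_Fp //; apply.
- by move=> t _; have pt := poly_of_primeP t; split; [apply: prime_factor_irr | apply: prime_factor_monic].
- by move=> t t' _ _; apply: poly_of_prime_inj.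
- move=> t /eqP dt; rewrite -[LHS]prednK ?dt //.
  by have := prime_factor_size (poly_of_primeP t); case: (size _).
Qed.

(** The Euler product is only polynomial in [m], which is why a truncation depth of order log n
    suffices. *)
Lemma rankin_density_le : rankin (@prime_density R p m exc) <= expR 6 * m%:R ^+ 6.
Proof.
apply: le_trans (_ : \prod_(t : good_prime m exc) expR (6 * prime_density R t) <= _).
  apply: ler_prod => t _; rewrite expR_ge1Dx andbT.
  by rewrite addr_ge0 // mulr_ge0 // invr_ge0 exprn_ge0 // ltW.
rewrite -expR_sum -mulr_sumr.
apply: le_trans (_ : expR (6 * (1 + ln m%:R)) <= _).
  by rewrite ler_expR ler_wpM2l // sum_density_le.
rewrite mulrDr mulr1 expRD ler_wpM2l ?expR_ge0 //.
by rewrite expRM_natl lnK // posrE ltr0n.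
Qed.

Lemma rankin_density_ge1 : 1 <= rankin (@prime_density R p m exc).
Proof.
rewrite /rankin; elim/big_ind: _ => // [x y x1 y1|t _].
  by rewrite -[1]mulr1 ler_pM.
by rewrite lerDl mulr_ge0 // invr_ge0 exprn_ge0 // ltW.
Qed.
End Bounds.

(* Some root of q is a root of unity of order at most K; these q are the exceptional ones. *)
Definition low_order (F : fieldType) K (q : {poly F}) : bool :=
  [exists t : 'I_K.+1, (0 < t)%N && (q %| 'X^t - 1)].

(** By degree, [x^t - 1] has at most [t] distinct prime factors; sum this over [t <= K]. *)
Lemma card_low_order (F : finFieldType) m K :
  (\sum_(q : {poly_(m.+1) F} | prime_factor (polyn q) && low_order K (polyn q)) 1 <= K ^ 2)%N.
Proof.
pose P t (q : {poly_(m.+1) F}) := prime_factor (polyn q) && ((0 < t)%N && (polyn q %| 'X^t - 1)).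
apply: leq_trans (_ : \sum_(t < K.+1) \sum_(q | P t q) 1 <= _)%N.
  under [leqRHS]eq_bigr => t _ do rewrite big_mkcond.
  rewrite exchange_big big_mkcond /=; apply: leq_sum => q _.
  case: ifP => // /andP[pq /existsP[t /andP[t0 qt]]].
  by rewrite (bigD1 t) //= /P pq t0 qt.
have each (t : nat) : (0 < t)%N -> (\sum_(q | P t q) 1 <= t)%N.
  move=> t0; have sz : size ('X^t - 1 : {poly F}) = t.+1 by rewrite size_XnsubC.
  have g0 : 'X^t - 1 != 0 :> {poly F} by rewrite -size_poly_gt0 sz.
  have := @sum_degree_le F _ (P t) (@polyn F m.+1) _ g0; rewrite sz /= => h.
  apply: leq_trans (h _ _ _) => [|q /andP[pq _]|q q' _ _ /val_inj //|q /and3P[]//].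
    apply: leq_sum => q /andP[/prime_factor_size]; by case: (size _) => [|[]].
  by split; [apply: prime_factor_irr | apply: prime_factor_monic].
rewrite big_ord_recl [X in (X + _ <= _)%N]big_pred0 => [|q]; last by rewrite /P andbF.
rewrite add0n; apply: leq_trans (_ : \sum_(i < K) K <= _)%N; last first.
  by rewrite sum_nat_const card_ord.
by apply: leq_sum => t _; apply: leq_trans (each _ _) _ => //=; rewrite /bump add1n.
Qed.

Section Bad.
Variables (R : realType) (p n m K : nat).
Hypothesis pp : prime p.
Hypothesis mn : (m <= n)%N.

Lemma mass_bad_le (wt : 'I_n.+1 -> 'F_p -> R) b : (forall i a, 0 <= wt i a) -> 0 <= b ->
  (forall q, prime_factor q -> (size q <= m.+1)%N -> div_mass wt q <= b) ->
  mass (coef_weight wt) (@bad_coefs p n m (low_order K)) <= (K ^ 2)%:R * b.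
Proof.
move=> w0 b0 hb.
have cw0 c : 0 <= coef_weight wt c by apply: prodr_ge0.
apply: le_trans (_ : \sum_(q : {poly_(m.+1) 'F_p} | prime_factor (polyn q) && low_order K (polyn q)) div_mass wt (polyn q) <= _).
  rewrite /div_mass /mass; under [leRHS]eq_bigr => q _ do rewrite big_mkcond.
  rewrite exchange_big big_mkcond /=; apply: ler_sum => c _.
  have s0 : 0 <= \sum_(q : {poly_(m.+1) 'F_p} | prime_factor (polyn q) && low_order K (polyn q))
      (if polyn q %| poly_of_coefs c then coef_weight wt c else 0).
    by apply: sumr_ge0 => q _; case: ifP.
  case: ifP => // /existsP[q /and3P[pq eq qc]].
  rewrite (bigD1 q) /= ?pq ?eq // qc lerDl.
  by apply: sumr_ge0 => q' _; case: ifP.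
apply: le_trans (_ : \sum_(q : {poly_(m.+1) 'F_p} | prime_factor (polyn q) && low_order K (polyn q)) b <= _).
  by apply: ler_sum => q /andP[pq _]; apply: hb => //; apply: size_npoly.
by rewrite sumr_const -[leLHS]mulr_natl ler_wpM2r // ler_nat -sum1_card card_low_order.
Qed.

Lemma mass_bad_monic :
  mass (coef_weight (@monic_law R p n)) (@bad_coefs p n m (low_order K)) <= (K ^ 2)%:R * p%:R^-1.
Proof.
have p0 : 0 < p%:R :> R by rewrite ltr0n prime_gt0.
apply: mass_bad_le => [i a||q pq sq]; first exact: monic_law_ge0.
  by rewrite invr_ge0 ltW.
have q1 := prime_factor_size pq.
have q0 : q != 0 by rewrite -size_poly_gt0 ltnW.
have dq : (0 < (size q).-1)%N by move: q1; case: (size q) => [|[]].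
have dm : ((size q).-1 <= m)%N by move: sq; case: (size q).
rewrite div_mass_monic // ?(leq_trans dm) // lef_pV2 ?posrE ?exprn_gt0 //.
by rewrite -[leLHS]expr1 ler_weXn2l // ler1n prime_gt0.
Qed.

Variable mu : 'F_p -> R.
Hypothesis mu_ge0 : forall a, 0 <= mu a.
Hypothesis mu1 : \sum_a mu a = 1.
Variable eta0 : R.
Hypothesis eta0_gt0 : 0 < eta0.
Hypothesis mu_le : forall a, mu a <= 1 - eta0.

Lemma mass_bad_iid :
  mass (coef_weight (fun _ : 'I_n.+1 => mu)) (@bad_coefs p n m (low_order K)) <=
  (K ^ 2)%:R * (2 / p%:R + 4 / Num.sqrt (slope R * eta0 * n.+1%:R / 2)).
Proof.
apply: mass_bad_le => [i a||q pq sq] //.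
apply: div_mass_anticoncentration => //; first exact: prime_factor_size.
exact: prime_factor_coprimeX.
Qed.
End Bad.

(** * Total error in terms of the parameters *)

Section Assemble.
Variables (R : realType) (p n m r : nat).
Hypothesis pp : prime p.
Variable mu : 'F_p -> R.
Hypothesis mu_ge0 : forall a, 0 <= mu a.
Hypothesis mu1 : \sum_a mu a = 1.
Variable eta0 : R.
Hypothesis eta0_gt0 : 0 < eta0.
Hypothesis mu_le : forall a, mu a <= 1 - eta0.
Hypothesis r_odd : odd r.
Hypothesis m_gt0 : (0 < m)%N.

(** In order: D, the exponent k, L and K of the overview, the length of a window on which the values
    cannot all be small, and the constant that [eps_small] requires. *)
Definition degree_bound := (r.*2.+1 * m)%N.
Definition bits := (trunc_log 2 p).+1.
Definition len := (degree_bound * bits)%N.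
Definition order_bound := exceptional_bound len.
Definition window := (degree_bound + bits * order_bound * len + len).+1.
Definition density_const : R := 4 / (slope R * eta0).

Hypothesis Dn : (degree_bound <= n)%N.

Notation wf := (coef_weight (fun _ : 'I_n.+1 => mu)).
Notation wu := (@coef_weight R p n (@monic_law R p n)).

Lemma degree_bound_gt0 : (0 < degree_bound)%N. Proof. by rewrite muln_gt0. Qed.

Lemma p_lt_bits : (p < 2 ^ bits)%N. Proof. exact: trunc_log_ltn. Qed.

Lemma pD_lt_len : (p ^ degree_bound < 2 ^ len)%N.
Proof. by rewrite /len mulnC expnM ltn_exp2r ?degree_bound_gt0 // p_lt_bits. Qed.

(** The constant makes the first factor at most [expR (- (2 * len))], while [p <= expR bits] bounds
    the second by [expR len]; the remaining [expR (- len)] beats [(2 / 3) ^+ r.+1] as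
    [r + 1 <= len]. *)
Lemma eps_small beta : density_const * len%:R <= beta ->
  expR (- (slope R * eta0 * beta / 2)) * p%:R ^+ (m * r.*2) <= (2 / 3) ^+ r.+1.
Proof.
move=> hb; have s0 := slope_gt0 R.
have se0 : 0 < slope R * eta0 by rewrite mulr_gt0.
have p0 : 0 < p%:R :> R by rewrite ltr0n prime_gt0.
have h2 : (2 : R) <= expR 1 by apply: le_trans (expR_ge1Dx 1); lra.
have pe : p%:R <= expR (bits%:R) :> R.
  apply: le_trans (_ : 2 ^+ bits <= _).
    by rewrite -natrX ler_nat ltnW // p_lt_bits.
  by rewrite -[bits%:R]mulr1 expRM_natl lerXn2r ?nnegrE ?expR_ge0.
have e1 : expR (- (slope R * eta0 * beta / 2)) <= expR (- (2 * len%:R)).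
  rewrite ler_expR lerN2.
  have -> : 2 * len%:R = slope R * eta0 * (density_const * len%:R) / 2.
    by rewrite /density_const; field; rewrite ?(gt_eqF s0) ?(gt_eqF eta0_gt0).
  by rewrite ler_pM2r ?invr_gt0 // ler_pM2l.
have e2 : p%:R ^+ (m * r.*2) <= expR (len%:R) :> R.
  apply: le_trans (_ : expR bits%:R ^+ degree_bound <= _); last first.
    by rewrite -expRM_natl -natrM.
  apply: le_trans (_ : expR bits%:R ^+ (m * r.*2) <= _).
    by rewrite lerXn2r ?nnegrE ?expR_ge0 // ltW.
  rewrite ler_weXn2l //; first by rewrite -expR0 ler_expR.
  by rewrite /degree_bound mulnC leq_mul2r leqnSn orbT.
apply: le_trans (ler_pM (expR_ge0 _) (exprn_ge0 _ (ltW p0)) e1 e2) _.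
rewrite -expRD.
have -> : - (2 * len%:R) + len%:R = - len%:R :> R by ring.
rewrite expRN.
have -> : (2 / 3) ^+ r.+1 = ((3 / 2) ^+ r.+1)^-1 :> R.
  by rewrite -exprVn; congr (_ ^+ _); field.
rewrite lef_pV2 ?posrE ?expR_gt0 ?exprn_gt0 //.
apply: le_trans (_ : expR 1 ^+ r.+1 <= _).
  by rewrite lerXn2r ?nnegrE ?expR_ge0 //; lra.
rewrite -expRM_natl mulr1 ler_expR ler_nat /len /degree_bound.
have : (0 < bits)%N by []. move: m_gt0; case: (m) => // m' _; case: bits => // k _.
by rewrite -[r.+1]muln1 -mulnA leq_mul //; lia.
Qed.

Lemma final_bound (exc : pred {poly 'F_p}) beta (A : pred (discrete {ffun 'I_m -> nat})) :
  density_const * len%:R <= beta ->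
  (forall Q (psi : {scalar {poly 'F_p}}), Q != 0 -> coprimep Q 'X ->
    ((size Q).-1 <= degree_bound)%N -> (forall q, prime_factor q -> q %| Q -> ~~ exc q) ->
    (forall g, psi (Q * g) = 0) -> (exists g, psi g != 0) ->
    beta <= \sum_(i < n.+1) ratio R (psi 'X^i) ^+ 2) ->
  `|mass wf (fun c => A (Nprimes m (poly_of_coefs c)))
  - mass wu (fun c => A (Nprimes m (poly_of_coefs c)))| <=
  mass wu (bad_coefs m exc) + mass wf (bad_coefs m exc)
  + (2 / 3) ^+ r.+1 * (3 * (expR 6 * m%:R ^+ 6) ^+ 2).
Proof.
move=> hb hgood.
apply: le_trans (@main_bound_abs R p pp mu mu_ge0 mu1 n m r exc
  (expR (- (slope R * eta0 * beta / 2))) r_odd m_gt0 Dn (expR_ge0 _) _ A) _.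
  move=> Q Qm QD QX Qexc; have Q0 := monic_neq0 Qm.
  apply: (@div_mass_good R p pp mu mu_ge0 mu1 eta0 eta0_gt0 mu_le n Q beta Q0).
  by move=> psi psiQ psin0; apply: (hgood Q).
set Z := rankin _.
have Z1 : 1 <= Z by apply: rankin_density_ge1.
have ZB : Z <= expR 6 * m%:R ^+ 6 by apply: rankin_density_le.
rewrite -addrA lerD2l mulrAC.
have := eps_small hb; set e := expR _ * _; set q := (2 / 3) ^+ r.+1 => eq.
have q0 : 0 <= q by rewrite exprn_ge0 // divr_ge0.
apply: le_trans (_ : q * (Z + Z ^+ 2) + q * Z ^+ 2 <= _).
  by rewrite lerD2l ler_wpM2r // exprn_ge0 // (le_trans _ Z1).
rewrite -mulrDr ler_wpM2l //.
apply: le_trans (_ : 3 * Z ^+ 2 <= _); first by nra.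
by rewrite ler_wpM2l // lerXn2r ?nnegrE ?(le_trans _ Z1) // (le_trans (le_trans _ Z1) ZB).
Qed.

Local Notation Dif A := (`|mass wf (fun c => A (Nprimes m (poly_of_coefs c)))
  - mass wu (fun c => A (Nprimes m (poly_of_coefs c)))|).

Lemma final_bound_small_prime (A : pred (discrete {ffun 'I_m -> nat})) :
  density_const * len%:R <= (n.+1 %/ degree_bound)%:R * p%:R ^- 2 ->
  Dif A <= (2 / 3) ^+ r.+1 * (3 * (expR 6 * m%:R ^+ 6) ^+ 2).
Proof.
move=> h; apply: le_trans (@final_bound pred0 _ A h _) _.
  move=> Q psi Q0 QX QD _ psiQ psin0; apply: (small_prime_bound R pp psiQ psin0 Q0 QX n.+1 QD).
  exact: degree_bound_gt0.
have nobad : @bad_coefs p n m pred0 =1 pred0.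
  by move=> c; apply/negbTE; rewrite negb_exists; apply/forallP => q; rewrite andbF.
by rewrite /mass !(big_pred0 _ _ _ _ nobad) !add0r.
Qed.

Lemma final_bound_large_prime (A : pred (discrete {ffun 'I_m -> nat})) :
  density_const * len%:R <= (n.+1 %/ window)%:R * len%:R ^- 2 ->
  Dif A <= (order_bound ^ 2)%:R * (3 / p%:R + 4 / Num.sqrt (slope R * eta0 * n.+1%:R / 2))
    + (2 / 3) ^+ r.+1 * (3 * (expR 6 * m%:R ^+ 6) ^+ 2).
Proof.
move=> h; apply: le_trans (@final_bound (low_order order_bound) _ A h _) _.
  move=> Q psi Q0 QX QD Qexc psiQ psin0.
  apply: (@large_prime_bound R p pp psi Q psiQ psin0 Q0 QX degree_bound n.+1 QD bits len) => //.
  - exact: p_lt_bits.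
  - exact: pD_lt_len.
  case=> q [t [qi qQ /andP[t0 tK] qt]].
  have qn0 : q != 0 by apply: irredp_neq0.
  (* Made monic, the low-order factor becomes a prime factor of [Q], different from [x] by
     coprimality, and so contradicts [Qexc]. *)
  pose q' := (lead_coef q)^-1 *: q.
  have l0 : lead_coef q != 0 by rewrite lead_coef_eq0.
  have q'q : q' %= q by rewrite eqp_scale // invr_eq0.
  have q'i : irreducible_poly q'.
    split; first by rewrite size_scale ?invr_eq0 // qi.1.
    move=> d d1 dq; apply: eqp_trans (_ : d %= q) _; last by rewrite eqp_sym.
    by apply: qi.2 => //; rewrite -(eqp_dvdr _ q'q).
  have q'X : q' != 'X.
    apply/eqP => eX; have : q' %| 'X by rewrite eX.
    have : coprimep q' 'X by apply: coprimep_dvdr QX; rewrite (eqp_dvdl _ q'q).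
    by rewrite irreducible_poly_coprime // => /negP.
  have pf : prime_factor q'.
    apply/and3P; split => //; last exact/irreducibleP.
    by rewrite monicE lead_coefZ mulVf.
  have := Qexc q' pf; rewrite (eqp_dvdl _ q'q) => /(_ qQ) /negP; apply.
  by apply/existsP; exists (Ordinal (tK : t < order_bound.+1)%N); rewrite t0 /= (eqp_dvdl _ q'q).
rewrite lerD2r.
have mn : (m <= n)%N by apply: leq_trans Dn; rewrite /degree_bound mulSn leq_addr.
have b1 := mass_bad_monic R order_bound pp mn.
have b2 := mass_bad_iid n m order_bound pp mu_ge0 mu1 eta0_gt0 mu_le.
apply: le_trans (lerD b1 b2) _.
rewrite -mulrDr ler_wpM2l // addrA lerD2r le_eqVlt; apply/orP; left; apply/eqP.
by field; rewrite pnatr_eq0 -lt0n prime_gt0.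
Qed.
End Assemble.

(** * Choice of the parameters *)

Lemma trunc_log2_le (R : realType) N : (0 < N)%N -> (trunc_log 2 N)%:R <= 2 * ln (N%:R) :> R.
Proof.
move=> N0; have h2 : 1 / 2 <= ln 2 :> R.
  have : ln (1 + - (1 / 2)) <= - (1 / 2) :> R by rewrite le_ln1Dx //; lra.
  have -> : 1 + - (1 / 2) = 2^-1 :> R by lra.
  by rewrite lnV ?posrE //; lra.
have h : (2 ^ trunc_log 2 N <= N)%N by apply: trunc_logP.
have : ln (2%:R ^+ trunc_log 2 N) <= ln (N%:R) :> R.
  by rewrite ler_ln ?posrE ?exprn_gt0 ?ltr0n // -natrX ler_nat.
rewrite lnXn // -[leLHS]mulr_natl => h3.
have t0 : 0 <= (trunc_log 2 N)%:R :> R by [].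
nra.
Qed.

Section Scales.
(* X = n^(1/13) and U = n^(-delta). *)
Variables (R : realType) (n p m : nat) (X U : R).
Hypothesis n_gt0 : (0 < n)%N.
Hypothesis nX : n%:R = X ^+ 13.
Hypothesis X1 : 1 <= X.
Hypothesis U0 : 0 < U.
Hypothesis U1 : U <= 1.
Hypothesis p_gt1 : (1 < p)%N.
Hypothesis pX : p%:R <= expR X.
Hypothesis m_gt0 : (0 < m)%N.
Hypothesis mXU : m%:R <= X * U.

Let l : R := 1 + ln n%:R.
(* Chosen so that (2/3)^(r+1) <= n^(-13), which beats the factor m^12 of the sieve. *)
Let r := (Num.truncn (20 * l)).*2.+1.
Let D := degree_bound m r.
Let k := bits p.
Let L := len p m r.
Let K := order_bound p m r.
Let W := window p m r.

Lemma log_ge1 : 1 <= l.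
Proof. by rewrite lerDl ln_ge0 // ler1n. Qed.

(** With [y = ln X / 6] one has [l = 1 + 78 y], as [78 = 13 * 6], and [X] is the sixth power of
    [expR y >= 1 + y]. *)
Lemma log_pow6_le : l ^+ 6 <= 78 ^+ 6 * X.
Proof.
have n0 : 0 < n%:R :> R by rewrite ltr0n.
have X0 : 0 < X := lt_le_trans ltr01 X1.
have lX : ln n%:R = 13 * ln X by rewrite nX lnXn // -[LHS]mulr_natl.
have lX0 : 0 <= ln X by apply: ln_ge0.
have h : X = expR (ln X / 6) ^+ 6.
  by rewrite -expRM_natl mulrC divfK // lnK // posrE.
rewrite h -exprMn lerXn2r ?nnegrE ?mulr_ge0 ?expR_ge0 ?(le_trans ler01 log_ge1) //.
have := expR_ge1Dx (ln X / 6); rewrite /l lX; lra.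
Qed.

Lemma scale_ge1 : 1 <= X * U.
Proof. by apply: le_trans mXU; rewrite ler1n. Qed.

Lemma sieve_depth_le : r.*2.+1%:R <= 83 * l.
Proof.
have l1 := log_ge1.
have h : (Num.truncn (20 * l))%:R <= 20 * l by rewrite truncn_le; lra.
rewrite /r; move: (Num.truncn _) h => t h.
have -> : (t.*2.+1).*2.+1%:R = 4 * t%:R + 3 :> R.
  by rewrite -natrM -natrD; congr (_%:R); lia.
lra.
Qed.

(** From [r + 1 >= 40 l] and [2 / 3 <= expR (- (1 / 3))] the power is at most [expR (- (13 * l))];
    the 1 in [l] pays for [expR 6 ^+ 2]. The factor [U ^+ 3] is gained from [1 <= X * U]. *)
Lemma sieve_error_le : (2 / 3) ^+ r.+1 * (3 * (expR 6 * m%:R ^+ 6) ^+ 2) <= 3 * U ^+ 3.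
Proof.
have l1 := log_ge1; have n0 : 0 < n%:R :> R by rewrite ltr0n.
have XU := scale_ge1; have x1 := X1.
have ln23 : 2 / 3 <= expR (- (1 / 3)) :> R.
  have -> : 2 / 3 = 1 + - (1 / 3) :> R by lra.
  exact: expR_ge1Dx.
have rl : 40 * l <= r.+1%:R.
  have : 20 * l < (Num.truncn (20 * l)).+1%:R by apply: truncnS_gt.
  rewrite /r; move: (Num.truncn _) => t.
  have -> : t.*2.+2%:R = 2 * t.+1%:R :> R by rewrite -natrM mul2n.
  lra.
have e1 : (2 / 3) ^+ r.+1 <= expR (- (13 * l)) :> R.
  apply: le_trans (_ : expR (- (1 / 3)) ^+ r.+1 <= _).
    by rewrite lerXn2r ?nnegrE ?expR_ge0 //; lra.
  by rewrite -expRM_natl ler_expR; lra.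
have e2 : expR (- (13 * l)) * (expR 6) ^+ 2 <= n%:R ^- 13.
  rewrite -expRM_natl -expRD.
  have -> : n%:R ^- 13 = expR (- (13 * ln n%:R)) :> R.
    by rewrite expRN expRM_natl lnK.
  rewrite ler_expR /l.
  have -> : - (13 * (1 + ln n%:R)) + 2%:R * 6 = - (13 * ln n%:R) - 1 :> R by ring.
  by rewrite gerBl.
have mX : m%:R <= X by apply: le_trans mXU _; rewrite ler_piMr // (le_trans ler01 X1).
have e3 : (m%:R ^+ 6) ^+ 2 <= X ^+ 12.
  by rewrite -exprM lerXn2r ?nnegrE ?(le_trans ler01 X1).
have X0 : 0 < X := lt_le_trans ltr01 X1.
have e4 : n%:R ^- 13 * X ^+ 12 <= U ^+ 3.
  rewrite nX ler_pdivrMl ?exprn_gt0 //.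
  apply: le_trans (_ : X ^+ 12 * (X * U) ^+ 3 <= _).
    by rewrite -[leLHS]mulr1 ler_wpM2l ?exprn_ge0 ?exprn_ege1 ?(ltW X0).
  rewrite exprMn mulrA ler_wpM2r ?exprn_ge0 ?(ltW U0) //.
  by rewrite -exprD -exprM ler_weXn2l.
rewrite mulrCA ler_wpM2l // [(expR 6 * _) ^+ 2]exprMn mulrA.
have f1 : 0 <= (2 / 3) ^+ r.+1 * expR 6 ^+ 2 :> R.
  by rewrite mulr_ge0 ?exprn_ge0 ?expR_ge0 // divr_ge0.
have f2 : 0 <= (m%:R ^+ 6) ^+ 2 :> R by rewrite exprn_ge0 // exprn_ge0.
have f3 : (2 / 3) ^+ r.+1 * expR 6 ^+ 2 <= n%:R ^- 13 :> R.
  by apply: le_trans e2; rewrite ler_wpM2r // exprn_ge0 ?expR_ge0.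
apply: le_trans e4; exact: (ler_pM f1 f2 f3 e3).
Qed.

Lemma degree_bound_le : D%:R <= 83 * l * (X * U).
Proof.
rewrite /D /degree_bound natrM; apply: ler_pM => //; exact: sieve_depth_le.
Qed.

Lemma bits_le : k%:R <= 3 * X.
Proof.
rewrite /k /bits -natr1.
have : (trunc_log 2 p)%:R <= 2 * ln (p%:R) :> R by apply: trunc_log2_le; lia.
have : ln p%:R <= X.
  by rewrite -[leRHS]expRK ler_ln ?posrE ?expR_gt0 // ltr0n; lia.
have := X1; lra.
Qed.

Lemma len_le : L%:R <= 249 * l * (X ^+ 2 * U).
Proof.
rewrite /L /len natrM.
have -> : 249 * l * (X ^+ 2 * U) = (83 * l * (X * U)) * (3 * X) by ring.
by apply: ler_pM => //; [exact: degree_bound_le | exact: bits_le].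
Qed.

Lemma degree_gt0 : (0 < D)%N. Proof. by rewrite /D /degree_bound muln_gt0. Qed.
Lemma len_gt0 : (0 < L)%N. Proof. by rewrite /L /len muln_gt0 /= andbT degree_gt0. Qed.

Lemma ln_len_le : ln L%:R <= 300 * l.
Proof.
have l1 := log_ge1; have n1 : 1 <= n%:R :> R by rewrite ler1n.
have x1 := X1; have X0 : 0 < X := lt_le_trans ltr01 X1.
have Xn : X ^+ 2 <= n%:R by rewrite nX ler_weXn2l.
have LB : L%:R <= 249 * l * n%:R.
  apply: le_trans len_le _; rewrite ler_wpM2l ?mulr_ge0 ?ler0n ?(le_trans ler01 l1) //.
  by apply: le_trans Xn; rewrite ler_piMr // exprn_ge0 //; lra.
have l0 : 0 < l := lt_le_trans ltr01 l1.
have n0 : 0 < n%:R :> R by rewrite ltr0n.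
have LP : 0 < L%:R :> R by rewrite ltr0n len_gt0.
have q0 : 0 < 249 * l by rewrite mulr_gt0 ?ltr0n.
apply: le_trans (_ : ln (249 * l * n%:R) <= _).
  by rewrite ler_ln ?posrE ?LP ?(mulr_gt0 q0 n0).
rewrite (lnM q0 n0) (lnM _ l0) ?posrE ?ltr0n //.
have a1 : ln (1 + 248) <= 248 :> R by apply: le_ln1Dx; lra.
have a2 : ln (1 + (l - 1)) <= l - 1 by apply: le_ln1Dx; lra.
have e1 : 1 + 248 = 249 :> R by lra.
have e2 : 1 + (l - 1) = l by lra.
have e3 : ln n%:R = l - 1 by rewrite /l addrC addKr.
by rewrite e3; rewrite e1 in a1; rewrite e2 in a2; lra.
Qed.

(* Sealed, so that conversion never unfolds it into unary numerals. *)
Lemma order_const_subproof : {x : R | x = 48 * 249 * 601}.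
Proof. by exists (48 * 249 * 601). Qed.

Definition order_const : R := sval order_const_subproof.

Lemma order_constE : order_const = 48 * 249 * 601.
Proof. exact: svalP order_const_subproof. Qed.

(** In [order_const], 48 comes from [exceptional_bound], 249 from [len_le], and [601 = 2 * 300 + 1]
    from the logarithm of [len]. *)
Lemma order_bound_le : K%:R <= order_const * (l ^+ 2 * X ^+ 2 * U).
Proof.
have l1 := log_ge1.
have t : (trunc_log 2 L).+1%:R <= 601 * l.
  rewrite -natr1; have := trunc_log2_le R len_gt0; have := ln_len_le; lra.
rewrite /K /order_bound /exceptional_bound -/L (natrM _ (48 * L)) (natrM _ 48) order_constE.
have -> : 48 * 249 * 601 * (l ^+ 2 * X ^+ 2 * U) = 48 * (249 * l * (X ^+ 2 * U)) * (601 * l) by ring.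
apply: ler_pM => //; rewrite ler_wpM2l //. exact: len_le.
Qed.

Lemma order_bound_gt0 : (0 < K)%N.
Proof. by rewrite /K /order_bound /exceptional_bound -/L (muln_gt0 (48 * L)) (muln_gt0 48) len_gt0. Qed.

Lemma window_le : W%:R <= 4 * (3 * X * (order_const * (l ^+ 2 * X ^+ 2 * U)) * (249 * l * (X ^+ 2 * U))).
Proof.
apply: le_trans (_ : 4 * (k%:R * K%:R * L%:R) <= _); last first.
  rewrite ler_wpM2l // ler_pM ?len_le // ?mulr_ge0 // ler_pM ?order_bound_le // bits_le //.
rewrite -!natrM ler_nat /W /window.
have kK : (0 < k * K)%N by rewrite muln_gt0 order_bound_gt0.
have DL : (D <= L)%N by rewrite /L /len leq_pmulr.
have LT : (L <= k * K * L)%N by rewrite leq_pmull.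
have L0 := len_gt0; rewrite -/D -/k -/K -/L; move: (k * K * L)%N LT => T LT; lia.
Qed.

Variable c : R.
Hypothesis c0 : 0 < c.

(** The constants lost in [window_len_le]: [249 ^+ 3] for the cube of the length, the bracket for
    the window, [78 ^+ 6] for the logarithms. *)
Definition scale_min : R := (c + 2) * 249 ^+ 3 * (4 * 3 * order_const * 249) * 78 ^+ 6.

Hypothesis X_large : scale_min <= X.

Lemma order_const_gt0 : 0 < order_const. Proof. by rewrite order_constE !mulr_gt0 ?ltr0n. Qed.

(** The left side is of order [l ^+ 6 * X ^+ 11]; one more power of [X] absorbs the logarithms and
    the thirteenth the constants. The 2 added to [c] leaves room for rounding in quotients. *)
Lemma window_len_le : (c + 2) * L%:R ^+ 3 * W%:R <= n%:R.
Proof.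
have l1 := log_ge1; have x1 := X1; have u0 := U0; have u1 := U1.
have X0 : 0 < X := lt_le_trans ltr01 X1.
apply: le_trans (_ : (c + 2) * (249 * l * (X ^+ 2 * U)) ^+ 3 *
   (4 * (3 * X * (order_const * (l ^+ 2 * X ^+ 2 * U)) * (249 * l * (X ^+ 2 * U)))) <= _).
  apply: ler_pM; rewrite ?window_le ?mulr_ge0 ?exprn_ge0 //; first by have := c0; lra.
  rewrite ler_wpM2l //; first by have := c0; lra.
  by rewrite lerXn2r ?nnegrE ?(le_trans _ len_le) // len_le.
have -> : (c + 2) * (249 * l * (X ^+ 2 * U)) ^+ 3 *
   (4 * (3 * X * (order_const * (l ^+ 2 * X ^+ 2 * U)) * (249 * l * (X ^+ 2 * U)))) =
   ((c + 2) * 249 ^+ 3 * (4 * 3 * order_const * 249)) * (l ^+ 6 * (X ^+ 11 * U ^+ 5)) by ring.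
have U5 : X ^+ 11 * U ^+ 5 <= X ^+ 11.
  by rewrite ler_piMr ?exprn_ge0 ?exprn_ile1 //; lra.
have cc : 0 <= (c + 2) * 249 ^+ 3 * (4 * 3 * order_const * 249).
  have c2 : 0 <= c + 2 by rewrite addr_ge0 ?(ltW c0).
  by rewrite !mulr_ge0 ?exprn_ge0 ?ler0n ?c2 ?(ltW order_const_gt0).
apply: le_trans (_ : (c + 2) * 249 ^+ 3 * (4 * 3 * order_const * 249) * ((78 ^+ 6 * X) * X ^+ 11) <= _).
  rewrite (ler_wpM2l cc) // ler_pM ?log_pow6_le ?mulr_ge0 ?exprn_ge0 ?(ltW X0) ?(ltW U0) ?(le_trans ler01 l1) //.
rewrite nX.
have -> : (c + 2) * 249 ^+ 3 * (4 * 3 * order_const * 249) * (78 ^+ 6 * X * X ^+ 11) = scale_min * X ^+ 12.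
  by rewrite /scale_min; ring.
by rewrite [leRHS]exprS ler_wpM2r // exprn_ge0 //; lra.
Qed.

Lemma len_ge1 : 1 <= L%:R :> R. Proof. by rewrite ler1n len_gt0. Qed.

Lemma degree_bound_le_len : (D <= L)%N.
Proof. by rewrite /L /len leq_pmulr. Qed.

Lemma len_lt_window : (L < W)%N.
Proof. by rewrite /W /window ltnS leq_addl. Qed.

Lemma natdiv_ge (a : R) V N : (0 < V)%N -> (a + 1) * V%:R <= N%:R -> a <= (N %/ V)%:R.
Proof.
move=> V0 h; have V0' : 0 < V%:R :> R by rewrite ltr0n.
have : N%:R <= ((N %/ V).+1 * V)%:R :> R by rewrite ler_nat ltnW // ltn_ceil.
rewrite natrM -natr1 => h2.
by rewrite -(lerD2r 1) -(ler_pM2r V0'); apply: le_trans h _.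
Qed.

Lemma degree_bound_le_n : (D <= n)%N.
Proof.
rewrite -(ler_nat R); apply: le_trans window_len_le.
have l1 := len_ge1; have c00 := c0.
have : D%:R <= W%:R :> R by rewrite ler_nat (leq_trans degree_bound_le_len) // ltnW // len_lt_window.
have W0 : 0 <= W%:R :> R by [].
have : 1 <= (c + 2) * L%:R ^+ 3.
  by apply: mulr_ege1; [lra | rewrite exprn_ege1].
nra.
Qed.

Lemma large_condition : c * L%:R <= (n.+1 %/ W)%:R * L%:R ^- 2.
Proof.
have l1 := len_ge1; have c00 := c0; have L0 : 0 < L%:R :> R by lra.
rewrite ler_pdivlMr ?exprn_gt0 //.
apply: natdiv_ge => //; apply: le_trans (_ : n%:R <= _); last by rewrite ler_nat.
apply: le_trans window_len_le; rewrite ler_wpM2r //.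
have -> : c * L%:R * L%:R ^+ 2 = c * L%:R ^+ 3 by ring.
have : 1 <= L%:R ^+ 3 :> R by rewrite exprn_ege1.
lra.
Qed.

(** Failure of the first alternative forces [p] to be large compared with the root of [n / (D * L)],
    which keeps exceptional factors rare. *)
Lemma small_or_large_prime :
  c * L%:R <= (n.+1 %/ D)%:R * p%:R ^- 2 \/ n%:R <= 2 * c * D%:R * L%:R * p%:R ^+ 2.
Proof.
have [|h] := leP (c * L%:R) ((n.+1 %/ D)%:R * p%:R ^- 2); [by left|right].
have p0 : 0 < p%:R :> R by rewrite ltr0n; lia.
have D0 : 0 < D%:R :> R by rewrite ltr0n degree_gt0.
move: h; rewrite ltr_pdivrMr ?exprn_gt0 // => h.
have h2 : n.+1%:R < ((n.+1 %/ D).+1)%:R * D%:R :> R by rewrite -natrM ltr_nat ltn_ceil // degree_gt0.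
have h3 : 2 * D%:R <= n%:R :> R.
  apply: le_trans window_len_le; have l1 := len_ge1; have c00 := c0.
  have : D%:R <= W%:R :> R by rewrite ler_nat (leq_trans degree_bound_le_len) // ltnW // len_lt_window.
  have L3 : 1 <= L%:R ^+ 3 :> R by rewrite exprn_ege1.
  move=> DW; apply: ler_pM => //.
  by rewrite -[leLHS]mulr1; apply: ler_pM => //; lra.
rewrite -natr1 in h2; rewrite -[(_ %/ _).+1%:R]natr1 in h2.
set q := (n.+1 %/ D)%:R in h h2.
have : q * D%:R <= c * L%:R * p%:R ^+ 2 * D%:R by rewrite ler_pM2r // ltW.
lra.
Qed.

Lemma sqr_bound (y C : R) : 0 <= C -> y ^+ 2 <= C * U ^+ 6 -> y <= Num.sqrt C * U ^+ 3.
Proof.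
move=> C0 h; have B0 : 0 <= Num.sqrt C * U ^+ 3.
  by rewrite mulr_ge0 ?sqrtr_ge0 // exprn_ge0 // ltW.
have [y0|y0] := leP y 0; first by apply: le_trans B0.
rewrite -(@ler_pXn2r _ 2) ?nnegrE ?(ltW y0) // exprMn sqr_sqrtr //.
by rewrite -exprM.
Qed.

Lemma log_pow12_le : l ^+ 12 <= 78 ^+ 12 * X ^+ 2.
Proof.
have l1 := log_ge1.
have -> : l ^+ 12 = (l ^+ 6) ^+ 2 by rewrite -exprM.
have -> : 78 ^+ 12 * X ^+ 2 = (78 ^+ 6 * X) ^+ 2 by rewrite exprMn -exprM.
by rewrite lerXn2r ?nnegrE ?(le_trans _ log_pow6_le) ?log_pow6_le // exprn_ge0 //; lra.
Qed.

Lemma order_bound_pow4_le : K%:R ^+ 4 <= order_const ^+ 4 * (l ^+ 8 * X ^+ 8 * U ^+ 4).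
Proof.
have -> : order_const ^+ 4 * (l ^+ 8 * X ^+ 8 * U ^+ 4) = (order_const * (l ^+ 2 * X ^+ 2 * U)) ^+ 4 by ring.
by rewrite lerXn2r ?nnegrE ?(le_trans _ order_bound_le) // order_bound_le.
Qed.

Definition prime_const : R := 2 * c * order_const ^+ 4 * 83 * 249 * 78 ^+ 12.
Definition coef_const : R := order_const ^+ 4 * 78 ^+ 12.

(** All thirteen powers of [X] are spent: [K ^ 4 * D * L] has order [l ^+ 10 * X ^+ 11 * U ^+ 6],
    and the logarithms take the remaining [X ^+ 2]. *)
Lemma order_bound_div_prime_le : n%:R <= 2 * c * D%:R * L%:R * p%:R ^+ 2 ->
  (K ^ 2)%:R / p%:R <= Num.sqrt prime_const * U ^+ 3.
Proof.
move=> h; have p0 : 0 < p%:R :> R by rewrite ltr0n; lia.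
have n0 : 0 < n%:R :> R by rewrite ltr0n.
have l1 := log_ge1; have x1 := X1; have u0 := U0; have c00 := c0; have k0 := order_const_gt0.
have X0 : 0 < X := lt_le_trans ltr01 X1.
apply: sqr_bound.
  by rewrite /prime_const !mulr_ge0 ?exprn_ge0 ?ler0n ?(ltW k0) ?(ltW c0).
rewrite natrX expr_div_n -exprM ler_pdivrMr ?exprn_gt0 //.
have a1 : D%:R * L%:R <= 83 * l * (X * U) * (249 * l * (X ^+ 2 * U)).
  by apply: ler_pM => //; [exact: degree_bound_le|exact: len_le].
have a2 : K%:R ^+ 4 * (D%:R * L%:R) <=
   order_const ^+ 4 * (l ^+ 8 * X ^+ 8 * U ^+ 4) * (83 * l * (X * U) * (249 * l * (X ^+ 2 * U))).
  exact: (ler_pM (exprn_ge0 _ (ler0n _ _)) (mulr_ge0 (ler0n _ _) (ler0n _ _)) order_bound_pow4_le a1).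
have a3 : order_const ^+ 4 * (l ^+ 8 * X ^+ 8 * U ^+ 4) * (83 * l * (X * U) * (249 * l * (X ^+ 2 * U))) =
  order_const ^+ 4 * 83 * 249 * U ^+ 6 * X ^+ 11 * l ^+ 10 by ring.
have a4 : l ^+ 10 <= 78 ^+ 12 * X ^+ 2.
  by apply: le_trans log_pow12_le; rewrite ler_weXn2l.
have a5 : order_const ^+ 4 * 83 * 249 * U ^+ 6 * X ^+ 11 * l ^+ 10 <=
   order_const ^+ 4 * 83 * 249 * U ^+ 6 * X ^+ 11 * (78 ^+ 12 * X ^+ 2).
  by rewrite ler_wpM2l ?a4 // !mulr_ge0 ?exprn_ge0 ?ler0n ?(ltW k0) ?(ltW u0) ?(ltW X0).
have a6 : n%:R * (2 * c)^-1 * (2 * c * order_const ^+ 4 * 83 * 249 * 78 ^+ 12 * U ^+ 6) =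
  order_const ^+ 4 * 83 * 249 * U ^+ 6 * X ^+ 11 * (78 ^+ 12 * X ^+ 2).
  by rewrite nX; field; rewrite gt_eqF.
have DL0 : 0 < D%:R * L%:R :> R by rewrite -natrM ltr0n muln_gt0 degree_gt0 len_gt0.
rewrite -(ler_pM2r DL0); apply: le_trans a2 _; rewrite a3; apply: le_trans a5 _.
rewrite -a6 -/prime_const mulrC -[leRHS]mulrA ler_wpM2l //.
  by rewrite mulr_ge0 ?exprn_ge0 ?(ltW u0) // /prime_const !mulr_ge0 ?exprn_ge0 ?ler0n ?(ltW k0) ?(ltW c0).
rewrite ler_pdivrMr ?mulr_gt0 //; apply: le_trans h _.
by rewrite le_eqVlt; apply/orP; left; apply/eqP; ring.
Qed.

Variable s : R.
Hypothesis s0 : 0 < s.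

Lemma order_bound_div_sqrt_le : (K ^ 2)%:R / Num.sqrt (s * n.+1%:R) <= Num.sqrt (coef_const / s) * U ^+ 3.
Proof.
have n0 : 0 < n%:R :> R by rewrite ltr0n.
have l1 := log_ge1; have x1 := X1; have u0 := U0; have k0 := order_const_gt0; have ss := s0.
have X0 : 0 < X := lt_le_trans ltr01 X1.
have sn : 0 < s * n.+1%:R by rewrite mulr_gt0.
apply: sqr_bound.
  by rewrite /coef_const divr_ge0 ?(ltW s0) // mulr_ge0 // exprn_ge0 // ltW.
rewrite natrX expr_div_n -exprM sqr_sqrtr ?(ltW sn) // ler_pdivrMr //.
apply: le_trans order_bound_pow4_le _.
have a4 : l ^+ 8 <= 78 ^+ 12 * X ^+ 2.
  by apply: le_trans log_pow12_le; rewrite ler_weXn2l.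
apply: le_trans (_ : order_const ^+ 4 * ((78 ^+ 12 * X ^+ 2) * X ^+ 8 * U ^+ 4) <= _).
  by rewrite ler_wpM2l ?exprn_ge0 ?(ltW k0) // !ler_wpM2r ?exprn_ge0 //; lra.
(* [K ^ 4] provides only [U ^+ 4]; the missing [U ^+ 2] is bought with [(X * U) ^+ 2 >= 1]. *)
apply: le_trans (_ : order_const ^+ 4 * ((78 ^+ 12 * X ^+ 2) * X ^+ 8 * U ^+ 4) * (X * U) ^+ 2 <= _).
  rewrite -[leLHS]mulr1 ler_wpM2l ?exprn_ege1 ?scale_ge1 //.
  by rewrite !mulr_ge0 ?exprn_ge0 //; lra.
have -> : order_const ^+ 4 * (78 ^+ 12 * X ^+ 2 * X ^+ 8 * U ^+ 4) * (X * U) ^+ 2 = coef_const * U ^+ 6 * X ^+ 12.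
  by rewrite /coef_const; ring.
have -> : coef_const / s * U ^+ 6 * (s * n.+1%:R) = coef_const * U ^+ 6 * n.+1%:R.
  by field; rewrite gt_eqF.
rewrite ler_wpM2l //; first by rewrite mulr_ge0 ?exprn_ge0 ?(ltW u0) // mulr_ge0 // exprn_ge0 // ltW.
apply: le_trans (_ : n%:R <= _); last by rewrite ler_nat.
by rewrite nX ler_weXn2l.
Qed.
End Scales.

Local Open Scope classical_set_scope.
Local Open Scope ring_scope.

(** * From random variables to finite sums *)

(** The sets [E c] need to cover only up to a null set: the lower bounds for [S] and its complement
    add up to 1, so both are equalities. *)
Lemma probability_fin_partition (R : realType) d (Om : measurableType d) (P : probability Om R)
  (C : finType) (E : C -> set Om) (w : C -> R) (B : pred C) (S : set Om) :
  (forall c, measurable (E c)) -> trivIset setT E ->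
  (forall c, P (E c) = (w c)%:E) -> \sum_c w c = 1 -> measurable S ->
  (forall c, B c -> E c `<=` S) -> (forall c, ~~ B c -> E c `<=` ~` S) ->
  P S = (\sum_(c | B c) w c)%:E.
Proof.
move=> mE tE PE w1 mS BS BnS.
have ge (B' : pred C) (S' : set Om) : measurable S' -> (forall c, B' c -> E c `<=` S') ->
    ((\sum_(c | B' c) w c)%:E <= P S')%E.
  move=> mS' BS'.
  have fB : finite_set [set` B'] by apply: finite_finset.
  have tB : trivIset [set` B'] E by apply: sub_trivIset tE.
  have mB i : [set` B'] i -> measurable (E i) by [].
  have e : P (\bigcup_(i in [set` B']) E i) = (\sum_(c | B' c) (w c)%:E)%E.
    rewrite (measure_fin_bigcup P fB tB mB).
    rewrite -(@bigfs _ _ _ _ (index_enum C)) ?index_enum_uniq //; last first.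
      by move=> i _; rewrite mem_index_enum.
    by apply: eq_bigr => c _; apply: PE.
  rewrite -sumEFin -e.
  apply: le_measure; rewrite ?inE //; first exact: fin_bigcup_measurable.
  by move=> x [c /= Bc]; apply: BS'.
apply/eqP; rewrite eq_le ge // andbT.
have := ge (predC B) (~` S) (measurableC mS) BnS.
rewrite probability_setC // => h.
have fS : P S \is a fin_num by apply: fin_num_measure.
move: h; rewrite -(fineK fS) -EFinB !lee_fin.
have := w1; rewrite (bigID B) /= => {}w1 h; move: w1 h; set x := \sum_(c | B c) _.
by set y := \sum_(c | ~~ B c) _; set z := fine _ => w1 h; rewrite -w1 in h; lra.
Qed.

Lemma coef_poly_of_coefs p n (c : {ffun 'I_n.+1 -> 'F_p}) (i : 'I_n.+1) :
  (poly_of_coefs c)`_i = c i.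
Proof.
rewrite /poly_of_coefs coef_sum (bigD1 i) //= coefZ coefXn eqxx mulr1 big1 ?addr0 // => j ji.
by rewrite coefZ coefXn; case: eqP => e; rewrite ?mulr0 //; rewrite -val_eqE /= e eqxx in ji.
Qed.

Lemma poly_of_coefs_inj p n : injective (@poly_of_coefs p n).
Proof. by move=> c c' e; apply/ffunP => i; rewrite -!coef_poly_of_coefs e. Qed.

Lemma size_poly_of_coefs p n (c : {ffun 'I_n.+1 -> 'F_p}) : (size (poly_of_coefs c) <= n.+1)%N.
Proof.
apply: (leq_trans (size_sum _ _ _)); apply/bigmax_leqP => i _.
by apply: leq_trans (size_scale_leq _ _) _; rewrite size_polyXn.
Qed.

Section Laws.
Variables (R : realType) (p n : nat).
Hypothesis pp : prime p.
Notation C := {ffun 'I_n.+1 -> 'F_p}.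

Section Iid.
Variables (mu : probability (discrete 'F_p) R).
Variables (d : measure_display) (Om : measurableType d) (P : probability Om R)
  (eps : 'I_n.+1 -> {RV P >-> discrete 'F_p}).
Hypothesis indep : mutually_independent eps.
Hypothesis law : forall (i : 'I_n.+1) (B : set (discrete 'F_p)),
  distribution P (eps i) B = mu B.

Definition atom (a : 'F_p) : R := fine (mu [set a]).

Lemma atomE (a : 'F_p) : mu [set a] = (atom a)%:E.
Proof. by rewrite /atom fineK // fin_num_measure. Qed.

Lemma atom_ge0 a : 0 <= atom a.
Proof. by rewrite /atom fine_ge0. Qed.

Lemma atom_sum : \sum_a atom a = 1.
Proof.
have tS : trivIset [set: 'F_p] (fun a : 'F_p => [set a] : set (discrete 'F_p)).
  by apply/trivIsetP => i j _ _ ij; apply/seteqP; split => // x [-> e]; rewrite e eqxx in ij.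
have fS : finite_set [set: 'F_p] by apply: finite_finset.
have mS (i : 'F_p) : [set: 'F_p] i -> measurable ([set i] : set (discrete 'F_p)) by [].
have := measure_fin_bigcup mu fS tS mS.
have -> : \bigcup_(i in [set: 'F_p]) ([set i] : set (discrete 'F_p)) = [set: discrete 'F_p].
  by apply/seteqP; split => // x _; exists x.
have e1 : mu [set: discrete 'F_p] = 1%:E := probability_setT mu.
move=> e0; apply: EFin_inj; rewrite -sumEFin -e1; apply: esym; apply: etrans e0 _.
have -> : [set: 'F_p] = [set` (xpredT : {pred 'F_p})] by apply/seteqP; split.
rewrite -(@bigfs _ _ _ _ (index_enum 'F_p)) ?index_enum_uniq //; last first.
  by move=> i _; rewrite mem_index_enum.
by apply: eq_bigr => a _; exact: atomE.
Qed.

Lemma atom_le a : atom a <= 1 - eta mu.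
Proof.
rewrite /eta opprB addrC subrK.
exact: (@le_bigmax _ _ _ 0 (fun x : 'F_p => fine (mu [set x])) a).
Qed.

Lemma random_polyE w : random_poly eps w = poly_of_coefs [ffun i => (eps i w : 'F_p)].
Proof. by apply: eq_bigr => i _; rewrite ffunE. Qed.

Lemma prob_random_poly m (A : set (discrete {ffun 'I_m -> nat})) :
  P ((fun w => Nprimes m (random_poly eps w)) @^-1` A) =
  (mass (coef_weight (fun _ : 'I_n.+1 => atom))
     (fun c => `[< A (Nprimes m (poly_of_coefs c)) >]))%:E.
Proof.
pose E (c : C) : set Om := \bigcap_(i in [set: 'I_n.+1]) (eps i @^-1` [set c i]).
have mE c : measurable (E c).
  apply: fin_bigcap_measurable => [|i _]; first exact: finite_finset.
  by rewrite -[X in measurable X]setTI; apply: measurable_funP.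
have PE c : P (E c) = (coef_weight (fun _ : 'I_n.+1 => atom) c)%:E.
  rewrite /E (indep (B := fun i => [set c i])) //.
  rewrite /coef_weight (big_morph EFin (fun x y => EFinM x y) erefl).
  by apply: eq_bigr => i _; rewrite -atomE -(law i).
have tE : trivIset setT E.
  apply/trivIsetP => c c' _ _ cc'; apply/seteqP; split => // w [h h'].
  case/eqP: cc'; apply/ffunP => i.
  by have := h i I; have := h' i I; rewrite /= => -> ->.
have SE : (fun w => Nprimes m (random_poly eps w)) @^-1` A =
    \bigcup_(c in [set c : C | `[< A (Nprimes m (poly_of_coefs c)) >]]) E c.
  apply/seteqP; split => w /=.
    move=> Aw; exists [ffun i => (eps i w : 'F_p)] => /=; first by apply/asboolP; rewrite -random_polyE.
    by move=> i _ /=; rewrite ffunE.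
  case=> c /= /asboolP Ac Ew; rewrite random_polyE.
  suff -> : [ffun i => (eps i w : 'F_p)] = c by [].
  by apply/ffunP => i; rewrite ffunE; apply: Ew.
apply: (@probability_fin_partition R d Om P C E _ _ _ mE tE PE) => //.
- by apply: coef_weight_sum => i; apply: atom_sum.
- rewrite SE; apply: fin_bigcup_measurable => [|c _]; [exact: finite_finset|exact: mE].
- by move=> c Bc w Ew; rewrite SE; exists c.
- move=> c Bc w Ew; rewrite SE => -[c' /= Bc' Ew'].
  suff e : c = c' by rewrite e Bc' in Bc.
  by apply/ffunP => i; have := Ew i I; have := Ew' i I; rewrite /= => -> ->.
Qed.
End Iid.

Section Monic.
Variables (d : measure_display) (Om : measurableType d) (P : probability Om R)
  (g : {RV P >-> discrete {poly 'F_p}}).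
Hypothesis unif : uniform_monic n g.

Lemma prob_monic_poly m (A : set (discrete {ffun 'I_m -> nat})) :
  P ((fun w => Nprimes m (g w : {poly 'F_p})) @^-1` A) =
  (mass (coef_weight (@monic_law R p n))
     (fun c => `[< A (Nprimes m (poly_of_coefs c)) >]))%:E.
Proof.
(* Vectors with leading coefficient other than 1 have weight 0 under [monic_law] and get the empty
   event, which allows one index type for both laws. *)
pose E (c : C) : set Om := if c ord_max == 1 then g @^-1` [set poly_of_coefs c] else set0.
have mg (B : set (discrete {poly 'F_p})) : measurable (g @^-1` B).
  by rewrite -[X in measurable X]setTI; apply: measurable_funP.
have mE c : measurable (E c) by rewrite /E; case: ifP.
have PE c : P (E c) = (coef_weight (@monic_law R p n) c)%:E.
  have wE : coef_weight (@monic_law R p n) c = p%:R ^- n * (c ord_max == 1)%:R.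
    rewrite /coef_weight big_ord_recr /= /monic_law ltnn.
    rewrite (eq_bigr (fun=> p%:R^-1)); last by move=> i _; rewrite /= ltn_ord.
    by rewrite prodr_const card_ord exprVn.
  rewrite wE /E; case: eqP => [c1|_]; last by rewrite measure0 mulr0.
  have cn : (poly_of_coefs c)`_n = 1 by rewrite -[n]/(@nat_of_ord n.+1 ord_max) coef_poly_of_coefs.
  have sz : size (poly_of_coefs c) = n.+1.
    apply/eqP; rewrite eqn_leq size_poly_of_coefs ltnNge; apply/negP => h.
    by have := oner_neq0 'F_p; rewrite -cn nth_default ?eqxx.
  rewrite (unif (poly_of_coefs c)) monicE lead_coefE sz /= cn !eqxx /= mulr1.
  by rewrite card_Fp // natrX.
have tE : trivIset setT E.
  apply/trivIsetP => c c' _ _ cc'; apply/seteqP; split => // w [].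
  rewrite /E; case: ifP => // _ /= e; case: ifP => // _ /= e'.
  by case/eqP: cc'; apply: (@poly_of_coefs_inj p n); rewrite -e -e'.
apply: (@probability_fin_partition R d Om P C E _ _ _ mE tE PE) => //.
- by apply: coef_weight_sum => i; apply: monic_law_sum.
- exact: (mg [set h | A (Nprimes m (h : {poly 'F_p}))]).
- by move=> c /asboolP Bc w; rewrite /E; case: ifP => // _ /= ->.
- by move=> c /asboolP Bc w; rewrite /E; case: ifP => // _ /= ->.
Qed.
End Monic.
End Laws.

Lemma dTV_le (R : realType) d (T : measurableType d) (mu nu : set T -> \bar R) (b : R) :
  (forall A, measurable A -> `|fine (mu A) - fine (nu A)| <= b) -> dTV mu nu <= b.
Proof.
move=> h; apply: ge_sup; last by move=> x [A mA <-]; apply: h.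
by exists `|fine (mu set0) - fine (nu set0)|, set0.
Qed.

Lemma mass_diff_le1 (R : realType) (T : finType) (w w' : T -> R) (A : pred T) :
  (forall t, 0 <= w t) -> (forall t, 0 <= w' t) -> mass w xpredT = 1 -> mass w' xpredT = 1 ->
  `|mass w A - mass w' A| <= 1.
Proof.
have aux (v : T -> R) : (forall t, 0 <= v t) -> mass v xpredT = 1 -> 0 <= mass v A <= 1.
  move=> v0 v1; rewrite sumr_ge0 //= -v1 /mass [leRHS](bigID A) /= lerDl.
  by apply: sumr_ge0.
move=> w0 w0' w1 w1'; have := aux w w0 w1; have := aux w' w0' w1'.
rewrite ler_norml; lra.
Qed.

Theorem corollary1p7 (R : realType) (delta eta0 : R) :
  0 < delta -> 0 < eta0 ->
  exists A : R,
  forall (n p : nat) (mu : probability (discrete 'F_p) R),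
    (1 <= n)%N -> prime p -> p%:R <= expR (n%:R `^ 13^-1) :> R ->
    eta mu = eta0 ->
  forall (d : measure_display) (Omega : measurableType d)
         (P : probability Omega R)
         (eps : 'I_n.+1 -> {RV P >-> discrete 'F_p}),
    mutually_independent eps ->
    (forall (i : 'I_n.+1) (B : set (discrete 'F_p)),
       distribution P (eps i) B = mu B) ->
  forall (d' : measure_display) (Omega' : measurableType d')
         (P' : probability Omega' R)
         (fbar : {RV P' >-> discrete {poly 'F_p}}),
    uniform_monic n fbar ->
  let m := Num.truncn (n%:R `^ (13^-1 - delta)) in
  dTV (pushforward P (fun w => Nprimes m (random_poly eps w)))
      (pushforward P' (fun w => Nprimes m (fbar w : {poly 'F_p})))
    <= A * n%:R `^ (- 3 * delta).
Proof.
move=> delta0 eta00.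
pose c : R := density_const eta0; pose s := slope R * eta0 / 2.
have sl0 := slope_gt0 R.
have c0 : 0 < c by rewrite divr_gt0 // mulr_gt0.
have s0 : 0 < s by rewrite divr_gt0 // mulr_gt0.
(* The second term is for [X] below its threshold, 3 for the sieve error, and the last two for
   exceptional factors, with coefficients from [3 / p] and [4 / sqrt]. *)
exists (1 + `|scale_min c| ^+ 3 + 3 + 3 * Num.sqrt (prime_const c) + 4 * Num.sqrt (coef_const R / s)).
set A0 := _ + _ + _ + _ + _.
have q0 := sqrtr_ge0 (prime_const c); have q1 := sqrtr_ge0 (coef_const R / s).
have x0 : 0 <= `|scale_min c| ^+ 3 by rewrite exprn_ge0.
move=> n p mu n1 pp pe etamu d Om P eps indep law d' Om' P' fbar unif; cbv zeta.
set m := Num.truncn _.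
have n0 : 0 < n%:R :> R by rewrite ltr0n.
pose X := n%:R `^ 13^-1 : R; pose U := n%:R `^ (- delta) : R.
have nX : n%:R = X ^+ 13.
  by rewrite /X -powR_mulrn ?powR_ge0 // -powRrM mulVf ?pnatr_eq0 // powRr1 // ltW.
have X1 : 1 <= X by rewrite /X -[leLHS](powRr0 n%:R) ler_powR ?ler1n // invr_ge0.
have U0 : 0 < U by rewrite powR_gt0.
have U1 : U <= 1 by rewrite /U -[leRHS](powRr0 n%:R) ler_powR ?ler1n // oppr_le0 ltW.
have U3 : n%:R `^ (- 3 * delta) = U ^+ 3.
  by rewrite /U -powR_mulrn ?powR_ge0 // -powRrM; congr (_ `^ _); ring.
have mE : n%:R `^ (13^-1 - delta) = X * U.
  by rewrite /X /U powRD //; apply/implyP => _; rewrite gt_eqF.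
have XU0 : 0 <= X * U by rewrite mulr_ge0 ?(ltW U0) // (le_trans _ X1).
have mXU : m%:R <= X * U by rewrite /m mE truncn_le.
rewrite U3; apply: dTV_le => S mS; rewrite /pushforward.
rewrite (prob_random_poly indep law) (prob_monic_poly pp unif) /=.
have at0 := atom_ge0 mu; have at1 := atom_sum mu.
have atle a : atom mu a <= 1 - eta0 by rewrite -etamu atom_le.
have wf1 : mass (coef_weight (fun _ : 'I_n.+1 => atom mu)) xpredT = 1.
  exact: mass_iid_total.
have wu1 : mass (coef_weight (@monic_law R p n)) xpredT = 1 by apply: mass_monic_total.
have U30 : 0 < U ^+ 3 by rewrite exprn_gt0.
have A00 : 0 <= A0 by rewrite /A0; lra.
(* For [m = 0] the count vectors have no coordinates and both laws agree. *)
have [m0|m0] := posnP m.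
  have NE (g g' : {poly 'F_p}) : Nprimes m g = Nprimes m g' :> discrete {ffun 'I_m -> nat}.
    by apply/ffunP => j; have := ltn_ord j; rewrite {2}m0.
  have e (w : {ffun 'I_n.+1 -> 'F_p} -> R) : mass w xpredT = 1 ->
      mass w (fun x => `[< S (Nprimes m (poly_of_coefs x)) >]) = (`[< S (Nprimes m (0 : {poly 'F_p})) >])%:R.
    move=> w1; rewrite massE; under eq_bigr => x _ do rewrite (NE (poly_of_coefs x) 0).
    by rewrite -mulr_suml -[X in X * _]/(mass w xpredT) w1 mul1r.
  by rewrite (e _ wf1) (e _ wu1) subrr normr0 mulr_ge0 // ltW.
have sc1 := scale_ge1 m0 mXU.
(* For bounded [X] the trivial bound is enough: [1 <= (X * U) ^+ 3], because [m >= 1] forces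
   [X * U >= 1]. *)
have [Xs|Xl] := ltP X (scale_min c).
  apply: le_trans (_ : 1 <= _).
    apply: mass_diff_le1 => // t; apply: prodr_ge0 => i _ //.
    exact: monic_law_ge0.
  apply: le_trans (_ : (X * U) ^+ 3 <= _); first by rewrite exprn_ege1.
  rewrite exprMn ler_wpM2r ?(ltW U30) //.
  apply: le_trans (_ : `|scale_min c| ^+ 3 <= _); last by rewrite /A0; lra.
  rewrite lerXn2r ?nnegrE ?(le_trans ler01 X1) //.
  by apply: le_trans (ler_norm _); apply: ltW.
have p1 := prime_gt1 pp.
pose r := (Num.truncn (20 * (1 + ln n%:R) : R)).*2.+1.
have r_odd : odd r by rewrite /r /= odd_double.
have Dn := degree_bound_le_n n1 nX X1 U0 U1 p1 pe m0 mXU c0 Xl.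
have rerr := sieve_error_le n1 nX X1 U0 U1 m0 mXU.
have [small|large] := small_or_large_prime n1 nX X1 U0 U1 p1 pe m0 mXU c0 Xl.
  apply: le_trans (final_bound_small_prime pp at0 at1 eta00 atle r_odd m0 Dn (fun g => `[< S g >]) small) _.
  by apply: le_trans rerr _; rewrite ler_wpM2r ?(ltW U30) // /A0; lra.
have lc := large_condition n1 nX X1 U0 U1 p1 pe m0 mXU c0 Xl.
apply: le_trans (final_bound_large_prime pp at0 at1 eta00 atle r_odd m0 Dn (fun g => `[< S g >]) lc) _.
have k1 := order_bound_div_prime_le n1 nX X1 U0 U1 p1 pe m0 mXU c0 Xl large.
have k2 := order_bound_div_sqrt_le n1 nX X1 U0 U1 p1 pe m0 mXU s0.
have e : slope R * eta0 * n.+1%:R / 2 = s * n.+1%:R by rewrite /s; ring.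
rewrite e.
apply: le_trans (lerD (_ : _ <= 3 * (Num.sqrt (prime_const c) * U ^+ 3) + 4 * (Num.sqrt (coef_const R / s) * U ^+ 3)) rerr) _.
  by rewrite mulrDr lerD // mulrCA ler_wpM2l.
rewrite /A0 -subr_ge0; set a := Num.sqrt _; set b := Num.sqrt _; set u := U ^+ 3; set x := `|_| ^+ 3.
have -> : (1 + x + 3 + 3 * a + 4 * b) * u - (3 * (a * u) + 4 * (b * u) + 3 * u) = (1 + x) * u by ring.
by rewrite mulr_ge0 ?(ltW U30) // addr_ge0.
Qed.
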